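(* Let $\phi$ be a pair potential on $\mathbb{R}^d$ with $\phi(x)\ge0$ for all $x\in\mathbb{R}^d$ and $\int_{\mathbb{R}^d}|1-e^{-\phi(x)}|\,dx<\infty$, let $z>0$ and $\mu\in\mathcal{G}(z,\phi)$. Then the operator $(H,\mathcal{F}C_b^\infty(\mathcal{D},\Gamma))$, given by $$HF(\gamma)=\int_{\mathbb{R}^d}z\,dx\,\exp[-E(x,\gamma)]\,D^+_xF(\gamma)-\int_{\mathbb{R}^d}\gamma(dx)\,D^-_xF(\gamma),$$ is essentially selfadjoint in $L^2(\Gamma,\mu)$. In particular, the Friedrichs extension of $(H,\mathcal{F}C_b^\infty(\mathcal{D},\Gamma))$ coincides with its closure.
   Context: Configuration space. $\Gamma$ is the set of all locally finite subsets $\gamma\subset\mathbb{R}^d$, $d\in\mathbb{N}$; $\gamma$ is identified with the Radon measure $\sum_{x\in\gamma}\varepsilon_x$, and $\langle f,\gamma\rangle:=\sum_{x\in\gamma}f(x)$. $\Gamma$ carries the vague topology (weakest topology making $\gamma\mapsto\langle f,\gamma\rangle$ continuous for all $f\in\mathcal{D}:=C_0(\mathbb{R}^d)$, the continuous real functions with compact support) and its Borel $\sigma$-algebra $\mathcal{B}(\Gamma)$. We write $x$ for $\{x\}$. Gibbs measures. A pair potential is a Borel function $\phi:\mathbb{R}^d\to\mathbb{R}\cup\{+\infty\}$ with $\phi(-x)=\phi(x)\in\mathbb{R}$ for $x\ne0$. For $x\notin\gamma$, $E(x,\gamma):=\sum_{y\in\gamma}\phi(x-y)$ if $\sum_{y\in\gamma}|\phi(x-y)|<\infty$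 and $+\infty$ otherwise. For $z>0$, $\mathcal{G}(z,\phi)$ is the set of probability measures $\mu$ on $(\Gamma,\mathcal{B}(\Gamma))$ with $$\int_\Gamma\mu(d\gamma)\int_{\mathbb{R}^d}\gamma(dx)F(\gamma,x)=\int_\Gamma\mu(d\gamma)\int_{\mathbb{R}^d}z\,dx\,e^{-E(x,\gamma)}F(\gamma\cup x,x)$$ for all measurable $F:\Gamma\times\mathbb{R}^d\to[0,+\infty]$. Operator. $\mathcal{F}C_b^\infty(\mathcal{D},\Gamma)$ is the set of ($\mu$-classes of) functions $F(\gamma)=g_F(\langle\varphi_1,\gamma\rangle,\dots,\langle\varphi_N,\gamma\rangle)$, $N\in\mathbb{N}$, $\varphi_i\in\mathcal{D}$, $g_F\in C_b^\infty(\mathbb{R}^N)$ (smooth, bounded together with all derivatives); it is dense in $L^2(\Gamma,\mu)$. $D^-_xF(\gamma):=F(\gamma\setminus x)-F(\gamma)$, $D^+_xF(\gamma):=F(\gamma)-F(\gamma\cup x)$. The operator $H$ maps $\mathcal{F}C_b^\infty(\mathcal{D},\Gamma)$ into $L^2(\Gamma,\mu)$ and is symmetric and nonnegative there, so it has a Friedrichs extension. *)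

(* Defs.v *)
From HB Require Import structures.
From mathcomp Require Import all_boot all_order all_algebra.
From mathcomp Require Import all_classical all_reals all_analysis.
From mathcomp Require Import measurable_realfun.

Set Implicit Arguments.
Unset Strict Implicit.
Unset Printing Implicit Defensive.

Import Order.TTheory GRing.Theory Num.Theory.
Import numFieldNormedType.Exports.

Local Open Scope classical_set_scope.
Local Open Scope ring_scope.

(* ['rV[R]_n] carries its Borel sigma-algebra. *)
HB.instance Definition _ (R : realType) (n : nat) :=
  Measurable.copy 'rV[R]_n (g_sigma_algebraType (@open 'rV[R]_n)).

Section lebesgue_row_vector.
Variable R : realType.

Lemma measurable_rV_open n (A : set 'rV[R]_n) : open A -> measurable A.
Proof. exact: sub_gen_smallest. Qed.

Lemma open_rV_cubes n (A : set 'rV[R]_n) : open A ->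
  A = \bigcup_(qk in [set: 'rV[rat]_n * nat])
        [set v | ball (map_mx ratr qk.1 : 'rV[R]_n) qk.2.+1%:R^-1 `<=` A
              /\ ball (map_mx ratr qk.1 : 'rV[R]_n) qk.2.+1%:R^-1 v].
Proof.
move=> oA; apply/seteqP; split=> [v Av|v [qk _ /=[+ vb]]]; last exact.
have /nbhs_ballP[e/= e0 vA] : nbhs v A by exact: open_nbhs_nbhs.
have [k] : exists k : nat, k.+1%:R^-1 < e / 2.
  have /ltr_add_invr[k] : 0 < e / 2 by rewrite divr_gt0.
  by rewrite add0r => ?; exists k.
move=> ke.
have k0 : 0 < k.+1%:R^-1 :> R by rewrite invr_gt0.
have h i : {q : rat | v 0 i - k.+1%:R^-1 < ratr q < v 0 i + k.+1%:R^-1}.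
  apply: cid; have /rat_in_itvoo[q] : v 0 i - k.+1%:R^-1 < v 0 i + k.+1%:R^-1.
    by rewrite ltrBlDr -addrA ltrDl addr_gt0 ?k0.
  by rewrite in_itv/=; exists q.
have bv : ball (map_mx ratr (\row_i projT1 (h i)) : 'rV[R]_n) k.+1%:R^-1 v.
  split=> // i j; rewrite !mxE ord1 /ball/= distrC.
  by rewrite distrC ltr_distl; exact: (projT2 (h j)).
exists (\row_i projT1 (h i), k) => //; split=> //= w bw; apply: vA.
apply: (@le_ball _ _ _ (k.+1%:R^-1 + k.+1%:R^-1)).
  by rewrite (splitr e) lerD// ltW.
exact: ball_triangle (ball_sym bv) bw.
Qed.

(* [row_cons] identifies R x R^n with R^(n+1). *)
Definition row_cons n (p : measurableTypeR R * 'rV[R]_n) : 'rV[R]_n.+1 := row_mx p.1%:M p.2.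

Definition row_split n (v : 'rV[R]_n.+1) : measurableTypeR R * 'rV[R]_n :=
  (v 0 0, @rsubmx R 1 1 n v).

Lemma row_splitK n : cancel (@row_split n) (@row_cons n).
Proof.
move=> v; rewrite /row_cons /row_split/=.
rewrite -[RHS](@hsubmxK R 1 1 n); congr (@row_mx R 1 1 n _ _).
apply/rowP => i; rewrite !mxE !ord1 eqxx mulr1n; congr (v _ _).
by apply: val_inj.
Qed.

Lemma row_cons0 n p : @row_cons n p 0 0 = p.1.
Proof.
have h (j : 'I_n.+1) : j = lshift n (0 : 'I_1) -> row_cons p 0 j = p.1.
  by move=> ->; rewrite /row_cons (@row_mxEl R 1 1 n) mxE.
by apply: h; exact: val_inj.
Qed.

Lemma row_consS n p (j : 'I_n) : @row_cons n p 0 (rshift 1 j) = p.2 0 j.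
Proof. exact: (@row_mxEr R 1 1 n). Qed.

Lemma row_consK n : cancel (@row_cons n) (@row_split n).
Proof.
move=> p; rewrite [RHS]surjective_pairing /row_split row_cons0; congr pair.
exact: row_mxKr.
Qed.

Lemma measurable_row_cons n : measurable_fun setT (@row_cons n).
Proof.
apply: (@measurability _ _ _ _ _ _ (@open 'rV[R]_n.+1)) => // _ [A oA <-].
rewrite setTI (open_rV_cubes oA) preimage_bigcup.
apply: countable_bigcupT_measurable => // -[q k].
have [qA|qA] := pselect (ball (map_mx ratr q : 'rV[R]_n.+1) k.+1%:R^-1 `<=` A);
    last by rewrite [X in measurable X](_ : _ = set0)//; apply/seteqP; split=> // p [].
pose c : 'rV[R]_n.+1 := map_mx ratr q.
rewrite [X in measurable X](_ : _ =
    ball ((row_split c).1) k.+1%:R^-1 `*` ball ((row_split c).2) k.+1%:R^-1).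
  apply: measurableX; first exact: measurable_ball.
  apply: measurable_rV_open. apply: ball_open.
apply/seteqP; split=> [p /= [_ [k0 h]]|p [/= h1 h2]].
  split=> /=.
    by have := h 0 0; rewrite row_cons0.
  by split=> // i j; have := h 0 (rshift 1 j); rewrite ord1 row_consS !mxE.
split=> //; split=> // i j; rewrite ord1.
case: (@split_ordP 1 n j) => j' ->.
  have -> : lshift n j' = 0 :> 'I_n.+1 by apply: val_inj; rewrite /= ord1.
  by rewrite row_cons0; move: h1; rewrite !mxE.
by rewrite row_consS; have [_ /(_ 0 j')] := h2; rewrite !mxE.
Qed.

Lemma measurable_row_split n : measurable_fun setT (@row_split n).
Proof.
apply/measurable_fun_pairP; split.
  apply: (measurability _ (RGenOpens.measurableE R)) => _ [_ [a [b ->] <-]].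
  rewrite setTI; apply: measurable_rV_open; apply: open_comp.
    by move=> v _; exact: coord_continuous.
  exact: interval_open.
apply: (@measurability _ _ _ _ _ _ (@open 'rV[R]_n)) => // _ [A oA <-].
rewrite setTI; apply: measurable_rV_open; apply: open_comp => // v _.
move=> B /nbhs_ballP[e /= e0 eB]; apply/nbhs_ballP; exists e => //= w [_ vw].
by apply: eB; split=> // i j; rewrite !mxE; exact: vw.
Qed.

Section step.
Variables (n : nat) (m : {sigma_finite_measure set 'rV[R]_n -> \bar R}).

Definition lebesgue_cons : set 'rV[R]_n.+1 -> \bar R :=
  pushforward (lebesgue_measure \x m)%E (@row_cons n).

Let mprod : {measure set (measurableTypeR R * 'rV[R]_n)%type -> \bar R} :=
  (lebesgue_measure \x m)%E.

Let measurable_preimage A : measurable A -> measurable (@row_cons n @^-1` A).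
Proof. by move=> mA; rewrite -[X in measurable X]setTI; exact: measurable_row_cons. Qed.

Let lebesgue_cons0 : lebesgue_cons set0 = 0%E.
Proof. by rewrite /lebesgue_cons /pushforward preimage_set0 (measure0 mprod). Qed.

Let lebesgue_cons_ge0 A : (0 <= lebesgue_cons A)%E.
Proof. exact: (measure_ge0 mprod). Qed.

Let lebesgue_cons_sigma_additive : semi_sigma_additive lebesgue_cons.
Proof.
move=> F mF tF mUF; rewrite /lebesgue_cons /pushforward preimage_bigcup.
apply: (@measure_semi_sigma_additive _ _ _ mprod).
- by move=> i; exact: measurable_preimage.
- apply/trivIsetP => /= i j _ _ ij; rewrite -preimage_setI.
  by move/trivIsetP : tF => /(_ _ _ _ _ ij) ->//; rewrite preimage_set0.
- by rewrite -preimage_bigcup; exact: measurable_preimage.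
Qed.

HB.instance Definition _ := isMeasure.Build _ _ _ lebesgue_cons
  lebesgue_cons0 lebesgue_cons_ge0 lebesgue_cons_sigma_additive.

Let lebesgue_cons_sigma_finite : sigma_finite setT lebesgue_cons.
Proof.
have /sigma_finiteP[F [TF ndF Foo]] := sigma_finiteT (@lebesgue_measure R).
have /sigma_finiteP[G [TG ndG Goo]] := sigma_finiteT m.
exists (fun k => @row_split n @^-1` (F k `*` G k)).
  rewrite -preimage_bigcup [X in _ @^-1` X](_ : _ = setT) ?preimage_setT//.
  apply/esym; rewrite -setXTT TF TG predeqE => -[x y]; split.
    move=> [/= [i _ Fnx] [k _ Gky]]; exists (maxn i k) => //; split.
    - by move: x Fnx; exact/subsetPset/ndF/leq_maxl.
    - by move: y Gky; exact/subsetPset/ndG/leq_maxr.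
  by move=> [i _ []/= ? ?]; split; exists i.
move=> k; have [mF Fk] := Foo k; have [mG Gk] := Goo k; split.
  by rewrite -[X in measurable X]setTI; apply: measurable_row_split => //;
    exact: measurableX.
rewrite /lebesgue_cons /pushforward.
rewrite [X in (lebesgue_measure \x m)%E X](_ : _ = F k `*` G k).
  by rewrite product_measure1E// lte_mul_pinfty// ge0_fin_numE.
by apply/seteqP; split=> p; rewrite /preimage/mkset row_consK.
Qed.

HB.instance Definition _ := @Measure_isSigmaFinite.Build _ _ _ lebesgue_cons
  lebesgue_cons_sigma_finite.

End step.

(* Lebesgue measure on R^n, as the n-fold product of [lebesgue_measure]. *)
Fixpoint lebesgue_rV n : {sigma_finite_measure set 'rV[R]_n -> \bar R} :=
  match n with
  | 0 => \d_(0 : 'rV[R]_0)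
  | n'.+1 => lebesgue_cons (lebesgue_rV n')
  end.

Lemma measurable_rV_box n (a b : 'I_n -> R) :
  measurable [set v : 'rV[R]_n | forall i, v 0 i \in `[a i, b i]].
Proof.
rewrite -[X in measurable X]setCK; apply: measurableC; apply: measurable_rV_open.
apply: closed_openC.
rewrite (_ : mkset _ = \bigcap_i [set v : 'rV[R]_n | v 0 i \in `[a i, b i]]).
  apply: closed_bigI => i _.
  apply: (@preimage_closed _ _ (fun v : 'rV[R]_n => v 0 i) `[a i, b i]%classic).
    by move=> v _; exact: coord_continuous.
  exact: interval_closed.
by apply/seteqP; split=> [v h i _|v h i]; exact: h.
Qed.

Lemma lebesgue_rV_box n (a b : 'I_n -> R) : (forall i, a i <= b i) ->
  lebesgue_rV n [set v | forall i, v 0 i \in `[a i, b i]] =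
  (\prod_i (b i - a i))%:E.
Proof.
elim: n a b => [|n ih] a b ab.
  rewrite big_ord0 /= diracE mem_set//= => -[]//.
rewrite /= /lebesgue_cons /pushforward big_ord_recl EFinM.
rewrite -(ih (a \o lift ord0) (b \o lift ord0)); last by move=> i; exact: ab.
have -> : (b ord0 - a ord0)%:E =
    (lebesgue_measure (`[a ord0, b ord0]%classic : set R))%E.
  rewrite lebesgue_measure_itv/= lte_fin; case: ltP => //.
  by move=> ba; rewrite (@le_anti _ _ (a ord0) (b ord0)) ?ab// subrr.
rewrite -product_measure1E//; last exact: measurable_rV_box.
congr (_ _); rewrite predeqE => -[x v]; split=> [h|[h0 h] i].
  split=> [|i] /=; first by have := h 0; rewrite row_cons0.
  by have := h (lift ord0 i); rewrite -rshift1 row_consS.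
have [->|[j ->]] : i = 0 \/ exists j, i = rshift 1 j :> 'I_n.+1.
- case: (unliftP ord0 i) => [j ->|->]; last by left.
  by right; exists j; rewrite rshift1.
- by rewrite row_cons0.
- by rewrite row_consS rshift1; exact: h.
Qed.

End lebesgue_row_vector.
Arguments lebesgue_rV {R} n.

Section configurations.
Variables (R : realType) (d : nat).

Record config := Config {
  points :> set 'rV[R]_d;
  locally_finite : forall K : set 'rV[R]_d, compact K -> finite_set (points `&` K)
}.

HB.instance Definition _ := gen_eqMixin config.
HB.instance Definition _ := gen_choiceMixin config.

Lemma locally_finite0 (K : set 'rV[R]_d) : compact K -> finite_set (set0 `&` K).
Proof. by rewrite set0I. Qed.

HB.instance Definition _ := isPointed.Build config (Config locally_finite0).

Lemma locally_finiteU1 (g : config) x (K : set 'rV[R]_d) :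
  compact K -> finite_set ((g `|` [set x]) `&` K).
Proof.
move=> cK; rewrite setIUl finite_setU; split; first exact: locally_finite.
exact: finite_setIl.
Qed.

Lemma locally_finiteD1 (g : config) x (K : set 'rV[R]_d) :
  compact K -> finite_set ((g `\ x) `&` K).
Proof.
move=> cK; apply: sub_finite_set (locally_finite g cK).
by apply: setSI; exact: subDsetl.
Qed.

Definition addp (g : config) x : config := Config (@locally_finiteU1 g x).
Definition delp (g : config) x : config := Config (@locally_finiteD1 g x).

(* Continuous real functions with compact support *)
Definition test_fun : set ('rV[R]_d -> R) :=
  [set f | continuous f /\ compact (closure [set x | f x != 0])].

(* For a test function the sum has finitely many nonzero terms; [\sum_(_ \in _)]
   is 0 when the summand has infinite support on [g]. *)
Definition pairing (f : 'rV[R]_d -> R) (g : config) : R := \sum_(x \in g) f x.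

(* The coarsest topology making [pairing f] continuous for all test functions [f]. *)
Definition vague_topology : Type :=
  sup_topology (fun f : {f | test_fun f} =>
    Topological.on (initial_topology (pairing (sval f)))).

HB.instance Definition _ := Topological.copy config vague_topology.

HB.instance Definition _ :=
  Measurable.copy config (g_sigma_algebraType (@open config)).

End configurations.

Section gibbs.
Variables (R : realType) (d : nat).
Implicit Types (phi : 'rV[R]_d -> \bar R) (g : config R d) (x : 'rV[R]_d).

Definition pair_potential phi := [/\ measurable_fun setT phi,
  (forall x, phi x != -oo%E) &
  (forall x, x != 0 -> phi (- x) = phi x /\ phi x \is a fin_num)].

(* Also meaningful for [x] in [g], which only matters on a Lebesgue-null set of [x]. *)
Definition energy phi x g : \bar R :=
  let f := fun y => phi (x - y) in
  if `[< summable g f >] then (\esum_(y in g) f^\+ y - \esum_(y in g) f^\- y)%E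
  else +oo%E.

Definition gibbs (z : R) phi : set (probability (config R d) R) :=
  [set mu : probability (config R d) R | forall F : config R d * 'rV[R]_d -> \bar R,
    measurable_fun setT F -> (forall p, 0 <= F p)%E ->
    (\int[mu]_g (\esum_(x in g) F (g, x)) =
     \int[mu]_g (\int[lebesgue_rV d]_x
       (z%:E * expeR (- energy phi x g) * F (addp g x, x))))%E].

End gibbs.

Section cylinder_functions.
Variable R : realType.

Definition iter_partial N (s : seq 'I_N) (h : 'rV[R]_N -> R) : 'rV[R]_N -> R :=
  foldr (fun i f x => 'D_(delta_mx 0 i) f x) h s.

(* C_b^oo(R^N) *)
Definition smooth_bounded N : set ('rV[R]_N -> R) :=
  [set h | forall s : seq 'I_N, [/\ continuous (iter_partial s h),
    (forall x i, derivable (iter_partial s h) x (delta_mx 0 i)) &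
    exists M, forall x, `|iter_partial s h x| <= M]].

(* FC_b^oo(D, Gamma), as functions rather than as mu-classes *)
Definition cylinder d : set (config R d -> R) :=
  [set F | exists N (f : 'I_N -> 'rV[R]_d -> R) (h : 'rV[R]_N -> R),
    [/\ forall i, test_fun (f i), smooth_bounded h &
        forall g, F g = h (\row_i pairing (f i) g)]].

Variables (d : nat) (z : R) (phi : 'rV[R]_d -> \bar R).

Definition Dminus (F : config R d -> R) x g := F (delp g x) - F g.

Definition Dplus (F : config R d -> R) x g := F g - F (addp g x).

(* For a cylinder function [F], [Dminus F x g] vanishes for all but finitely
   many points [x] of [g]. *)
Definition generator (F : config R d -> R) (g : config R d) : R :=
  \int[lebesgue_rV d]_x (z * fine (expeR (- energy phi x g)) * Dplus F x g)
  - \sum_(x \in g) Dminus F x g.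

End cylinder_functions.

(* Unbounded operators in the real Hilbert space L^2(mu), given by their graphs *)
Section unbounded_operators.
Context disp (T : measurableType disp) (R : realType).
Variable mu : {measure set T -> \bar R}.
Local Notation L2 := (LspaceType2 mu).
Implicit Types (A : set (L2 * L2)) (u v w : L2).

(* An element of L^2(mu) as a real function: any representative *)
Definition fct u : T -> R := u.

Definition ip (f g : T -> R) : R := \int[mu]_x (f x * g x).

Definition cvg_L2 (u_ : L2^nat) u :=
  (fun n => 'N[mu]_2%:E[EFin \o (fct (u_ n) \- fct u)%R])%E @ \oo --> 0%E.

Definition domain A : set L2 := fst @` A.

Definition linear_operator A :=
  (forall u v v', A (u, v) -> A (u, v') -> v = v') /\
  (forall (a : R) p q r, A p -> A q ->
     fct r.1 = (fun x => a * fct p.1 x + fct q.1 x) %[ae mu] ->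
     fct r.2 = (fun x => a * fct p.2 x + fct q.2 x) %[ae mu] -> A r).

Definition densely_defined A :=
  forall u, exists u_ : L2^nat, (forall n, domain A (u_ n)) /\ cvg_L2 u_ u.

Definition op_closure A : set (L2 * L2) :=
  [set p : L2 * L2 | exists p_ : (L2 * L2)^nat, [/\ forall n, A (p_ n),
    cvg_L2 (fun n => (p_ n).1) p.1 & cvg_L2 (fun n => (p_ n).2) p.2]].

Definition adjoint A : set (L2 * L2) :=
  [set p : L2 * L2 | forall q, A q -> ip q.2 p.1 = ip q.1 p.2].

Definition symmetric_op A :=
  forall p q, A p -> A q -> ip p.2 q.1 = ip p.1 q.2.

Definition nonnegative_op A := forall p, A p -> 0 <= ip p.2 p.1.

Definition selfadjoint A :=
  [/\ linear_operator A, densely_defined A & adjoint A = A].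

Definition essentially_selfadjoint A :=
  [/\ linear_operator A, densely_defined A, symmetric_op A &
      selfadjoint (op_closure A)].

(* The closure of the form q(f, g) := (A f, g) with domain [domain A] *)
Definition form_approx A (p_ : (L2 * L2)^nat) u :=
  [/\ forall n, A (p_ n), cvg_L2 (fun n => (p_ n).1) u &
      forall e, 0 < e -> \forall m & n \near \oo,
        `|ip (fct (p_ m).2 \- fct (p_ n).2) (fct (p_ m).1 \- fct (p_ n).1)| < e].

Definition form_domain A : set L2 := [set u | exists p_, form_approx A p_ u].

Definition form_value A u w (c : R) :=
  exists p_ q_, [/\ form_approx A p_ u, form_approx A q_ w &
    (fun n => ip (p_ n).2 (q_ n).1) @ \oo --> c].

(* The operator associated with the closure of the form: (u, v) belongs to its
   graph iff u is in the domain of the closed form q and q(u, w) = (v, w) for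
   every w in that domain. *)
Definition friedrichs A : set (L2 * L2) :=
  [set p : L2 * L2 | form_domain A p.1 /\
    forall w, form_domain A w -> form_value A p.1 w (ip p.2 w)].

End unbounded_operators.

Section glauber.
Variables (R : realType) (d : nat) (z : R) (phi : 'rV[R]_d -> \bar R).
Variable mu : probability (config R d) R.

(* The graph of [generator] on mu-classes of cylinder functions *)
Definition operatorH : set (LspaceType2 mu * LspaceType2 mu) :=
  [set p | exists F, [/\ cylinder F,
    fct p.1 = F %[ae mu] &
    fct p.2 = generator z phi F %[ae mu]]].

End glauber.
Arguments operatorH {R d} z phi mu _.

(* Main.v *)
(* For a symmetric nonnegative operator, density of the range of [lam + H] for a
   single [lam > 0] gives essential selfadjointness, and the Friedrichs extension
   is then the closure. To solve [(lam + H) u = F] approximately for a bounded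
   local [F], replace [H] by a bounded birth-and-death generator [H_n]: births
   occur only in a cube, at a rate ignoring the points outside it, and all the
   points of a cell of a fine grid die simultaneously. The iteration for
   [(lam + H_n) u = F] preserves the bound |u(g + x) - u(g)| <= Delta(x), where
   Delta solves lam Delta = 2 |F| 1_cube + z (1 - e^{-phi}) * Delta; since phi >= 0,
   the convolution is what the change of the birth rates caused by a new point
   contributes. For lam = 1 + z int (1 - e^{-phi}) the function Delta is bounded
   and integrable. By the Georgii-Nguyen-Zessin identity the sum of Delta over the
   points of a random configuration is square integrable, and it dominates
   [H u_n - H_n u_n], which tends to 0 pointwise.

   The solutions are bounded local measurable functions. A monotone class argument
   shows that these lie in the domain of the closure of [H] on cylinder functions. *)

Require Import Defs.
From HB Require Import structures.
From mathcomp Require Import all_boot all_order all_algebra finmap.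
From mathcomp Require Import all_classical all_reals all_analysis.
From mathcomp Require Import measurable_realfun ring lra.

Set Implicit Arguments.
Unset Strict Implicit.
Unset Printing Implicit Defensive.

Import Order.TTheory GRing.Theory Num.Theory.
Import numFieldNormedType.Exports.

Local Open Scope classical_set_scope.
Local Open Scope ring_scope.

(** * The Hilbert space L^2 *)

(** Single deaths have no bounded total rate, even in a cube, since the number of points is
    unbounded; hence the resolvent equation for [H] cannot be iterated in sup norm. Emptying a cell
    at rate one costs only the number of cells, and it cannot amplify an increment: an added point
    either disappears with its cell or stays. The points that die together wrongly have a neighbour
    closer than the mesh, and a given point of a locally finite set eventually has no such
    neighbour. The total rate of [H_n] still grows with n, so nothing about the convergence of the
    iteration is uniform in n. What survives uniformly are two sup-norm facts, the bound C / lam on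
    the solution and the increment bound Delta. They suffice because the error is only asked to be
    small in L^2(mu): almost sure convergence with one square integrable majorant is enough. The
    approximate solutions themselves need not converge: density of the range only asks that (lam +
    H) u_n be close to F, so each u_n may be a finite iterate. *)

Lemma discriminant_le0 (R : realFieldType) (a b c : R) : 0 <= a -> 0 <= c ->
  (forall t, 0 <= t ^+ 2 * a + 2 * t * b + c) -> b ^+ 2 <= a * c.
Proof.
move=> a0 c0 h; have [a_eq0|a_neq0] := eqVneq a 0.
  rewrite a_eq0 mul0r; have [->|b0] := eqVneq b 0; first by rewrite expr0n.
  (* For a = 0 the polynomial is affine, and at this t it takes the value -1. *)
  have := h (- (c + 1) / (2 * b)); rewrite a_eq0 mulr0 add0r.
  have -> : 2 * (- (c + 1) / (2 * b)) * b = - (c + 1) by field.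
  by move=> h'; exfalso; lra.
have a_gt0 : 0 < a by rewrite lt_neqAle eq_sym a_neq0.
have := h (- b / a).
have -> : (- b / a) ^+ 2 * a + 2 * (- b / a) * b + c = (a * c - b ^+ 2) / a.
  by field.
by rewrite pmulr_lge0 ?invr_gt0// subr_ge0.
Qed.

Section square_integrable.
Context disp (T : measurableType disp) (R : realType).
Variable mu : {measure set T -> \bar R}.
Local Notation L2 f := (f \in Lfun mu 2%:E).
Local Notation ip := (ip mu).
Implicit Types f g h : T -> R.

Lemma L2_measurable f : L2 f -> measurable_fun setT f.
Proof. by rewrite inE => /andP[/[!inE]]. Qed.

Lemma Lnorm2E f : ('N[mu]_2%:E[EFin \o f] = (\int[mu]_x (f x ^+ 2)%:E) `^ 2^-1)%E.
Proof.
rewrite unlock /Lnorm; congr (_ `^ _)%E; apply: eq_integral => x _ /=.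
by rewrite powR_mulrn ?normr_ge0// real_normK ?num_real.
Qed.

Lemma L2P f : L2 f <->
  measurable_fun setT f /\ (\int[mu]_x (f x ^+ 2)%:E < +oo)%E.
Proof.
split=> [f2|[mf f2]].
  split; first exact: L2_measurable.
  have /integrableP[_] := Lfun2_integrable_sqr f2.
  rewrite (eq_integral (fun x => (f x ^+ 2)%:E))// => x _.
  by rewrite gee0_abs// lee_fin sqr_ge0.
rewrite inE; apply/andP; split; first by rewrite inE.
by rewrite inE/= /finite_norm Lnorm2E poweR_lty.
Qed.

Lemma L2_dominated f g : measurable_fun setT f -> L2 g ->
  (forall x, `|f x| <= `|g x|) -> L2 f.
Proof.
move=> mf /L2P[mg g2] fg; apply/L2P; split => //.
apply: le_lt_trans g2; apply: ge0_le_integral => //= [x _|||x _].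
- by rewrite lee_fin sqr_ge0.
- exact/measurable_EFinP/measurable_funX.
- exact/measurable_EFinP/measurable_funX.
- by rewrite lee_fin -(real_normK (num_real (f x))) -(real_normK (num_real (g x)))
    lerXn2r ?nnegrE.
Qed.

Lemma L2_ae f g : measurable_fun setT f -> L2 g -> f = g %[ae mu] -> L2 f.
Proof.
move=> mf /L2P[mg g2] fg; apply/L2P; split => //.
rewrite (_ : \int[mu]_x _ = \int[mu]_x (g x ^+ 2)%:E)%E//.
apply: ae_eq_integral => //.
- exact/measurable_EFinP/measurable_funX.
- exact/measurable_EFinP/measurable_funX.
- by apply: filterS fg => x /[apply] ->.
Qed.

Lemma L2_lin f g a : L2 f -> L2 g -> L2 (fun x => a * f x + g x).
Proof.
move=> f2 g2; have mf := L2_measurable f2; have mg := L2_measurable g2.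
have [if2 ig2] := ((L2P f).1 f2, (L2P g).1 g2).
apply/L2P; split; first by apply: measurable_funD => //; exact: measurable_funM.
apply: (@le_lt_trans _ _ (\int[mu]_x ((2 * a ^+ 2)%:E * (f x ^+ 2)%:E
    + 2%:E * (g x ^+ 2)%:E))%E).
  apply: ge0_le_integral => //= [x _|||x _].
  - by rewrite lee_fin sqr_ge0.
  - apply/measurable_EFinP/measurable_funX/measurable_funD => //.
    exact: measurable_funM.
  - apply: emeasurable_funD; apply: emeasurable_funM => //;
      exact/measurable_EFinP/measurable_funX.
  - rewrite -!EFinM -EFinD lee_fin.
    have := sqr_ge0 (a * f x - g x); rewrite sqrrB sqrrD exprMn; nra.
have a0 : 0 <= 2 * a ^+ 2 by rewrite mulr_ge0// sqr_ge0.
have mf2 : measurable_fun setT (fun x => (f x ^+ 2)%:E).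
  exact/measurable_EFinP/measurable_funX.
have mg2 : measurable_fun setT (fun x => (g x ^+ 2)%:E).
  exact/measurable_EFinP/measurable_funX.
have f0 x : (0 <= (f x ^+ 2)%:E)%E by rewrite lee_fin sqr_ge0.
have g0 x : (0 <= (g x ^+ 2)%:E)%E by rewrite lee_fin sqr_ge0.
rewrite ge0_integralD//=; first last.
- exact: measurable_funeM.
- by move=> x _; rewrite mule_ge0.
- exact: measurable_funeM.
- by move=> x _; rewrite mule_ge0.
rewrite !ge0_integralZl//.
apply: lte_add_pinfty; apply: lte_mul_pinfty => //.
- by case: if2.
- by case: ig2.
Qed.

Lemma L2_0 : L2 (fun=> 0 : R).
Proof.
apply/L2P; split => //; rewrite integral0_eq// => x _.
by rewrite expr0n.
Qed.

Lemma L2_Z f a : L2 f -> L2 (fun x => a * f x).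
Proof.
move=> f2; have := L2_lin a f2 L2_0; rewrite (_ : (fun x => _ + 0) = fun x => a * f x)//.
by apply/funext => x; rewrite addr0.
Qed.

Lemma L2_D f g : L2 f -> L2 g -> L2 (f \+ g).
Proof.
move=> f2 g2; have := L2_lin 1 f2 g2; rewrite (_ : (fun x => _ + _) = f \+ g)//.
by apply/funext => x; rewrite mul1r.
Qed.

Lemma L2_B f g : L2 f -> L2 g -> L2 (f \- g).
Proof.
move=> f2 g2; have := L2_lin (-1) g2 f2; rewrite (_ : (fun x => _ + _) = f \- g)//.
by apply/funext => x /=; rewrite mulN1r addrC.
Qed.

Lemma L2_integrableM f g : L2 f -> L2 g ->
  mu.-integrable setT (fun x => (f x * g x)%:E).
Proof. by move=> f2 g2; apply/Lfun1_integrable/Lfun2_mul_Lfun1. Qed.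

Lemma ipC f g : ip f g = ip g f.
Proof. by apply: eq_Rintegral => x _; rewrite mulrC. Qed.

Lemma ip_lin f g h a : L2 f -> L2 g -> L2 h ->
  ip (fun x => a * f x + g x) h = a * ip f h + ip g h.
Proof.
move=> f2 g2 h2; have ifh := L2_integrableM f2 h2.
rewrite /ip -RintegralZl// -RintegralD//.
- by apply: eq_Rintegral => x _ /=; rewrite mulrDl mulrA.
- rewrite (_ : _ \o _ = (fun x => a%:E * (f x * h x)%:E)%E)//.
  exact: integrableZl.
- exact: L2_integrableM.
Qed.

Lemma ipDl f g h : L2 f -> L2 g -> L2 h -> ip (f \+ g) h = ip f h + ip g h.
Proof.
move=> f2 g2 h2; rewrite -[X in X + _]mul1r -ip_lin//.
by congr (Defs.ip _ _ _); apply/funext => x /=; rewrite mul1r.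
Qed.

Lemma ipBl f g h : L2 f -> L2 g -> L2 h -> ip (f \- g) h = ip f h - ip g h.
Proof.
move=> f2 g2 h2; rewrite -mulN1r addrC -ip_lin//.
by congr (Defs.ip _ _ _); apply/funext => x /=; rewrite mulN1r addrC.
Qed.

Lemma ipZl f h a : L2 f -> L2 h -> ip (fun x => a * f x) h = a * ip f h.
Proof.
move=> f2 h2; rewrite /ip -RintegralZl//; last exact: L2_integrableM.
by apply: eq_Rintegral => x _; rewrite mulrA.
Qed.

Lemma ipDr f g h : L2 f -> L2 g -> L2 h -> ip h (f \+ g) = ip h f + ip h g.
Proof. by move=> *; rewrite ipC ipDl// !(ipC h). Qed.

Lemma ipBr f g h : L2 f -> L2 g -> L2 h -> ip h (f \- g) = ip h f - ip h g.
Proof. by move=> *; rewrite ipC ipBl// !(ipC h). Qed.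

Lemma ip_linr f g h a : L2 f -> L2 g -> L2 h ->
  ip h (fun x => a * f x + g x) = a * ip h f + ip h g.
Proof. by move=> *; rewrite ipC ip_lin// !(ipC h). Qed.

Lemma ip_ge0 f : 0 <= ip f f.
Proof. by apply: Rintegral_ge0 => x _; rewrite -expr2 sqr_ge0. Qed.

Lemma EFin_ip f : L2 f -> (ip f f)%:E = (\int[mu]_x (f x ^+ 2)%:E)%E.
Proof.
move=> f2; rewrite /ip /Rintegral fineK.
  by apply: eq_integral => x _; rewrite expr2.
by apply: integrable_fin_num => //; exact: L2_integrableM.
Qed.

Lemma ip_ae f f' g g' : L2 f -> L2 f' -> L2 g -> L2 g' ->
  f = f' %[ae mu] -> g = g' %[ae mu] -> ip f g = ip f' g'.
Proof.
move=> f2 f'2 g2 g'2 ff' gg'; rewrite /ip /Rintegral; congr fine.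
apply: ae_eq_integral => //.
- by apply/measurable_EFinP/measurable_funM; exact: L2_measurable.
- by apply/measurable_EFinP/measurable_funM; exact: L2_measurable.
- by apply: filterS2 ff' gg' => x fx gx _; rewrite fx// gx.
Qed.

Lemma ip_aer f g g' : L2 f -> L2 g -> L2 g' -> g = g' %[ae mu] -> ip f g = ip f g'.
Proof. by move=> f2 g2 g'2 gg'; apply: ip_ae => //; exact: filterS gg'. Qed.

Lemma ip_eq0 f : L2 f -> ip f f = 0 -> f = (fun=> 0) %[ae mu].
Proof.
move=> f2 f0; have mf := L2_measurable f2.
have : (\int[mu]_x `|(f x ^+ 2)%:E| = 0)%E.
  rewrite (eq_integral (fun x => (f x ^+ 2)%:E)); last first.
    by move=> x _; rewrite gee0_abs// lee_fin sqr_ge0.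
  by rewrite -EFin_ip// f0.
move/ae_eq_integral_abs => /(_ measurableT) h.
have /h : measurable_fun setT (fun x => (f x ^+ 2)%:E).
  exact/measurable_EFinP/measurable_funX.
by apply: filterS => x /[apply] -[/eqP]; rewrite sqrf_eq0 => /eqP.
Qed.

Lemma CauchySchwarz_ip f g : L2 f -> L2 g -> ip f g ^+ 2 <= ip f f * ip g g.
Proof.
move=> f2 g2; apply: discriminant_le0; rewrite ?ip_ge0// => t.
have := ip_ge0 (fun x => t * f x + g x).
rewrite ip_lin ?ip_linr//; last exact: L2_lin.
by rewrite (ipC g f) expr2; congr (0 <= _); ring.
Qed.

Definition nrm f := Num.sqrt (ip f f).

Lemma nrm_ge0 f : 0 <= nrm f. Proof. exact: sqrtr_ge0. Qed.

Lemma sqr_nrm f : nrm f ^+ 2 = ip f f.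
Proof. by rewrite sqr_sqrtr// ip_ge0. Qed.

Lemma normr_ip f g : L2 f -> L2 g -> `|ip f g| <= nrm f * nrm g.
Proof.
move=> f2 g2; rewrite -(@ler_pXn2r _ 2%N)// ?nnegrE ?mulr_ge0 ?nrm_ge0//.
by rewrite exprMn !sqr_nrm real_normK ?num_real// CauchySchwarz_ip.
Qed.

Lemma nrmD f g : L2 f -> L2 g -> nrm (f \+ g) <= nrm f + nrm g.
Proof.
move=> f2 g2.
rewrite -(@ler_pXn2r _ 2%N)// ?nnegrE ?addr_ge0 ?nrm_ge0//.
rewrite sqrrD !sqr_nrm ipDl ?ipDr//; last exact: L2_D.
rewrite (ipC g f); have := le_trans (ler_norm _) (normr_ip f2 g2).
by rewrite -mulr_natl; lra.
Qed.

Lemma nrmZ f a : L2 f -> nrm (fun x => a * f x) = `|a| * nrm f.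
Proof.
move=> f2; rewrite /nrm ipZl ?[ip f _]ipC ?ipZl//; try exact: L2_Z.
by rewrite mulrA -expr2 sqrtrM ?sqr_ge0// sqrtr_sqr.
Qed.

Lemma nrm_subC f g : nrm (f \- g) = nrm (g \- f).
Proof.
rewrite /nrm; congr Num.sqrt; apply: eq_Rintegral => x _ /=.
by rewrite -!expr2 -sqrrN opprB.
Qed.

Lemma nrm_ae f g : L2 f -> L2 g -> f = g %[ae mu] -> nrm f = nrm g.
Proof. by move=> f2 g2 fg; rewrite /nrm (ip_ae (f' := g) (g' := g)). Qed.

Lemma nrm_sub_trans f g h : L2 f -> L2 g -> L2 h ->
  nrm (f \- h) <= nrm (f \- g) + nrm (g \- h).
Proof.
move=> f2 g2 h2; rewrite (_ : f \- h = (f \- g) \+ (g \- h)).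
  by apply: nrmD; exact: L2_B.
by apply/funext => x /=; rewrite addrA subrK.
Qed.

Lemma nrm_lt f e : L2 f -> 0 < e -> (nrm f < e) = (\int[mu]_x (f x ^+ 2)%:E < (e ^+ 2)%:E)%E.
Proof.
move=> f2 e0; rewrite -EFin_ip// lte_fin -sqr_nrm ltr_pXn2r// ?nnegrE ?nrm_ge0//.
exact: ltW.
Qed.

Lemma L2_fct (u : LspaceType2 mu) : L2 (fct u).
Proof.
rewrite inE; apply/andP; split.
  rewrite inE; exact: (@measurable_funPT _ _ _ _ (repr (u : aeEqMfun _ mu))).
by rewrite inE; exact: Lebesgue_finite.
Qed.

(** Elements of [LspaceType2] are quotient classes bundled with a finiteness proof: the quotient
    identifies the classes, and proof irrelevance the bundled proofs. *)
Lemma fct_inj (u v : LspaceType2 mu) : fct u = fct v %[ae mu] -> u = v.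
Proof.
move=> uv; have e : (u : aeEqMfun _ mu) = (v : aeEqMfun _ mu).
  by rewrite -[LHS]reprK -[RHS]reprK; apply/eqmodP/asboolP.
case: u v e uv => [u [[hu]]] [v [[hv]]]/= e _.
by case: _ / e hv => hv; rewrite (Prop_irrelevance hu hv).
Qed.

(** The representative chosen by the quotient differs from [f] on a null set, so its square
    integrability has to be transferred through [L2_ae] before the class can be packed. *)
Lemma L2_fct_ex f : L2 f -> exists u : LspaceType2 mu, fct u = f %[ae mu].
Proof.
move=> f2; have mf := L2_measurable f2.
have mf' : (f : T -> measurableTypeR R) \in mfun by rewrite inE.
pose F : {mfun T >-> measurableTypeR R} := mfun_Sub mf'.
pose c : aeEqMfun (measurableTypeR R) mu := \pi_(aeEqMfun (measurableTypeR R) mu)%qT F.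
have cf : aqEqMfun_to_fun c = f %[ae mu].
  by apply/asboolP; have /eqmodP := reprK c.
have mc : measurable_fun setT (aqEqMfun_to_fun c).
  exact: (@measurable_funPT _ _ _ _ (repr c)).
have : finite_norm mu 2%:E (aqEqMfun_to_fun c).
  by have := L2_ae mc f2 cf; rewrite inE => /andP[_ /[!inE]].
move=> fc; pose u : LspaceType2 mu :=
  HB.pack_for (LspaceType2 mu) c (@isFinLebesgue.Build _ _ _ mu 2%:E (lee1n 2) c fc).
by exists u.
Qed.

Lemma cvg_L2P (u_ : nat -> LspaceType2 mu) u :
  cvg_L2 u_ u <-> (forall e, 0 < e -> exists N, forall n, (N <= n)%N ->
    nrm (fct (u_ n) \- fct u) < e).
Proof.
have uL2 n : L2 (fct (u_ n) \- fct u) by apply: L2_B; exact: L2_fct.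
have E n : 'N[mu]_2%:E[EFin \o (fct (u_ n) \- fct u)%R]%E =
    (nrm (fct (u_ n) \- fct u))%:E.
  by rewrite Lnorm2E -EFin_ip// poweR_EFin powR12_sqrt// ip_ge0.
rewrite /cvg_L2; under eq_fun do rewrite E.
split.
- move/fine_cvgP => [_ /cvgrPdist_lt h] e e0; have [N _ Nh] := h e e0.
  exists N => n Nn; have := Nh n Nn.
  by rewrite /= sub0r normrN ger0_norm ?nrm_ge0.
- move=> h; apply/fine_cvgP; split; first exact: nearW.
  apply/cvgrPdist_lt => e e0; have [N Nh] := h e e0.
  by exists N => // n Nn; rewrite /= sub0r normrN ger0_norm ?nrm_ge0//; exact: Nh.
Qed.

End square_integrable.

(** * Nonnegative symmetric operators *)

Section nonnegative_symmetric_operators.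
Context disp (T : measurableType disp) (R : realType).
Variable mu : {measure set T -> \bar R}.
Local Notation L2 := (LspaceType2 mu).
Local Notation ip := (ip mu).
Local Notation nrm := (nrm mu).
Variable A : set (L2 * L2).

Hint Extern 0 (is_true (fct _ \in _)) => exact: L2_fct : core.
Hint Extern 0 (is_true ((fct _ \- fct _) \in _)) => (apply: L2_B; exact: L2_fct) : core.
Hint Extern 0 (is_true ((fun x => _ * fct _ x + fct _ x) \in _)) => (apply: L2_lin; exact: L2_fct) : core.

Lemma op_closureP p : op_closure A p <-> forall e, 0 < e ->
  exists q, [/\ A q, nrm (fct q.1 \- fct p.1) < e & nrm (fct q.2 \- fct p.2) < e].
Proof.
split=> [[p_ [Ap /cvg_L2P h1 /cvg_L2P h2]] e e0|h].
  have [N1 N1h] := h1 e e0; have [N2 N2h] := h2 e e0.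
  exists (p_ (maxn N1 N2)); split => //.
    by apply: N1h; rewrite leq_maxl.
  by apply: N2h; rewrite leq_maxr.
have n0 n : 0 < n.+1%:R^-1 :> R by rewrite invr_gt0.
have [p_ p_h] := choice (fun n => h _ (n0 n)).
exists p_; split; first by move=> n; have [] := p_h n.
- apply/cvg_L2P => e e0; have [N _ Nh] := near_infty_natSinv_lt (PosNum e0).
  by exists N => n Nn; have [_ + _] := p_h n; move/lt_trans; apply; exact: Nh.
- apply/cvg_L2P => e e0; have [N _ Nh] := near_infty_natSinv_lt (PosNum e0).
  by exists N => n Nn; have [_ _] := p_h n; move/lt_trans; apply; exact: Nh.
Qed.

Lemma sub_op_closure p : A p -> op_closure A p.
Proof.
move=> Ap; apply/op_closureP => e e0; exists p.
have E (u : L2) : nrm (fct u \- fct u) = 0.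
  rewrite /nrm (_ : _ \- _ = fun=> 0) ?/ip ?Rintegral_ge0//; last first.
    by apply/funext => x /=; rewrite subrr.
  rewrite /Defs.ip /Rintegral integral0_eq ?sqrtr0//.
  by move=> x _; rewrite mulr0.
by rewrite !E.
Qed.

Lemma densely_definedP : densely_defined A <->
  forall (u : L2) e, 0 < e -> exists2 q, A q & nrm (fct q.1 \- fct u) < e.
Proof.
split=> [h u e e0|h u].
  have [u_ [Au /cvg_L2P/(_ _ e0)[N Nh]]] := h u.
  by have [q Aq qu] := Au N; exists q => //; rewrite qu; exact: Nh.
have n0 n : 0 < n.+1%:R^-1 :> R by rewrite invr_gt0.
have /choice[q_ q_h] : forall n, exists q, A q /\ nrm (fct q.1 \- fct u) < n.+1%:R^-1.
  by move=> n; have [q] := h u _ (n0 n); exists q.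
exists (fun n => (q_ n).1); split; first by move=> n; exists (q_ n) => //; case: (q_h n).
apply/cvg_L2P => e e0; have [N _ Nh] := near_infty_natSinv_lt (PosNum e0).
by exists N => n Nn; have [_] := q_h n; move/lt_trans; apply; exact: Nh.
Qed.

Definition lin_closed := forall (a : R) p q r, A p -> A q ->
     fct r.1 = (fun x => a * fct p.1 x + fct q.1 x) %[ae mu] ->
     fct r.2 = (fun x => a * fct p.2 x + fct q.2 x) %[ae mu] -> A r.

Hypothesis Alin : lin_closed.
Hypothesis Adense : densely_defined A.
Hypothesis Asym : symmetric_op A.
Hypothesis Age0 : nonnegative_op A.
Variable lam : R.
Hypothesis lam0 : 0 < lam.
Hypothesis Arange : forall (w : L2) e, 0 < e ->
  exists2 q, A q & nrm ((fun x => lam * fct q.1 x + fct q.2 x) \- fct w) < e.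

Lemma lin_ex (a : R) p q : A p -> A q -> exists r, [/\ A r,
   fct r.1 = (fun x => a * fct p.1 x + fct q.1 x) %[ae mu] &
     fct r.2 = (fun x => a * fct p.2 x + fct q.2 x) %[ae mu]].
Proof.
move=> Ap Aq.
have [u1 h1] := L2_fct_ex (L2_lin a (L2_fct p.1) (L2_fct q.1)).
have [u2 h2] := L2_fct_ex (L2_lin a (L2_fct p.2) (L2_fct q.2)).
by exists (u1, u2); split => //; exact: (@Alin a p q).
Qed.

Let B (q : L2 * L2) := (fun x => lam * fct q.1 x + fct q.2 x) : T -> R.
Let L2_Bq q : B q \in Lfun mu 2%:E. Proof. exact: L2_lin. Qed.
Hint Extern 0 (is_true (B _ \in _)) => exact: L2_Bq : core.

(** Since A is nonnegative, lam |q.1|^2 <= (B q, q.1), and Cauchy-Schwarz bounds the right side by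
    |B q| |q.1|. It makes the inverse of lam + A bounded on its range. *)
Let coercive q : A q -> lam * nrm (fct q.1) <= nrm (B q).
Proof.
move=> Aq; have [->|n0] := eqVneq (nrm (fct q.1)) 0; first by rewrite mulr0 nrm_ge0.
have {}n0 : 0 < nrm (fct q.1) by rewrite lt_neqAle eq_sym n0 nrm_ge0.
rewrite -(ler_pM2r n0) -mulrA -expr2 sqr_nrm.
apply: le_trans (le_trans (ler_norm _) (normr_ip (L2_Bq q) (L2_fct q.1))).
by rewrite /B ip_lin// lerDl; exact: Age0.
Qed.

(** For (u, v) in the adjoint, lam u + v is approximated by some [B q]. Coercivity cannot be applied
    to u - q.1, which need not lie in the domain, so the estimate lam |u - q.1| <= |B q - w| is
    obtained by duality: it is tested against vectors [B q'], which are dense. Then q.1 is close to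
    u, and q.2 = B q - lam q.1 is close to v. *)
Lemma adjoint_sub_closure : adjoint A `<=` op_closure A.
Proof.
move=> [u v] adj; apply/op_closureP => e e0.
have [w hw] := L2_fct_ex (L2_lin lam (L2_fct u) (L2_fct v)).
(* The first bound serves for B q - w, the second, after division by lam, for q.1 - u. *)
pose e' := Num.min (e / 2) (lam * e / 2).
have e'0 : 0 < e' by rewrite lt_min !divr_gt0 ?mulr_gt0.
have [q Aq qw] := Arange w e'0; exists q.
have r2 : fct u \- fct q.1 \in Lfun mu 2%:E by [].
have rle : lam * nrm (fct u \- fct q.1) <= nrm (B q \- fct w).
  have [->|n0] := eqVneq (nrm (fct u \- fct q.1)) 0; first by rewrite mulr0 nrm_ge0.
  have {}n0 : 0 < nrm (fct u \- fct q.1) by rewrite lt_neqAle eq_sym n0 nrm_ge0.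
  set r := fct u \- fct q.1 in r2 n0 *.
  set D := nrm (B q \- fct w).
  have D0 : 0 <= D by exact: nrm_ge0.
  (* The adjoint relation and symmetry move [B] from q' to the other side; coercivity then bounds
     |q'.1| by |B q'| / lam. *)
  have key q' : A q' -> lam * `|ip (B q') r| <= nrm (B q') * D.
    move=> Aq'; have -> : ip (B q') r = ip (fct q'.1) (fct w \- B q).
      rewrite /r ipBr// ipBr//; congr (_ - _).
        rewrite (ip_aer _ _ _ hw)//.
        by rewrite /B ip_lin// ip_linr// (adj _ Aq').
      by rewrite /B ip_lin// ip_linr// (Asym Aq' Aq).
    apply: (@le_trans _ _ (lam * (nrm (fct q'.1) * D))).
      by rewrite ler_pM2l// /D nrm_subC; apply: normr_ip => //; exact: L2_B.
    by rewrite mulrA ler_wpM2r// coercive.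
  apply/ler_addgt0Pr => d d0.
  have [w' hw'] := L2_fct_ex r2.
  (* Testing with some [B q'] at distance less than d' from r gives lam |r|^2 <= |r| D + d' (lam |r|
     + D); d' is chosen so that the last term is at most d |r|. *)
  pose M := lam * nrm r + D + 1.
  have M0 : 0 < M by rewrite /M ltr_pwDr// addr_ge0// mulr_ge0// ltW.
  pose d' := Num.min (nrm r) (d * nrm r / M).
  have d'0 : 0 < d' by rewrite lt_min n0 !mulr_gt0// invr_gt0.
  have [q' Aq'] := Arange w' d'0; rewrite -/(B q').
  rewrite (nrm_ae (g := B q' \- r)); [|exact: L2_B|exact: L2_B|]; last first.
    by apply: filterS hw' => x /[apply] /= ->.
  move=> q'r.
  have q'r1 : nrm (B q') <= nrm r + d'.
    rewrite (_ : B q' = r \+ (B q' \- r)); last first.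
      by apply/funext => x /=; rewrite addrC subrK.
    by apply: le_trans (nrmD _ _) _ => //; [exact: L2_B|rewrite lerD2l ltW].
  have q'r2 : nrm r ^+ 2 <= `|ip (B q') r| + d' * nrm r.
    rewrite sqr_nrm (_ : ip r r = ip (B q') r - ip (B q' \- r) r); last first.
      by rewrite ipBl//; ring.
    apply: le_trans (ler_norm _) _; apply: le_trans (ler_normB _ _) _.
    rewrite lerD2l; apply: le_trans (normr_ip _ _) _ => //; first exact: L2_B.
    by rewrite ler_wpM2r ?nrm_ge0// ltW.
  have d'M : d' * M <= d * nrm r by rewrite -ler_pdivlMr// ge_min lexx orbT.
  rewrite -(ler_pM2r n0); have := key _ Aq'.
  have : nrm (B q') * D <= (nrm r + d') * D by rewrite ler_wpM2r.
  have : lam * nrm r ^+ 2 <= lam * (`|ip (B q') r| + d' * nrm r) by rewrite ler_pM2l.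
  by rewrite /M in d'M *; nra.
have uq : nrm (fct q.1 \- fct u) < e / 2.
  rewrite nrm_subC -(ltr_pM2l lam0); apply: (le_lt_trans rle).
  by apply: (lt_le_trans qw); rewrite mulrA ge_min lexx orbT.
split => //=; first by apply: (lt_trans uq); rewrite ltr_pdivrMr// ltr_pMr// ltr1n.
pose r1 := fct q.1 \- fct u.
have r12 : r1 \in Lfun mu 2%:E by rewrite /r1.
have -> : fct q.2 \- fct v = (fun x => - lam * r1 x + ((B q) \- (fun x => lam * fct u x + fct v x)) x).
  by apply/funext => x; rewrite /r1 /B /=; ring.
have BL2 : (B q \- (fun x => lam * fct u x + fct v x)) \in Lfun mu 2%:E.
  by apply: L2_B => //; exact: L2_lin.
apply: (le_lt_trans (nrmD _ BL2)); first by apply: L2_Z.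
rewrite nrmZ// normrN gtr0_norm// (nrm_ae BL2 (g := B q \- fct w)).
- rewrite (splitr e) ltrD//.
    rewrite nrm_subC; apply: (le_lt_trans rle).
    by apply: (lt_le_trans qw); rewrite ge_min lexx.
  by apply: (lt_le_trans qw); rewrite ge_min lexx.
- exact: L2_B.
- by apply: filterS hw => x /[apply] /= ->.
Qed.

Lemma closure_sub_adjoint : op_closure A `<=` adjoint (op_closure A).
Proof.
move=> p /op_closureP cp q /op_closureP cq.
apply/eqP; rewrite -subr_eq0 -normr_le0; apply/ler_addgt0Pr => e e0.
rewrite add0r.
pose M := nrm (fct p.1) + nrm (fct p.2) + nrm (fct q.1) + nrm (fct q.2) + 1 + 1.
have [p10 p20 q10 q20] : [/\ 0 <= nrm (fct p.1), 0 <= nrm (fct p.2),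
  0 <= nrm (fct q.1) & 0 <= nrm (fct q.2)] by split; exact: nrm_ge0.
have M0 : 0 < M by rewrite /M; lra.
pose d := Num.min 1 (e / (4 * M)).
have d0 : 0 < d by rewrite lt_min ltr01/= divr_gt0// mulr_gt0.
have d1 : d <= 1 by rewrite ge_min lexx.
have dM : d * (4 * M) <= e by rewrite -ler_pdivlMr ?mulr_gt0// ge_min lexx orbT.
have [p' [Ap' p1 p2]] := cp d d0; have [q' [Aq' q1 q2]] := cq d d0.
have := Asym Ap' Aq'; rewrite (ipC mu (fct p'.2)) (ipC mu (fct p'.1)) => /eqP; rewrite -subr_eq0 => /eqP s0.
have diff (a b a' b' : L2) : nrm (fct a \- fct a') < d -> nrm (fct b \- fct b') < d ->
    `|ip (fct a) (fct b) - ip (fct a') (fct b')| <= d * (nrm (fct a') + 1) + d * nrm (fct b').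
  move=> aa bb.
  have -> : ip (fct a) (fct b) - ip (fct a') (fct b') =
    ip (fct a) (fct b \- fct b') + ip (fct a \- fct a') (fct b').
    by rewrite ipBr// ipBl//; ring.
  apply: (le_trans (ler_normD _ _)); apply: lerD.
    apply: (le_trans (normr_ip _ _)) => //.
    rewrite mulrC; apply: ler_pM; rewrite ?nrm_ge0//; first exact: ltW.
    rewrite (_ : fct a = (fct a \- fct a') \+ fct a'); last first.
      by apply/funext => x /=; rewrite subrK.
    apply: (le_trans (nrmD _ _)) => //; rewrite addrC lerD2l.
    exact: (le_trans (ltW aa)).
  apply: (le_trans (normr_ip _ _)) => //.
  by rewrite ler_wpM2r ?nrm_ge0// ltW.
have /= h1 := diff _ _ _ _ q2 p1; have /= h2 := diff _ _ _ _ q1 p2.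
rewrite (_ : _ - _ = (ip (fct q'.1) (fct p'.2) - ip (fct q.1) (fct p.2)) -
  (ip (fct q'.2) (fct p'.1) - ip (fct q.2) (fct p.1))); last by move: s0; lra.
apply: (le_trans (ler_normB _ _)); apply: (le_trans (lerD h2 h1)).
by apply: le_trans dM; rewrite /M; nra.
Qed.

Lemma sub_adjoint_closure : adjoint (op_closure A) `<=` adjoint A.
Proof. by move=> p h q Aq; apply: h; exact: sub_op_closure. Qed.

Lemma adjoint_closureE : adjoint (op_closure A) = op_closure A.
Proof.
apply/seteqP; split; last exact: closure_sub_adjoint.
exact: subset_trans sub_adjoint_closure adjoint_sub_closure.
Qed.

Lemma densely_defined_closure : densely_defined (op_closure A).
Proof.
move=> u; have [u_ [Du h]] := Adense u; exists u_; split => // n.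
by have [p Ap pu] := Du n; exists p => //; exact: sub_op_closure.
Qed.

End nonnegative_symmetric_operators.

Lemma dense_ortho disp (T : measurableType disp) (R : realType)
  (mu : {measure set T -> \bar R}) (A : set (LspaceType2 mu * LspaceType2 mu)) (f : T -> R) :
  densely_defined A -> f \in Lfun mu 2%:E ->
  (forall q, A q -> ip mu (fct q.1) f = 0) -> f = (fun=> 0) %[ae mu].
Proof.
move=> /densely_definedP dA f2 h; apply: ip_eq0 => //.
have [w hw] := L2_fct_ex f2.
apply/eqP; rewrite eq_le ip_ge0 andbT; apply/ler_addgt0Pr => e e0; rewrite add0r.
pose d := e / (nrm mu f + 1).
have d0 : 0 < d by rewrite divr_gt0// ltr_wpDl// nrm_ge0.
have [q Aq qw] := dA w d d0.
have fq : fct q.1 \- f \in Lfun mu 2%:E by apply: L2_B => //; exact: L2_fct.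
have {}qw : nrm mu (fct q.1 \- f) < d.
  rewrite (nrm_ae (g := fct q.1 \- fct w))//; first by apply: L2_B => //; exact: L2_fct.
  by apply: filterS hw => x /[apply] /= ->.
have -> : ip mu f f = - ip mu (fct q.1 \- f) f.
  by rewrite ipBl//; [rewrite h// sub0r opprK|exact: L2_fct].
apply: (le_trans (ler_norm _)); rewrite normrN; apply: (le_trans (normr_ip fq f2)).
have : nrm mu (fct q.1 \- f) * nrm mu f <= d * (nrm mu f + 1).
  by apply: ler_pM; rewrite ?nrm_ge0 ?lerDl// ltW.
by rewrite divfK// gt_eqF// ltr_wpDl// nrm_ge0.
Qed.

(** Symmetry makes v - v' orthogonal to the dense domain. For [operatorH] this is the proof that the
    class of the generator depends only on the mu-class of the cylinder function. *)
Lemma symmetric_functional disp (T : measurableType disp) (R : realType)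
  (mu : {measure set T -> \bar R}) (A : set (LspaceType2 mu * LspaceType2 mu)) :
  densely_defined A -> symmetric_op A ->
  forall u v v', A (u, v) -> A (u, v') -> v = v'.
Proof.
move=> dA sA u v v' uv uv'; apply: fct_inj.
have L2f (x : LspaceType2 mu) := L2_fct x.
suff : fct v \- fct v' = (fun=> 0) %[ae mu].
  by apply: filterS => x /[apply] /= /eqP; rewrite subr_eq0 => /eqP.
apply: (dense_ortho dA); first exact: L2_B.
by move=> q Aq; rewrite ipBr// -(sA _ _ Aq uv) -(sA _ _ Aq uv')/= subrr.
Qed.

(** * The closed quadratic form and the Friedrichs extension *)

Section form_closure.
Context disp (T : measurableType disp) (R : realType).
Variable mu : {measure set T -> \bar R}.
Local Notation L2 := (LspaceType2 mu).
Local Notation ip := (ip mu).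
Local Notation nrm := (nrm mu).
Variable A : set (L2 * L2).

Hint Extern 0 (is_true (fct _ \in _)) => exact: L2_fct : core.
Hint Extern 0 (is_true ((fct _ \- fct _) \in _)) => (apply: L2_B; exact: L2_fct) : core.
Hint Extern 0 (is_true ((fun x => _ * fct _ x + fct _ x) \in _)) => (apply: L2_lin; exact: L2_fct) : core.

Hypothesis Alin : lin_closed A.
Hypothesis Asym : symmetric_op A.
Hypothesis Age0 : nonnegative_op A.

Lemma lin_closed_closure : lin_closed (op_closure A).
Proof.
move=> a p q r /op_closureP cp /op_closureP cq r1 r2; apply/op_closureP => e e0.
pose M := `|a| + 1.
have M0 : 0 < M by rewrite ltr_wpDl.
pose d := e / (M + 1).
have d0 : 0 < d by rewrite divr_gt0// addr_gt0.
have dM : d * (M + 1) = e by rewrite divfK// gt_eqF// addr_gt0.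
have [p' [Ap' p'1 p'2]] := cp d d0; have [q' [Aq' q'1 q'2]] := cq d d0.
have [r' [Ar' r'1 r'2]] := lin_ex Alin a Ap' Aq'.
have key (u v u' v' w w' : L2) :
    fct w = (fun x => a * fct u x + fct v x) %[ae mu] ->
    fct w' = (fun x => a * fct u' x + fct v' x) %[ae mu] ->
    nrm (fct u' \- fct u) < d -> nrm (fct v' \- fct v) < d ->
    nrm (fct w' \- fct w) < e.
  move=> hw hw' hu hv.
  rewrite (nrm_ae (g := fun x => a * (fct u' \- fct u) x + (fct v' \- fct v) x))//; last 2 first.
  - by apply: L2_lin.
  - by apply: filterS2 hw hw' => x h1 h2 _ /=; rewrite h1// h2//; ring.
  apply: (le_lt_trans (nrmD _ _)) => //; first by apply: L2_Z.
  rewrite nrmZ// -dM mulrDr mulr1 ltr_leD//.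
  - have := nrm_ge0 mu (fct u' \- fct u); have := normr_ge0 a.
    by rewrite /M; nra.
  - exact: ltW.
by exists r'; split => //; [apply: key r1 r'1 _ _|apply: key r2 r'2 _ _].
Qed.

Let a_ (p q : L2 * L2) := ip (fct p.2) (fct q.1).

Let a_sym p q : A p -> A q -> a_ p q = a_ q p.
Proof. by move=> Ap Aq; rewrite /a_ (Asym Ap Aq) ipC. Qed.

Let a_lin t p q r : A p -> A q ->
  fct r.1 = (fun x => t * fct p.1 x + fct q.1 x) %[ae mu] ->
  fct r.2 = (fun x => t * fct p.2 x + fct q.2 x) %[ae mu] ->
  a_ r r = t ^+ 2 * a_ p p + 2 * t * a_ p q + a_ q q.
Proof.
move=> Ap Aq r1 r2; rewrite {1}/a_ (ip_ae _ _ _ _ r2 r1)//.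
rewrite ip_lin// !ip_linr// -/(a_ p p) -/(a_ p q) -/(a_ q p) -/(a_ q q).
by rewrite (a_sym Aq Ap); ring.
Qed.

Let diffE (p q r : L2 * L2) :
  fct r.1 = (fun x => -1 * fct p.1 x + fct q.1 x) %[ae mu] ->
  fct r.2 = (fun x => -1 * fct p.2 x + fct q.2 x) %[ae mu] ->
  a_ r r = ip (fct q.2 \- fct p.2) (fct q.1 \- fct p.1).
Proof.
move=> r1 r2; apply: ip_ae => //.
- by apply: filterS r2 => x /[apply] -> /=; ring.
- by apply: filterS r1 => x /[apply] -> /=; ring.
Qed.

Let form_cauchy (p_ : nat -> L2 * L2) u : form_approx A p_ u -> forall e, 0 < e ->
  exists N, forall m n, (N <= m)%N -> (N <= n)%N ->
  `|ip (fct (p_ m).2 \- fct (p_ n).2) (fct (p_ m).1 \- fct (p_ n).1)| < e.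
Proof.
move=> [Ap _ h] e e0; have [[P Q]/= [[N1 _ h1] [N2 _ h2]] PQ] := h e e0.
exists (maxn N1 N2) => m n; rewrite !geq_max => /andP[m1 m2] /andP[n1 n2].
by apply: (PQ (m, n)); split; [exact: h1|exact: h2].
Qed.

(* A form-Cauchy sequence tending to 0 in [L^2] tends to 0 in the form norm:
   [a(r_n) <= a(r_n - r_m) + 2 |(A r_n, r_m)|], and [m] is sent to infinity. *)
Let closable (r_ : nat -> L2 * L2) u q : A q -> fct q.1 = fct u %[ae mu] ->
  form_approx A r_ u -> forall e, 0 < e -> exists N, forall n, (N <= n)%N ->
  forall s, A s -> fct s.1 = (fun x => -1 * fct q.1 x + fct (r_ n).1 x) %[ae mu] ->
   fct s.2 = (fun x => -1 * fct q.2 x + fct (r_ n).2 x) %[ae mu] -> a_ s s <= e.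
Proof.
move=> Aq qu rapp e e0; have [Ar /cvg_L2P ru _] := rapp.
have [N hN] := form_cauchy rapp e0.
exists N => n Nn s As s1 s2.
apply/ler_addgt0Pr => e' e'0.
pose M := 2 * (nrm (fct s.2) + 1).
have M0 : 0 < M by rewrite mulr_gt0// ltr_wpDl// nrm_ge0.
have [N' hN'] := ru (e' / M) (divr_gt0 e'0 M0).
pose m := maxn N N'.
have [t [At t1 t2]] := lin_ex Alin (-1) Aq (Ar m).
(* [s], [t] and [w] represent r_n - q, r_m - q and r_m - r_n; the form at [w] is small because the
   sequence is form-Cauchy. *)
have [w [Aw w1 w2]] := lin_ex Alin (-1) As At.
have aw : a_ w w < e.
  have := hN m n; rewrite leq_maxl => /(_ isT Nn).
  apply: le_lt_trans; apply: le_trans (ler_norm _).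
  rewrite le_eqVlt; apply/orP; left; apply/eqP.
  apply: ip_ae => //.
  - by apply: filterS2 (filterI w2 t2) s2 => x [h1 h2] h3 _ /=; rewrite h1// h2// h3//; ring.
  - by apply: filterS2 (filterI w1 t1) s1 => x [h1 h2] h3 _ /=; rewrite h1// h2// h3//; ring.
have tn : nrm (fct t.1) < e' / M.
  rewrite (nrm_ae (g := fct (r_ m).1 \- fct u))//; first by apply: hN'; rewrite leq_maxr.
  by apply: filterS2 t1 qu => x h1 h2 _ /=; rewrite h1// h2//; ring.
have ast : `|a_ s t| <= nrm (fct s.2) * nrm (fct t.1) by exact: normr_ip.
have := a_lin As At w1 w2; have := Age0 At; rewrite -/(a_ t t).
have := ler_norm (a_ s t); have : M * nrm (fct t.1) <= e'.
  by rewrite mulrC -ler_pdivlMr// ltW.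
have := nrm_ge0 mu (fct t.1); have := nrm_ge0 mu (fct s.2); rewrite /M.
nra.
Qed.

Lemma form_approx_cst q : A q -> form_approx A (fun=> q) q.1.
Proof.
move=> Aq; split => //.
- apply/cvg_L2P => e e0; exists 0%N => n _.
  have [p [Ap pq _]] := (op_closureP A q).1 (sub_op_closure Aq) e e0.
  by rewrite /nrm /Defs.ip /Rintegral integral0_eq ?sqrtr0// => x _; rewrite /= subrr ?mulr0 ?mul0r.
- move=> e e0; near=> m n.
  by rewrite /Defs.ip /Rintegral integral0_eq ?normr0// => x _; rewrite /= subrr ?mulr0 ?mul0r.
Unshelve. all: by end_near. Qed.

(** With w := q.1 as test vector, the form value is the limit of (A p_n, q_n). Replacing q_n by q
    costs a(p_n, q_n - q), which tends to 0 by Cauchy-Schwarz for the form: a(p_n, p_n) is bounded,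
    and a(q_n - q, q_n - q) tends to 0 by [closable]. What remains is (A p_n, q.1) = (p_n, A q),
    with limit (u, A q). *)
Lemma friedrichs_sub_adjoint : friedrichs A `<=` adjoint A.
Proof.
move=> [u v] [/= _ fr] q Aq /=.
have [p_ [q_ [papp qapp pq]]] := fr q.1 (ex_intro (fun p_ => form_approx A p_ q.1) _ (form_approx_cst Aq)).
have [Ap /cvg_L2P pu _] := papp; have [Aq_ /cvg_L2P qu _] := qapp.
suff : (fun n => ip (fct (p_ n).2) (fct (q_ n).1)) @ \oo --> ip (fct q.2) (fct u).
  move=> h; have := cvg_unique _ pq h; rewrite (ipC _ (fct v)).
  by move=> ->.
apply/cvgrPdist_le => e e0.
have [N1 h1] := form_cauchy papp (@ltr01 R).
pose K := 2 * (1 + a_ (p_ N1) (p_ N1)) + 1.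
have K0 : 0 < K by rewrite ltr_wpDl// mulr_ge0// addr_ge0//; exact: Age0.
(* Chosen so that K d = (e / 2)^2 in the Cauchy-Schwarz bound on the form. *)
pose d := (e / 2) ^+ 2 / K.
have d0 : 0 < d by rewrite divr_gt0// exprn_gt0// divr_gt0.
have [N2 h2] := closable Aq (ae_eq_refl _ _ _) qapp d0.
pose M := nrm (fct q.2) + 1.
have M0 : 0 < M by rewrite ltr_wpDl// nrm_ge0.
have e'0 : 0 < e / 2 / M by rewrite !divr_gt0.
have [N3 h3] := pu _ e'0.
exists (maxn N1 (maxn N2 N3)) => // n /=; rewrite !geq_max => /and3P[n1 n2 n3].
have [s [As s1 s2]] := lin_ex Alin (-1) Aq (Aq_ n).
have as_ : a_ s s <= d by exact: (h2 n n2 s).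
have [t [At t1 t2]] := lin_ex Alin (-1) (Ap N1) (Ap n).
(* Nonnegativity at p_n - 2 p_N1 controls the cross term; with a(p_n - p_N1) <= 1 it gives a(p_n) <=
   2 (1 + a(p_N1)). *)
have [t' [At' t'1 t'2]] := lin_ex Alin (-2) (Ap N1) (Ap n).
have apn : a_ (p_ n) (p_ n) <= K.
  have := a_lin (Ap N1) (Ap n) t1 t2; have := a_lin (Ap N1) (Ap n) t'1 t'2.
  have := Age0 At'; rewrite -/(a_ t' t').
  have : a_ t t <= 1.
    rewrite (diffE t1 t2); apply: le_trans (ler_norm _) _.
    by apply/ltW/h1.
  have := Age0 (Ap N1); rewrite -/(a_ _ _) /K; lra.
have aps : `|a_ (p_ n) s| <= e / 2.
  have : a_ (p_ n) s ^+ 2 <= a_ (p_ n) (p_ n) * a_ s s.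
    apply: discriminant_le0; [exact: Age0|exact: Age0|move=> tt].
    have [x [Ax x1 x2]] := lin_ex Alin tt (Ap n) As.
    by rewrite -(a_lin (Ap n) As x1 x2); exact: Age0.
  move=> h; have e20 : 0 <= e / 2 by rewrite divr_ge0// ltW.
  rewrite -(@ler_pXn2r _ 2%N)// real_normK ?num_real//; apply: (le_trans h).
  apply: (@le_trans _ _ (K * d)).
    by apply: ler_pM => //; exact: Age0.
  by rewrite /d mulrC divfK// gt_eqF.
rewrite (_ : _ - _ = - (a_ (p_ n) s + ip (fct q.2) (fct (p_ n).1 \- fct u))); last first.
  rewrite ipBr// [a_ _ s]/a_ (ip_aer _ _ _ s1)// ip_linr//.
  by rewrite (Asym (Ap n) Aq) (ipC _ (fct (p_ n).1)); ring.
rewrite normrN; apply: (le_trans (ler_normD _ _)).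
rewrite (splitr e) lerD//.
apply: (le_trans (normr_ip _ _)) => //.
apply: (@le_trans _ _ (M * (e / 2 / M))).
  apply: ler_pM; rewrite ?nrm_ge0//; first by rewrite /M lerDl.
  exact/ltW/h3.
by rewrite mulrC divfK// gt_eqF.
Qed.

Lemma closure_form_approx p (p_ : nat -> L2 * L2) : (forall n, A (p_ n)) ->
  cvg_L2 (fun n => (p_ n).1) p.1 -> cvg_L2 (fun n => (p_ n).2) p.2 ->
  form_approx A p_ p.1.
Proof.
move=> Ap p1 p2; split => // e e0.
move/cvg_L2P : p1 => p1; move/cvg_L2P : p2 => p2.
(* The two differences have norm at most 2 d, and (2 d)^2 <= 4 d < e. *)
pose d := Num.min 1 (e / 5).
have d0 : 0 < d by rewrite lt_min ltr01/= divr_gt0.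
have d1 : d <= 1 by rewrite ge_min lexx.
have d2 : d <= e / 5 by rewrite ge_min lexx orbT.
have [N1 h1] := p1 d d0; have [N2 h2] := p2 d d0.
exists ([set n | (maxn N1 N2 <= n)%N], [set n | (maxn N1 N2 <= n)%N]).
  by split; exists (maxn N1 N2).
move=> [m n] /= []; rewrite !geq_max => /andP[m1 m2] /andP[n1 n2].
apply: (le_lt_trans (normr_ip _ _)) => //.
have a1 : nrm (fct (p_ m).2 \- fct (p_ n).2) <= d + d.
  apply: (le_trans (nrm_sub_trans (g := fct p.2) _ _ _)) => //.
  by apply: lerD; rewrite ?(nrm_subC _ (fct p.2)); apply/ltW/h2.
have a2 : nrm (fct (p_ m).1 \- fct (p_ n).1) <= d + d.
  apply: (le_trans (nrm_sub_trans (g := fct p.1) _ _ _)) => //.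
  by apply: lerD; rewrite ?(nrm_subC _ (fct p.1)); apply/ltW/h1.
have := ler_pM (nrm_ge0 _ _) (nrm_ge0 _ _) a1 a2.
by move/le_lt_trans; apply; nra.
Qed.

(** When A p_n converges in L^2, (A p_n, q_n) pairs two L^2-convergent sequences, so its limit is
    (p.2, w) whichever approximation of w is given. *)
Lemma closure_sub_friedrichs : op_closure A `<=` friedrichs A.
Proof.
move=> p [p_ [Ap p1 p2]]; have papp := closure_form_approx Ap p1 p2.
split; first by exists p_.
move=> w [q_ qapp]; exists p_, q_; split => //.
have [Aq /cvg_L2P qw _] := qapp; move/cvg_L2P : p2 => p2.
apply/cvgrPdist_le => e e0.
pose M := nrm (fct p.2) + nrm (fct w) + 1.
have [n1 n2] : 0 <= nrm (fct p.2) /\ 0 <= nrm (fct w) by rewrite !nrm_ge0.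
have M0 : 0 < M by rewrite /M; lra.
pose d := Num.min 1 (e / (2 * M)).
have d0 : 0 < d by rewrite lt_min ltr01/= divr_gt0// mulr_gt0.
have d1 : d <= 1 by rewrite ge_min lexx.
have dM : d * (2 * M) <= e by rewrite -ler_pdivlMr ?mulr_gt0// ge_min lexx orbT.
have [N1 h1] := p2 d d0; have [N2 h2] := qw d d0.
exists (maxn N1 N2) => // n /=; rewrite geq_max => /andP[/h1 {}h1 /h2 {}h2].
rewrite (_ : _ - _ = - (ip (fct (p_ n).2) (fct (q_ n).1 \- fct w) +
    ip (fct (p_ n).2 \- fct p.2) (fct w))); last first.
  by rewrite ipBr// ipBl//; ring.
rewrite normrN; apply: (le_trans (ler_normD _ _)).
have b1 : nrm (fct (p_ n).2) <= nrm (fct p.2) + 1.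
  rewrite (_ : fct (p_ n).2 = fct p.2 \+ (fct (p_ n).2 \- fct p.2)); last first.
    by apply/funext => x /=; rewrite addrC subrK.
  apply: (le_trans (nrmD _ _)) => //; rewrite lerD2l.
  exact: (le_trans (ltW h1)).
have c1 : `|ip (fct (p_ n).2) (fct (q_ n).1 \- fct w)| <= nrm (fct (p_ n).2) * nrm (fct (q_ n).1 \- fct w).
  exact: normr_ip.
have c2 : `|ip (fct (p_ n).2 \- fct p.2) (fct w)| <= nrm (fct (p_ n).2 \- fct p.2) * nrm (fct w).
  exact: normr_ip.
have := ler_pM (nrm_ge0 _ _) (nrm_ge0 _ _) b1 (ltW h2).
have := ler_wpM2r n2 (ltW h1).
by rewrite /M in dM *; nra.
Qed.

Hypothesis Adense : densely_defined A.
Variable lam : R.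
Hypothesis lam0 : 0 < lam.
Hypothesis Arange : forall (w : L2) e, 0 < e ->
  exists2 q, A q & nrm ((fun x => lam * fct q.1 x + fct q.2 x) \- fct w) < e.

(** The Friedrichs operator lies in the adjoint, the adjoint in the closure, and the closure in the
    Friedrichs operator. The density of the range enters through the middle inclusion. *)
Theorem essentially_selfadjoint_friedrichs :
  essentially_selfadjoint A /\ friedrichs A = op_closure A.
Proof.
have cA := adjoint_sub_closure Asym Age0 lam0 Arange.
split; last first.
  apply/seteqP; split; last exact: closure_sub_friedrichs.
  exact: subset_trans friedrichs_sub_adjoint cA.
split => //.
  by split => //; exact: symmetric_functional.
have dcA := densely_defined_closure Adense.
split => //; last exact: (adjoint_closureE Asym Age0 lam0 Arange).
split; last exact: lin_closed_closure.
apply: symmetric_functional => // p q cp cq.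
by have := closure_sub_adjoint Asym cq cp.
Qed.

End form_closure.

(** * Borel measurability and Lebesgue measure on row vectors *)

Section row_vectors.
Context {R : realType} {n : nat}.
Implicit Types v w : 'rV[R]_n.

Lemma ltr_norm_rV v r : 0 < r -> `|v| < r <-> forall i, `|v 0 i| < r.
Proof.
move=> r0; have <- : ball (0 : 'rV[R]_n) r v <-> `|v| < r.
  by rewrite mx_norm_ball /ball_/= sub0r normrN.
split=> [[_ h] i|h]; first by have := h 0 i; rewrite mxE /ball/= sub0r normrN.
by split => // i j; rewrite mxE ord1 /ball/= sub0r normrN.
Qed.

Lemma measurable_coord_rV i : measurable_fun setT (fun v => v 0 i).
Proof.
apply: (measurability _ (RGenOpens.measurableE R)) => _ [_ [a [b ->] <-]].
rewrite setTI; apply: measurable_rV_open; apply: open_comp.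
  by move=> v _; exact: coord_continuous.
exact: interval_open.
Qed.

Lemma continuous_measurable_rV (f : 'rV[R]_n -> R) :
  continuous f -> measurable_fun setT f.
Proof.
move=> cf; apply: (measurability _ (RGenOpens.measurableE R)) => _ [_ [a [b ->] <-]].
rewrite setTI; apply: measurable_rV_open; apply: open_comp; last exact: interval_open.
by move=> v _; exact: cf.
Qed.

(** An open set is a countable union of rational cubes, and the preimage of a cube is a finite
    intersection of coordinate conditions. *)
Lemma measurable_fun_rV d (T : measurableType d) (g : T -> 'rV[R]_n) :
  (forall i, measurable_fun setT (fun t => g t 0 i)) -> measurable_fun setT g.
Proof.
move=> mg; apply: (@measurability _ _ _ _ _ _ (@open 'rV[R]_n)) => // _ [A oA <-].
rewrite setTI (open_rV_cubes oA) preimage_bigcup.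
apply: countable_bigcupT_measurable => // -[q k].
have [qA|qA] := pselect (ball (map_mx ratr q : 'rV[R]_n) k.+1%:R^-1 `<=` A); last first.
  by rewrite [X in measurable X](_ : _ = set0)//; apply/seteqP; split=> // p [].
rewrite [X in measurable X](_ : _ = \bigcap_(i in [set: 'I_n])
    ((fun t => g t 0 i) @^-1` ball (ratr (q 0 i) : R) k.+1%:R^-1)).
  apply: fin_bigcap_measurable => // i _; rewrite -[X in measurable X]setTI.
  by apply: mg => //; exact: measurable_ball.
apply/seteqP; split=> [t /= [_ [k0 h]] i _|t h].
  by have := h 0 i; rewrite mxE.
split => //; split => // i j; rewrite ord1 mxE; exact: h.
Qed.

Lemma measurable_funB_rV d (T : measurableType d) (f g : T -> 'rV[R]_n) :
  measurable_fun setT f -> measurable_fun setT g -> measurable_fun setT (fun t => f t - g t).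
Proof.
move=> mf mg; apply: measurable_fun_rV => i.
under eq_fun do rewrite !mxE.
by apply: measurable_funB; apply: (measurableT_comp (@measurable_coord_rV i)).
Qed.

Lemma continuous_cst_rV (a : R) : continuous (fun _ : 'rV[R]_n => a).
Proof. exact: cst_continuous. Qed.

Lemma continuous_mul_rV (f g : 'rV[R]_n -> R) : continuous f -> continuous g ->
  continuous (fun v => f v * g v).
Proof. by move=> cf cg v; have FF := nbhs_filter v; apply: (cvgM (cf v) (cg v)). Qed.

Lemma continuous_sub_rV (f g : 'rV[R]_n -> R) : continuous f -> continuous g ->
  continuous (fun v => f v - g v).
Proof. by move=> cf cg v; have FF := nbhs_filter v; apply: (@cvgB _ R^o _ _ FF _ _ _ _ (cf v) (cg v)). Qed.

Lemma continuous_add_rV (f g : 'rV[R]_n -> R) : continuous f -> continuous g ->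
  continuous (fun v => f v + g v).
Proof. by move=> cf cg v; have FF := nbhs_filter v; apply: (@cvgD _ R^o _ _ FF _ _ _ _ (cf v) (cg v)). Qed.

Lemma continuous_max_rV (a : R) (f : 'rV[R]_n -> R) : continuous f ->
  continuous (fun v => Num.max a (f v)).
Proof.
move=> cf v; apply: (@continuous_max _ _ (cst (a : R^o)) f) => //; last exact: cf.
exact: cst_continuous.
Qed.

Lemma continuous_min_rV (a : R) (f : 'rV[R]_n -> R) : continuous f ->
  continuous (fun v => Num.min a (f v)).
Proof.
move=> cf v; apply: (@continuous_min _ _ (cst (a : R^o)) f) => //; last exact: cf.
exact: cst_continuous.
Qed.

Lemma continuous_dist_rV v : continuous (fun w => `|w - v|).
Proof.
move=> w; have FF := nbhs_filter w.
apply/(@cvgrPdist_lt _ R^o _ _ FF) => e e0.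
apply: filterS (nbhsx_ballx w e e0) => y; rewrite mx_norm_ball /ball_/= => wy.
apply: le_lt_trans (ler_dist_dist _ _) _.
by rewrite opprB addrA subrK.
Qed.

Lemma measurable_norm_rV : measurable_fun setT (fun v => `|v|).
Proof. by apply: continuous_measurable_rV; exact: norm_continuous. Qed.

Lemma measurable_set1_rV v : measurable [set v].
Proof.
rewrite (_ : [set v] = [set w | forall i, w 0 i \in `[v 0 i, v 0 i]]); last first.
  apply/seteqP; split=> [w -> i|w h]; first by rewrite in_itv/= lexx.
  by apply/rowP => i; apply/eqP; have := h i; rewrite in_itv/= -eq_le eq_sym.
exact: measurable_rV_box.
Qed.

End row_vectors.

(** * Translation invariance and null sets of Lebesgue measure on row vectors *)

Section lebesgue_translation.
Context {R : realType}.

Lemma lebesgue_measure_shift (a : R) (A : set R) : measurable A ->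
  pushforward lebesgue_measure ((fun x => x + a) : R -> measurableTypeR R) A =
  lebesgue_measure A.
Proof.
have ms : measurable_fun setT ((fun x => x + a) : R -> measurableTypeR R).
  by apply: measurable_funD.
move=> mA; apply/esym/lebesgue_measure_unique => //=.
  move=> _ [[b c]] _ <-; rewrite /pushforward/=.
  rewrite (_ : _ @^-1` _ = `]b - a, c - a]%classic); last first.
    by apply/seteqP; split=> x /=; rewrite !in_itv/= ltrBlDr lerBrDr.
  rewrite !lebesgue_measure_itv/= !lte_fin ltrD2r -!EFinD.
  by congr (if _ then _%:E else _); lra.
Qed.

Lemma ge0_integral_lebesgue_shift (a : R) (f : R -> \bar R) :
  measurable_fun setT f -> (forall x, 0 <= f x)%E ->
  (\int[lebesgue_measure]_x f (x + a)%R = \int[lebesgue_measure]_x f x)%E.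
Proof.
move=> mf f0.
have ms : measurable_fun setT ((fun x => x + a) : R -> measurableTypeR R).
  by apply: measurable_funD.
transitivity (\int[pushforward lebesgue_measure
    ((fun x => x + a)%R : R -> measurableTypeR R)]_x f x)%E.
  by rewrite ge0_integral_pushforward.
by apply: eq_measure_integral => //= A mA _; exact: lebesgue_measure_shift.
Qed.

Lemma ge0_integral_rV_cons n (f : 'rV[R]_n.+1 -> \bar R) :
  measurable_fun setT f -> (forall v, 0 <= f v)%E ->
  (\int[lebesgue_rV n.+1]_v f v =
   \int[lebesgue_measure]_a \int[lebesgue_rV n]_w f (row_cons (a, w)))%E.
Proof.
move=> mf f0.
have mr := @measurable_row_cons R n.
rewrite -[LHS]/(\int[pushforward (lebesgue_measure \x lebesgue_rV n) (@row_cons R n)]_v f v)%E.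
rewrite (@ge0_integral_pushforward _ _ _ _ _ _ mr (lebesgue_measure \x lebesgue_rV n)%E setT f)//.
rewrite preimage_setT (@fubini_tonelli1 _ _ _ _ _ _ _ (f \o @row_cons R n))//.
  exact: measurableT_comp.
by move=> x; exact: f0.
Qed.

(** Tonelli separates the first coordinate; the remaining ones are shifted by induction and the
    first one by the one-dimensional invariance. *)
Lemma lebesgue_rV_shift n (x : 'rV[R]_n) (f : 'rV[R]_n -> \bar R) :
  measurable_fun setT f -> (forall v, 0 <= f v)%E ->
  (\int[lebesgue_rV n]_v f (v + x)%R = \int[lebesgue_rV n]_v f v)%E.
Proof.
elim: n x f => [|n ih] x f mf f0.
  by apply: eq_integral => v _; congr f; apply/rowP => -[].
have mfx : measurable_fun setT (fun v : 'rV[R]_n.+1 => f (v + x)%R).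
  apply: measurableT_comp => //; apply: measurable_fun_rV => i.
  under eq_fun do rewrite mxE.
  by apply: measurable_funD => //; exact: measurable_coord_rV.
rewrite (ge0_integral_rV_cons mfx (fun v => f0 (v + x))) (ge0_integral_rV_cons mf f0).
have mfr : measurable_fun setT (f \o @row_cons R n).
  by apply: measurableT_comp => //; exact: measurable_row_cons.
transitivity (\int[lebesgue_measure]_a \int[lebesgue_rV n]_w f (row_cons ((a + x 0 0)%R, w)))%E.
  apply: eq_integral => a _.
  rewrite -[RHS](ih (rsubmx (x : 'rV[R]_(1 + n)))).
  - apply: eq_integral => w _; congr f; apply/rowP => j; rewrite mxE.
    case: (@split_ordP 1 n j) => j' ->.
      have -> : lshift n j' = 0 :> 'I_n.+1 by apply: val_inj; rewrite /= ord1.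
      by rewrite !row_cons0.
    by rewrite !row_consS !mxE.
  - by apply: (@measurableT_comp _ _ _ _ _ _ (f \o @row_cons R n) _
      (pair (a + x 0 0 : measurableTypeR R))).
  - by move=> v; exact: f0.
rewrite (ge0_integral_lebesgue_shift _ (f := fun a => (\int[lebesgue_rV n]_w f (row_cons (a, w)))%E))//.
- have mF := measurable_fun_fubini_tonelli_F (m2 := lebesgue_rV n) (f \o @row_cons R n) mfr (fun p => f0 _).
  exact: mF.
- by move=> a; apply: integral_ge0.
Qed.

(** A point is a degenerate box. In dimension 0 the measure is a Dirac mass and the claim fails;
    this is the origin of the hypothesis [0 < d] further on. *)
Lemma lebesgue_rV_set1 n (x : 'rV[R]_n) : (0 < n)%N -> lebesgue_rV n [set x] = 0%E.
Proof.
move=> n0; rewrite (_ : [set x] = [set w | forall i, w 0 i \in `[x 0 i, x 0 i]]); last first.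
  apply/seteqP; split=> [w -> i|w h]; first by rewrite in_itv/= lexx.
  by apply/rowP => i; apply/eqP; have := h i; rewrite in_itv/= -eq_le eq_sym.
rewrite lebesgue_rV_box//; case: n n0 x => // n _ x.
by rewrite big_ord_recl subrr mul0r.
Qed.

Lemma lebesgue_rV_countable n (A : set 'rV[R]_n) : (0 < n)%N -> countable A ->
  measurable A /\ lebesgue_rV n A = 0%E.
Proof.
move=> n0 cA; have mA : measurable A.
  by apply: countable_measurable => // v; exact: measurable_set1_rV.
split => //; apply: measure_negligible => //.
have /countable_injP[f finj] := cA.
rewrite (_ : A = \bigcup_k (A `&` f @^-1` [set k])); last first.
  by apply/seteqP; split=> [x Ax|x [k _ []]//]; exists (f x).
apply: negligible_bigcup => k.
have [[x [Ax fx]]|no] := pselect (exists x, A x /\ f x = k).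
  exists [set x]; split; [exact: measurable_set1_rV|exact: lebesgue_rV_set1|].
  by move=> y [Ay /= fy]; apply: finj; rewrite ?inE// fx.
rewrite (_ : _ `&` _ = set0); first exact: negligible_set0.
by apply/seteqP; split => // x [Ax fx]; apply: no; exists x.
Qed.

Lemma lebesgue_rV_ball n (r : R) : (lebesgue_rV n [set v | (`|v| < r)%R] < +oo)%E.
Proof.
have [r0|r0] := ltP 0 r; last first.
  rewrite (_ : [set v | _] = set0) ?measure0//; apply/seteqP; split => // v /= vr.
  by have := le_lt_trans (normr_ge0 v) (lt_le_trans vr r0); rewrite ltxx.
apply: (@le_lt_trans _ _ (lebesgue_rV n [set v | forall i, v 0 i \in `[- r, r]])); last first.
  by rewrite (@lebesgue_rV_box _ _ (fun=> - r) (fun=> r)) ?ltry// => i; lra.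
apply: le_measure; rewrite ?inE.
- rewrite -[X in measurable X]setTI; have := @measurable_norm_rV R n.
  by move=> /(_ measurableT [set x | x < r]); apply; rewrite -set_itvNyo; exact: measurable_itv.
- exact: (@measurable_rV_box _ _ (fun=> - r) (fun=> r)).
- move=> v /= /(ltr_norm_rV _ r0) h i; rewrite in_itv/= -ler_norml; exact/ltW/h.
Qed.

End lebesgue_translation.

(** * Counting points of a configuration *)

Section bounded_support.
Context {R : realType} {d : nat}.
Implicit Types (f h : 'rV[R]_d -> R) (g : config R d) (v w x y : 'rV[R]_d).

(** The norm of row vectors is the sup norm, so these balls are open cubes exhausting the space. *)
Definition cube n : set 'rV[R]_d := [set v | `|v| < n%:R].

Lemma le_cube m n : (m <= n)%N -> cube m `<=` cube n.
Proof. by move=> mn v /= /lt_le_trans; apply; rewrite ler_nat. Qed.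

Lemma cube_ex v : exists n, cube n v.
Proof. by exists (Num.bound `|v|); rewrite /cube/= archi_boundP. Qed.

Lemma measurable_cube n : measurable (cube n).
Proof.
rewrite -[X in measurable X]setTI; have := @measurable_norm_rV R d.
move=> /(_ measurableT [set x | x < n%:R]); apply.
by rewrite -set_itvNyo; exact: measurable_itv.
Qed.

Lemma closed_ball0 (r : R) : closed [set v : 'rV[R]_d | `|v| <= r].
Proof.
apply: (@preimage_closed _ _ (fun v : 'rV[R]_d => `|v|) [set x | x <= r]).
  by move=> v _; exact: norm_continuous.
exact: closed_le.
Qed.

Lemma compact_ball0 (r : R) : compact [set v : 'rV[R]_d | `|v| <= r].
Proof.
apply: bounded_closed_compact; last exact: closed_ball0.
exists r; split; first exact: num_real.
by move=> M rM v /= /le_trans; apply; exact: ltW.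
Qed.

Lemma finite_cube g n : finite_set (g `&` cube n).
Proof.
apply: sub_finite_set (locally_finite g (@compact_ball0 n%:R)).
by apply: setIS => v /ltW.
Qed.
Hint Resolve finite_cube : core.

Lemma countable_config g : countable g.
Proof.
rewrite (_ : (g : set _) = \bigcup_n (g `&` cube n)).
  by apply: bigcup_countable => // n _; exact: finite_set_countable.
apply/seteqP; split=> [v gv|v [n _ []//]].
by have [n vn] := cube_ex v; exists n.
Qed.

Lemma measurable_config_set g : measurable (g : set 'rV[R]_d).
Proof.
apply: countable_measurable; last exact: countable_config.
by move=> v; exact: measurable_set1_rV.
Qed.

Definition bsupp n f := forall v, f v != 0 -> cube n v.

Lemma bsupp0 n f v : bsupp n f -> ~ cube n v -> f v = 0.
Proof. by move=> sf nv; apply/eqP; apply: contra_notT nv; exact: sf. Qed.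

Lemma le_bsupp m n f : (m <= n)%N -> bsupp m f -> bsupp n f.
Proof. by move=> mn sf v /sf; exact: le_cube. Qed.

Lemma bsupp_indic n (A : set 'rV[R]_d) : bsupp n (\1_(A `&` cube n)).
Proof.
move=> v; rewrite indicE pnatr_eq0 eqb0 negbK => /set_mem[].
by [].
Qed.

(** The big operator in [pairing] returns 0 on infinite supports, and its index set depends on the
    function. Summing over the fixed finite set of points of a cube makes linearity and limits
    available. *)
Lemma pairingE n f g : bsupp n f ->
  pairing f g = \sum_(x <- fset_set (g `&` cube n)) f x.
Proof.
move=> sf; rewrite /pairing -fsbig_finite//; apply/esym; apply: fsbig_widen.
  exact: subIsetl.
by move=> v [gv h] /=; apply: (bsupp0 sf) => nv; apply: h.
Qed.

Lemma mem_cube_fset g n v : (v \in fset_set (g `&` cube n)) = (v \in (g `&` cube n)).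
Proof. by rewrite in_fset_set. Qed.

Lemma test_fun_bsupp f : test_fun f -> exists n, bsupp n f.
Proof.
move=> [_ /compact_bounded [M [_ h]]].
have [n Mn] : exists n : nat, M + 1 < n%:R.
  by exists (Num.bound `|M + 1|); rewrite (le_lt_trans (ler_norm _))// archi_boundP.
exists n => v fv; apply: le_lt_trans Mn; apply: h; first by rewrite ltrDl.
exact: subset_closure.
Qed.

Lemma bsupp_test_fun n f : continuous f -> bsupp n f -> test_fun f.
Proof.
move=> cf sf; split => //.
apply: (@subclosed_compact _ _ [set v | `|v| <= n%:R]).
- exact: closed_closure.
- exact: compact_ball0.
- have /closure_id E := @closed_ball0 n%:R.
  by rewrite E; apply: closure_subset => v /sf /ltW.
Qed.

Lemma pairing_cvg n (f_ : nat -> 'rV[R]_d -> R) f g :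
  (forall k, bsupp n (f_ k)) -> bsupp n f -> (forall v, f_ k v @[k --> \oo] --> f v) ->
  pairing (f_ k) g @[k --> \oo] --> pairing f g.
Proof.
move=> sf_ sf cf; rewrite (pairingE g sf).
under eq_fun do rewrite (pairingE g (sf_ _)).
by apply: cvg_big => [|x _]; [exact: add_continuous|exact: cf].
Qed.

Lemma pairing_lin n f h a g : bsupp n f -> bsupp n h ->
  pairing (fun v => a * f v + h v) g = a * pairing f g + pairing h g.
Proof.
move=> sf sh; rewrite (pairingE _ sf) (pairingE _ sh) (@pairingE n).
  by rewrite big_split/= mulr_sumr.
move=> v; apply: contra_neqP => nv.
by rewrite (bsupp0 sf)// (bsupp0 sh)// mulr0 addr0.
Qed.

End bounded_support.
#[global] Hint Resolve finite_cube measurable_cube measurable_config_set : core.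

(** * Counts of Borel sets as limits of pairings with test functions *)

Section measurability_of_counts.
Context {R : realType} {d : nat}.
Context dX (X : measurableType dX) (c : X -> config R d).
Hypothesis mc : forall f, test_fun f -> measurable_fun setT (fun x => pairing f (c x)).

Let pos (t : R) : R := Num.max 0 t.

Let continuous_tent (v : 'rV[R]_d) (r : R) : continuous (fun w => pos (r - `|w - v|)).
Proof.
apply: continuous_max_rV; apply: continuous_sub_rV; first exact: continuous_cst_rV.
exact: continuous_dist_rV.
Qed.

(** [i] is decoded as a rational cube. The tent is positive exactly inside that cube if the cube is
    contained in [O]; all other codes give 0. By [open_rV_cubes], some tent is positive at each
    point of [O]. *)
Let tents (O : set 'rV[R]_d) (i : nat) (w : 'rV[R]_d) : R :=
  if (choice.unpickle i : option ('rV[rat]_d * nat)%type) is Some (q, k) then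
    if `[< ball (map_mx ratr q : 'rV[R]_d) k.+1%:R^-1 `<=` O >] then
      pos (k.+1%:R^-1 - `|w - map_mx ratr q|)
    else 0
  else 0.

Let tents_ge0 O i w : 0 <= tents O i w.
Proof.
rewrite /tents; case: choice.unpickle => [[q k]|//].
by case: ifP => // _; rewrite le_max lexx.
Qed.

Let continuous_tents O i : continuous (tents O i).
Proof.
rewrite /tents; case: choice.unpickle => [[q k]|]; last exact: continuous_cst_rV.
case: asbool; last exact: continuous_cst_rV.
exact: continuous_tent.
Qed.

(** A continuous approximation of the indicator of the part of [O] in the cube: the sum of tents is
    eventually positive on [O] and 0 outside, and the factor N drives positive values up to the cap
    1. The second factor does the same for the cube. *)
Let bump (O : set 'rV[R]_d) (n N : nat) (w : 'rV[R]_d) : R :=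
  Num.min 1 (N%:R * \sum_(i < N) tents O i w) * Num.min 1 (N%:R * pos (n%:R - `|w - 0|)).

Let bsupp_bump O n N : bsupp n (bump O n N).
Proof.
move=> w; rewrite /bump /pos subr0 /cube/=; apply: contra_neqT; rewrite -leNgt => nw.
have -> : Num.max 0 (n%:R - `|w|) = 0 by apply/max_idPl; rewrite subr_le0.
have -> : N%:R * 0 = 0 :> R by rewrite mulr0.
have -> : Num.min (1 : R) 0 = 0 by apply/min_idPr; exact: ler01.
by rewrite mulr0.
Qed.

Let test_fun_bump O n N : test_fun (bump O n N).
Proof.
have ct m : continuous (fun w => \sum_(i < m) tents O i w).
  elim: m => [|m ih]; first by under eq_fun do rewrite big_ord0; exact: continuous_cst_rV.
  under eq_fun do rewrite big_ord_recr/=.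
  by apply: continuous_add_rV => //; exact: continuous_tents.
apply: bsupp_test_fun (@bsupp_bump O n N); apply: continuous_mul_rV.
  apply: continuous_min_rV; apply: continuous_mul_rV; first exact: continuous_cst_rV.
  exact: ct.
apply: continuous_min_rV; apply: continuous_mul_rV; first exact: continuous_cst_rV.
exact: continuous_tent.
Qed.

Let cvg_bump O n w : open O -> bump O n N w @[N --> \oo] --> (\1_(O `&` cube n) w : R).
Proof.
move=> oO.
have [Ow|nOw] := pselect (O w); last first.
  rewrite indicE memNset; last by case.
  rewrite (_ : (fun N => _) = fun=> 0); first exact: cvg_cst.
  apply/funext => N; rewrite /bump; suff -> : \sum_(i < N) tents O i w = 0.
    have -> : N%:R * 0 = 0 :> R by rewrite mulr0.
    have -> : Num.min (1 : R) 0 = 0 by apply/min_idPr; exact: ler01.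
    by rewrite mul0r.
  apply: big1 => i _.
  rewrite /tents; case: choice.unpickle => [[q k]|//]; case: ifP => // /asboolP qO.
  apply/max_idPl; rewrite leNgt; apply/negP => h; apply: nOw; apply: qO.
  by rewrite mx_norm_ball /ball_/= distrC -subr_gt0.
have [nw|nw] := pselect (cube n w); last first.
  rewrite indicE memNset; last by case.
  rewrite (_ : (fun N => _) = fun=> 0); first exact: cvg_cst.
  by apply/funext => N; exact: bsupp0 nw.
rewrite indicE mem_set//.
move: (Ow); rewrite {1}(open_rV_cubes oO) => -[[q k] _ /= [qO qw]].
pose i := choice.pickle (q, k).
have ti : 0 < tents O i w.
  rewrite /tents /i choice.pickleK asboolT// lt_max subr_gt0; apply/orP; right.
  by move: qw; rewrite mx_norm_ball /ball_/= distrC.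
have tn : 0 < pos (n%:R - `|w - 0|) by rewrite lt_max subr_gt0 subr0 nw orbT.
set t := tents O i w in ti; set s := pos _ in tn.
(* From this N on, the partial sum contains the tent i, and both factors multiplied by N exceed
   1. *)
apply: cvg_near_cst; exists (maxn i.+1 (maxn (Num.bound t^-1) (Num.bound s^-1))) => //.
move=> N /=; rewrite !geq_max => /and3P[iN tN sN].
have big1' (r y : R) : 0 < r -> (Num.bound r^-1 <= N)%N -> r <= y -> Num.min 1 (N%:R * y) = 1.
  move=> r0 rN ry; apply/min_idPl.
  have : r^-1 < N%:R by rewrite (lt_le_trans (archi_boundP _)) ?ler_nat// ltW// invr_gt0.
  rewrite -[r^-1]mul1r ltr_pdivrMr// => /ltW /le_trans; apply.
  by rewrite ler_wpM2l.
rewrite /bump -/s [X in _ * X](big1' s)// (big1' t) ?mulr1//.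
by rewrite (bigD1 (Ordinal iN))//= -/t lerDl sumr_ge0.
Qed.

(** The hypothesis on [c] concerns pairings only: the measurability of [c] itself is deduced from
    these counts, in [measurable_config]. *)
Lemma measurable_pairing_open n (O : set 'rV[R]_d) : open O ->
  measurable_fun setT (fun x => pairing (\1_(O `&` cube n)) (c x)).
Proof.
move=> oO; apply: (@measurable_fun_cvg _ _ _ _ (fun N x => pairing (bump O n N) (c x))).
  by move=> N; apply: mc; exact: test_fun_bump.
move=> x _; apply: (@pairing_cvg _ _ n) => [k||v].
- exact: bsupp_bump.
- exact: bsupp_indic.
- exact: cvg_bump.
Qed.

(** Dynkin's theorem from open sets. Intersecting with a cube keeps all counts finite, so that a
    complement becomes a subtraction. *)
Lemma measurable_pairing_indic n (B : set 'rV[R]_d) : measurable B ->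
  measurable_fun setT (fun x => pairing (\1_(B `&` cube n)) (c x)).
Proof.
move=> mB.
pose P := [set A : set 'rV[R]_d | measurable_fun setT (fun x => pairing (\1_(A `&` cube n)) (c x))].
apply: (@dynkin_induction _ 'rV[R]_d (@open 'rV[R]_d) P).
- by [].
- by move=> A B' oA oB'; exact: openI.
- by apply: measurable_pairing_open; exact: openT.
- by move=> A oA; exact: measurable_pairing_open.
- move=> A mA PA; rewrite /P/=.
  rewrite (_ : (fun x => _) = (fun x => pairing (\1_(setT `&` cube n)) (c x) -
      pairing (\1_(A `&` cube n)) (c x))).
    apply: measurable_funB => //; apply: measurable_pairing_open; exact: openT.
  apply/funext => x.
  rewrite addrC -mulN1r -(@pairing_lin _ _ n); [|exact: bsupp_indic|exact: bsupp_indic].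
  congr (pairing _ _); apply/funext => v; rewrite !indicE !in_setI in_setC in_setT.
  by case: (v \in A); case: (v \in cube n); rewrite /= ?mulr0 ?mulr1 ?addr0 ?add0r// addNr.
- move=> F mF tF PF; rewrite /P/=.
  apply: (@measurable_fun_cvg _ _ _ _ (fun k x => pairing (\1_((\big[setU/set0]_(i < k) F i) `&` cube n)) (c x))).
  - move=> k.
    rewrite (_ : (fun x => _) = (fun x => \sum_(i < k) pairing (\1_(F i `&` cube n)) (c x))).
      by apply: measurable_sum => i; exact: PF.
    apply/funext => x; elim: k => [|k ih].
      rewrite !big_ord0 set0I indic0 /pairing fsbig1//.
    rewrite !big_ord_recr/= -ih addrC -[X in X + _]mul1r -(@pairing_lin _ _ n); [|exact: bsupp_indic|exact: bsupp_indic].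
    congr (pairing _ _); apply/funext => v; rewrite mul1r !indicE !in_setI !in_setU.
    case: (boolP (v \in F k)) => [Fk|]; last by rewrite orbF add0r.
    rewrite orbT/=; case: (v \in cube n); rewrite ?andbF ?addr0// andbT.
    rewrite (_ : v \in _ = false) ?addr0//; apply/negbTE; rewrite notin_setE.
    rewrite -bigcup_mkord => -[i /= ik Fi].
    have : (F i `&` F k) v by split => //; exact: set_mem.
    by move/trivIsetP : tF => ->//; rewrite ltn_eqF.
  - move=> x _; apply: (@pairing_cvg _ _ n) => [k||v]; try exact: bsupp_indic.
    have [[i _ Fi]|no] := pselect ((\bigcup_k F k) v); last first.
      rewrite (_ : (fun k => _) = fun=> \1_(\bigcup_k F k `&` cube n) v); first exact: cvg_cst.
      apply/funext => k; rewrite !indicE !in_setI; congr ((_ && _)%:R).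
      apply/idP/idP => /set_mem; last by [].
      by rewrite -bigcup_mkord => -[i _ Fi]; case: no; exists i.
    apply: cvg_near_cst; exists i.+1 => // k /= ik.
    rewrite !indicE !in_setI; congr ((_ && _)%:R).
    have FU : (\bigcup_k F k) v by exists i.
    by rewrite !mem_set// -bigcup_mkord; exists i.
- by [].
Qed.

End measurability_of_counts.

(** * Grid cells, the vague topology and its Borel sets *)

Section grid.
Context {R : realType} {d : nat}.
Implicit Types (f h : 'rV[R]_d -> R) (g : config R d) (v w x y : 'rV[R]_d).

(* The cubes of side 1/n of a grid, indexed by the integer parts of the
   coordinates of [n (v + n)]. *)
Definition cells n := {ffun 'I_d -> 'I_(2 * (n * n))}.

Definition cell n (k : cells n) : set 'rV[R]_d :=
  [set v | cube n v /\ forall i, (k i)%:R <= n%:R * (v 0 i + n%:R) < (k i).+1%:R].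

Lemma cell_cube n (k : cells n) : cell k `<=` cube n.
Proof. by move=> v []. Qed.

Lemma cell_inj n (k k' : cells n) v : cell k v -> cell k' v -> k = k'.
Proof.
move=> [_ h] [_ h']; apply/ffunP => i; apply/val_inj/eqP => /=.
have /andP[a1 a2] := h i; have /andP[b1 b2] := h' i.
rewrite eqn_leq -ltnS -(ltnS (k' i)).
by rewrite -2!(ltr_nat R) (le_lt_trans a1 b2) (le_lt_trans b1 a2).
Qed.

Lemma cell_ex n v : cube n v -> exists k : cells n, cell k v.
Proof.
move=> nv; have n0 : 0 < n%:R :> R by apply: le_lt_trans nv; exact: normr_ge0.
have h i : -n%:R < v 0 i < n%:R.
  by rewrite -ltr_norml; have /(ltr_norm_rV _ n0) := nv; apply.
have a0 i : 0 <= n%:R * (v 0 i + n%:R).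
  by rewrite mulr_ge0// ?ler0n// -lerBlDr sub0r; have /andP[/ltW] := h i.
(* |v 0 i| < n gives n (v 0 i + n) < 2 n^2, the number of cells along each axis. *)
have bd i : (Num.truncn (n%:R * (v 0 i + n%:R))%R < 2 * (n * n))%N.
  rewrite -(ltr_nat R); have /andP[t1 _] := truncn_itv (a0 i).
  apply: (le_lt_trans t1); rewrite !natrM; have /andP[_ vn] := h i; nra.
exists [ffun i => Ordinal (bd i)]; split => // i; rewrite ffunE/=.
exact: truncn_itv.
Qed.

Lemma cell_diam n (k : cells n) v w : cell k v -> cell k w -> `|v - w| < n%:R^-1.
Proof.
move=> [nv h] [_ h'].
have n0 : 0 < n%:R :> R by apply: le_lt_trans nv; exact: normr_ge0.
apply/ltr_norm_rV; first by rewrite invr_gt0.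
move=> i; rewrite !mxE -[ltRHS]mul1r ltr_pdivlMr// mulrC.
rewrite -[X in X * _](gtr0_norm n0) -normrM.
have /andP[a1 a2] := h i; have /andP[b1 b2] := h' i.
by rewrite ltr_norml; move: a2 b2; rewrite -!natr1 => a2 b2; apply/andP; split; lra.
Qed.

Lemma measurable_cell n (k : cells n) : measurable (cell k).
Proof.
rewrite (_ : cell k = cube n `&` \bigcap_(i in [set: 'I_d])
   ((fun v : 'rV[R]_d => n%:R * (v 0 i + n%:R)) @^-1` `[(k i)%:R, (k i).+1%:R[)).
  apply: measurableI => //; apply: fin_bigcap_measurable => // i _.
  rewrite -[X in measurable X]setTI.
  have mf : measurable_fun setT (fun v : 'rV[R]_d => n%:R * (v 0 i + n%:R)).
    by apply: measurable_funM => //; apply: measurable_funD => //; exact: measurable_coord_rV.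
  by apply: mf => //; exact: measurable_itv.
apply/seteqP; split=> v [nv h]; split => // i; last by have := h i I; rewrite /= in_itv.
by move=> _; rewrite /= in_itv/=; exact: h.
Qed.

Lemma bsupp_cell n (k : cells n) f : bsupp n (fun v => \1_(cell k) v * f v).
Proof.
move=> v; rewrite mulf_eq0 negb_or => /andP[+ _].
by rewrite indicE pnatr_eq0 eqb0 negbK => /set_mem /cell_cube.
Qed.

Lemma bsupp_indic_cell n (k : cells n) : bsupp n (\1_(cell k)).
Proof. by move=> v; rewrite indicE pnatr_eq0 eqb0 negbK => /set_mem /cell_cube. Qed.

Lemma sum_cells n v : cube n v -> \sum_(k : cells n) \1_(cell k) v = 1 :> R.
Proof.
move=> /cell_ex [k kv]; rewrite (bigD1 k)//= big1 ?addr0; first by rewrite indicE mem_set.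
move=> k' kk'; rewrite indicE memNset// => k'v.
by rewrite (cell_inj kv k'v) eqxx in kk'.
Qed.

Lemma pairing_cells n f g : bsupp n f ->
  pairing f g = \sum_(k : cells n) pairing (fun v => \1_(cell k) v * f v) g.
Proof.
move=> sf; rewrite (pairingE _ sf).
under [RHS]eq_bigr do rewrite (pairingE _ (@bsupp_cell _ _ _)).
rewrite exchange_big/= big_seq [RHS]big_seq; apply: eq_bigr => x.
rewrite mem_cube_fset => /set_mem[_ nx].
by rewrite -mulr_suml sum_cells// mul1r.
Qed.

Lemma pairing_ge0 n f g : bsupp n f -> (forall v, 0 <= f v) -> 0 <= pairing f g.
Proof. by move=> sf f0; rewrite (pairingE _ sf) sumr_ge0. Qed.

Lemma pairing_cell_eq0 n (k : cells n) g f : pairing (\1_(cell k)) g = 0 :> R ->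
  pairing (fun v => \1_(cell k) v * f v) g = 0.
Proof.
rewrite (pairingE _ (@bsupp_indic_cell _ k)) (pairingE _ (@bsupp_cell _ k f)).
move/eqP; rewrite psumr_eq0// => /allP h.
by rewrite big_seq big1// => x /h /eqP ->; rewrite mul0r.
Qed.

Lemma pairing_cell_osc n (k : cells n) g f (a e : R) :
  (forall x, points g x -> cell k x -> `|f x - a| <= e) ->
  `|pairing (fun v => \1_(cell k) v * f v) g - a * pairing (\1_(cell k)) g|
     <= e * pairing (\1_(cell k)) g.
Proof.
move=> h; rewrite (pairingE _ (@bsupp_indic_cell _ k)) (pairingE _ (@bsupp_cell _ k f)).
rewrite !mulr_sumr -sumrB; apply: le_trans (ler_norm_sum _ _ _) _.
rewrite big_seq [leRHS]big_seq; apply: ler_sum => x.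
rewrite mem_cube_fset => /set_mem[gx nx].
rewrite indicE.
have [/set_mem kx|_] := boolP (x \in cell k); last by rewrite mul0r !mulr0 subrr normr0.
by rewrite mul1r !mulr1; exact: h.
Qed.

(** If [g_ n] and [g] have equally many points in every cell, then on a cell occupied by [g] both
    sums are close to f(p) times the common count, p being a point of [g] in the cell; on the other
    cells both vanish. Only the continuity of f at the finitely many points of [g] in a cube is
    used. *)
Lemma cvg_pairing_cells f g (g_ : nat -> config R d) : test_fun f ->
  (forall n (k : cells n), pairing (\1_(cell k)) (g_ n) = pairing (\1_(cell k)) g :> R) ->
  pairing f (g_ n) @[n --> \oo] --> pairing f g.
Proof.
move=> tf eg; have [M sf] := test_fun_bsupp tf; have [cf _] := tf.
pose P : R := pairing (\1_(setT `&` cube M.+1)) g.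
have P0 : 0 <= P by apply: pairing_ge0 (@bsupp_indic _ _ _ _) _ => v; rewrite indicE.
apply/cvgrPdist_le => e0 e00.
(* Each of the two sums contributes at most e per point and [P] points are involved, so the error is
   at most 2 e P <= e0. *)
pose e := e0 / (2 * (P + 1)).
have e_gt0 : 0 < e by rewrite divr_gt0// mulr_gt0// ltr_wpDl.
have [N hN] : exists N, forall n, (N <= n)%N -> forall p, points g p -> cube M.+1 p ->
    forall y, `|y - p| < n%:R^-1 -> `|f y - f p| <= e.
  have hp p : exists N, forall n, (N <= n)%N ->
      forall y, `|y - p| < n%:R^-1 -> `|f y - f p| <= e.
    have := cf p; have FF := nbhs_filter p.
    move=> /(@cvgrPdist_le _ R^o _ _ FF) /(_ e e_gt0).
    move=> /nbhs_ballP[r /= r0 hr]; have [N Nr] : exists N : nat, r^-1 < N%:R.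
      by exists (Num.bound r^-1); rewrite archi_boundP// ltW// invr_gt0.
    exists N => n Nn y yp; rewrite distrC; apply: hr.
    rewrite mx_norm_ball /ball_/= distrC; apply: lt_trans yp _.
    have N0 : 0 < N%:R :> R by rewrite (lt_trans _ Nr)// invr_gt0.
    rewrite -(invrK r) ltf_pV2 ?posrE ?invr_gt0//.
      by rewrite (lt_le_trans Nr)// ler_nat.
    by rewrite (lt_le_trans N0)// ler_nat.
  have [N_ hN_] := choice hp.
  exists (\max_(p <- fset_set (g `&` cube M.+1)) N_ p)%N => n Nn p gp Mp.
  apply: hN_; apply: leq_trans Nn; apply: leq_bigmax_seq => //.
  by rewrite mem_cube_fset mem_set.
exists (maxn N M.+1) => // n /=; rewrite geq_max => /andP[Nn Mn].
have n0 : (0 < n)%N by exact: leq_trans Mn.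
have sfn := le_bsupp (ltnW Mn) sf.
rewrite !(pairing_cells _ sfn) -sumrB.
apply: le_trans (ler_norm_sum _ _ _) _.
apply: (@le_trans _ _ (2 * e * P)); last first.
  have : e * (2 * (P + 1)) = e0.
    by rewrite divfK// gt_eqF// mulr_gt0// ltr_wpDl.
  by nra.
have sM : bsupp n (\1_(setT `&` cube M.+1) : 'rV[R]_d -> R).
  by apply: le_bsupp Mn _; exact: bsupp_indic.
rewrite /P (pairing_cells _ sM) mulr_sumr; apply: ler_sum => k _.
have c0 : 0 <= pairing (fun v => \1_(cell k) v * \1_(setT `&` cube M.+1) v) g :> R.
  by apply: pairing_ge0 (@bsupp_cell _ _ _) _ => v; rewrite !indicE mulr_ge0.
have [[u [ku Mu]]|no] := pselect (exists u, cell k u /\ cube M u); last first.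
  have E : (fun v => \1_(cell k) v * f v) = fun=> 0.
    apply/funext => v; rewrite indicE; case: (boolP (v \in _)) => [/set_mem kv|_].
      rewrite (bsupp0 sf) ?mulr0// => Mv; apply: no; by exists v.
    by rewrite mul0r.
  have z g' : pairing (fun v => \1_(cell k) v * f v) g' = 0.
    by rewrite E /pairing fsbig1.
  by rewrite !z subrr normr0 mulr_ge0// mulr_ge0//; exact: ltW.
(* A cell meeting the cube [M] has diameter less than 1 / n <= 1, so it lies in the cube [M.+1];
   this is why the points of [g] are counted there. *)
have kM v : cell k v -> cube M.+1 v.
  move=> kv; rewrite /cube/= -(subrK u v); apply: le_lt_trans (ler_normD _ _) _.
  rewrite -natr1 addrC ltrD//; apply: lt_le_trans (cell_diam kv ku) _.
  by rewrite invf_le1 ?ltr0n// ler1n.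
have -> : (fun v => \1_(cell k) v * \1_(setT `&` cube M.+1) v) = \1_(cell k) :> (_ -> R).
  apply/funext => v; rewrite !indicE; case: (boolP (v \in cell k)) => [/set_mem kv|_].
    by rewrite mem_set ?mulr1//; split => //; exact: kM.
  by rewrite mul0r.
have [[p [gp kp]]|nop] := pselect (exists p, points g p /\ cell k p); last first.
  have E0 : pairing (\1_(cell k)) g = 0 :> R.
    rewrite (pairingE _ (@bsupp_indic_cell _ k)) big_seq big1// => x.
    rewrite mem_cube_fset => /set_mem[gx _]; rewrite indicE memNset// => kx.
    by apply: nop; exists x.
  have E1 : pairing (\1_(cell k)) (g_ n) = 0 :> R by rewrite eg.
  by rewrite !pairing_cell_eq0// subrr normr0 E0 mulr0.
have osc x : cell k x -> `|f x - f p| <= e.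
  move=> kx; apply: (hN n Nn p gp (kM _ kp)); exact: cell_diam kx kp.
have o1 := @pairing_cell_osc _ k g f _ _ (fun x _ => osc x).
have o2 := @pairing_cell_osc _ k (g_ n) f _ _ (fun x _ => osc x).
rewrite eg in o2.
apply: le_trans (_ : _ <= e * pairing (\1_(cell k)) g + e * pairing (\1_(cell k)) g) _.
  apply: le_trans (ler_distD (f p * pairing (\1_(cell k)) g) _ _) _.
  by rewrite (distrC (f p * _)); exact: lerD.
by rewrite -mulrDl -mulr2n mulr_natl.
Qed.

Lemma cvg_vague g (g_ : nat -> config R d) :
  (forall f, test_fun f -> pairing f (g_ n) @[n --> \oo] --> pairing f g) ->
  g_ @ \oo --> g.
Proof.
move=> h; apply/cvg_sup => -[f tf] A [B []] [] O oO <- Og BA.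
have [N _ hN] := h f tf O (open_nbhs_nbhs (conj oO Og)).
by exists N => // n /hN gn; exact: BA.
Qed.

Definition counts g n : cells n -> R := fun k => pairing (\1_(cell k)) g.

(** Otherwise there would be, for each n, a configuration outside [U] with the counts of [g] at
    level n; this sequence would converge vaguely to [g]. It replaces an appeal to second
    countability: membership in an open set is decided by finitely many integers. *)
Lemma open_config_counts (U : set (config R d)) g : open U -> U g ->
  exists n, forall g', counts g' (n := n) = counts g (n := n) -> U g'.
Proof.
move=> oU Ug; apply: contrapT => no.
have /choice[g_ hg] : forall n, exists g', counts g' (n := n) = counts g (n := n) /\ ~ U g'.
  move=> n; apply: contrapT => h; apply: no; exists n => g' gg'.
  by apply: contrapT => nU; apply: h; exists g'.
have /cvg_vague /(_ _ (open_nbhs_nbhs (conj oU Ug))) : forall f, test_fun f ->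
    pairing f (g_ n) @[n --> \oo] --> pairing f g.
  move=> f tf; apply: cvg_pairing_cells => // n k.
  by have [/(congr1 (fun F => F k))] := hg n.
move=> [N _ /(_ N (leqnn _))]; by have [_] := hg N.
Qed.

Lemma counts_nat g n : exists m : {ffun cells n -> nat}, counts g (n := n) = fun k => (m k)%:R.
Proof.
have h (k : cells n) : exists m : nat, counts g k = m%:R.
  rewrite /counts (pairingE _ (@bsupp_indic_cell _ k)).
  by under eq_bigr do rewrite indicE; rewrite -natr_sum; eexists.
have [m hm] := choice h; exists (finfun m).
by apply/funext => k; rewrite ffunE hm.
Qed.

(** Each vaguely open set is written as a countable union of events prescribing the cell counts at
    one level, namely those count vectors all of whose configurations lie in [U]. Countability holds
    because the counts are natural numbers. *)
Lemma measurable_config dX (X : measurableType dX) (c : X -> config R d) :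
  (forall f, test_fun f -> measurable_fun setT (fun t => pairing f (c t))) ->
  measurable_fun setT c.
Proof.
move=> mc; apply: (@measurability _ _ _ _ _ _ (@open (config R d))) => // _ [U oU <-].
rewrite setTI.
pose A n (m : {ffun cells n -> nat}) := [set t | counts (c t) (n := n) = fun k => (m k)%:R].
rewrite (_ : c @^-1` U = \bigcup_n \bigcup_(m in [set: {ffun cells n -> nat}])
    [set t | A n m t /\ forall g, counts g (n := n) = (fun k => (m k)%:R) -> U g]); last first.
  apply/seteqP; split=> [x /= Ux|x [n _ [m _ [Am]]]]; last exact.
  have [n hn] := open_config_counts oU Ux; have [m hm] := counts_nat (c x) n.
  by exists n => //; exists m => //; split => // g gm; apply: hn; rewrite gm hm.
apply: bigcup_measurable => n _; apply: countable_bigcupT_measurable => [|m]; first exact: countableP.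
have [h|h] := pselect (forall g, counts g (n := n) = (fun k => (m k)%:R) -> U g); last first.
  by rewrite [X in measurable X](_ : _ = set0)//; apply/seteqP; split => // x [].
rewrite [X in measurable X](_ : _ = \bigcap_(k in [set: cells n])
    ((fun t => pairing (\1_(cell k)) (c t)) @^-1` [set (m k)%:R : R])).
  apply: fin_bigcap_measurable => [|k _]; first exact: finite_finset.
  rewrite -[X in measurable X]setTI.
  have := measurable_pairing_indic mc n (measurable_cell k).
  rewrite (setIidl (@cell_cube _ k)).
  by move=> /(_ measurableT [set (m k)%:R : R]); apply; exact: measurable_set1.
apply/seteqP; split=> [x [/= Am _] k _|x Am]; first by have /(congr1 (fun F => F k)) := Am.
by split => //=; apply/funext => k; exact: Am.
Qed.

End grid.

(** * Configurations as counting measures *)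

Section counting_measure.
Context {R : realType} {d : nat}.
Implicit Types (g : config R d).

Lemma config_code g : exists e : 'rV[R]_d -> nat, {in points g &, injective e}.
Proof. by apply/countable_injP; exact: countable_config. Qed.

Definition code g := projT1 (cid (config_code g)).

(** The Dirac mass at the point numbered k, if there is one. Summed over k, it turns sums over [g]
    into integrals, to which the convergence theorems apply. *)
Definition atom g k : {measure set 'rV[R]_d -> \bar R} :=
  match pselect (exists x, points g x /\ code g x = k) with
  | left e => \d_(projT1 (cid e))
  | right _ => mzero
  end.

Definition npoints g : {measure set 'rV[R]_d -> \bar R} := mseries (atom g) 0.

Lemma integral_npoints g (f : 'rV[R]_d -> \bar R) : measurable_fun setT f ->
  (forall v, 0 <= f v)%E -> (\int[npoints g]_v f v = \esum_(v in g) f v)%E.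
Proof.
move=> mf f0; rewrite ge0_integral_measure_series// nneseries_esumT; last first.
  by move=> n; exact: integral_ge0.
have -> : (g : set _) = \bigcup_(k in setT) (points g `&` [set x | code g x = k]).
  by apply/seteqP; split=> [x gx|x [k _ []]//]; exists (code g x).
rewrite esum_bigcupT//; last first.
  apply/trivIsetP => i j _ _ ij; apply/seteqP; split => // x [[_ /= xi] [_ /= xj]].
  by move: ij; rewrite -xi -xj eqxx.
apply: eq_esum => k _; rewrite /atom; case: pselect => [e|no]; last first.
  rewrite integral_measure_zero [X in esum X](_ : _ = set0) ?esum_set0//.
  by apply/seteqP; split => // x [gx cx]; apply: no; exists x.
case: cid => x /= [gx cx]; rewrite integral_dirac// diracT mul1e.
rewrite [X in esum X](_ : _ = [set x]) ?esum_set1//.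
apply/seteqP; split=> [y [gy /= cy]|y ->//].
have := projT2 (cid (config_code g)); rewrite -/(code g) => inj.
by apply: inj; rewrite ?inE// cx.
Qed.

Lemma npointsE g (A : set 'rV[R]_d) : measurable A ->
  npoints g A = (\esum_(v in g) (\1_A v)%:E)%E.
Proof.
move=> mA; rewrite -integral_npoints//; first by rewrite integral_indic// setIT.
exact/measurable_EFinP/measurable_indic.
Qed.

Lemma esum_bsupp g n (f : 'rV[R]_d -> R) : bsupp n f -> (forall v, 0 <= f v) ->
  (\esum_(v in g) (f v)%:E = (pairing f g)%:E)%E.
Proof.
move=> sf f0; rewrite (pairingE _ sf) -sumEFin -fsbig_finite; last exact: finite_cube.
rewrite -esum_fset; [|exact: finite_cube|by move=> v _; rewrite lee_fin].
rewrite esum_mkcondr; apply: eq_esum => v _.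
by case: ifPn => // /negP nv; rewrite (bsupp0 sf)// => nv'; apply: nv; rewrite inE.
Qed.

Lemma npoints_cube g (A : set 'rV[R]_d) n : measurable A ->
  npoints g (A `&` cube n) = (pairing (\1_(A `&` cube n)) g)%:E.
Proof.
move=> mA; rewrite npointsE; last exact: measurableI.
by apply: esum_bsupp; [exact: bsupp_indic|move=> v; rewrite indicE].
Qed.

Lemma continuous_pairing (f : 'rV[R]_d -> R) : test_fun f ->
  continuous (pairing f : config R d -> R).
Proof.
move=> tf g A nA.
have /cvg_sup h : nbhs g --> g by exact: cvg_id.
have := h (exist _ f tf) (pairing f @^-1` A); apply.
exact: (@initial_continuous _ _ (pairing f) g A nA).
Qed.

Lemma measurable_pairing (f : 'rV[R]_d -> R) : test_fun f ->
  measurable_fun setT (pairing f : config R d -> R).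
Proof.
move=> tf; apply: (measurability _ (RGenOpens.measurableE R)) => _ [_ [a [b ->] <-]].
rewrite setTI; apply: sub_gen_smallest; apply: open_comp; last exact: interval_open.
by move=> g _; exact: continuous_pairing.
Qed.

End counting_measure.

(** * Measurable dependence of sums over a configuration *)

Section sums_over_configurations.
Import HBNNSimple.
Context {R : realType} {d : nat} dX (X : measurableType dX).
Variable c : X -> config R d.
Hypothesis mc : measurable_fun setT c.

Let mpair f : test_fun f -> measurable_fun setT (fun t => pairing f (c t)).
Proof. by move=> tf; apply: measurableT_comp => //; exact: measurable_pairing. Qed.

Let npoints_at t : {measure set 'rV[R]_d -> \bar R} := npoints (c t).

Let measurable_npoints (A : set 'rV[R]_d) : measurable A ->
  measurable_fun setT (npoints_at ^~ A).
Proof.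
move=> mA.
apply: (@emeasurable_fun_cvg _ _ _ _ (fun n t => npoints (c t) (A `&` cube n))).
  move=> n; under eq_fun do rewrite npoints_cube//.
  by apply/measurable_EFinP; exact: measurable_pairing_indic.
move=> t _.
have {2}-> : A = \bigcup_n (A `&` cube n).
  rewrite -setI_bigcupr (_ : \bigcup_n cube n = setT) ?setIT//.
  by apply/seteqP; split => // v _; have [n nv] := cube_ex v; exists n.
apply: nondecreasing_cvg_mu.
- by move=> n; apply: measurableI.
- by apply: bigcup_measurable => n _; apply: measurableI.
- by move=> m n mn; apply/subsetPset; apply: setIS; exact: le_cube.
Qed.

HB.instance Definition _ := isKernel.Build _ _ X 'rV[R]_d R npoints_at measurable_npoints.

(** The sum is an integral against the kernel of counting measures. This kernel is not finite, so
    for simple functions it is first restricted to a cube, where its mass is finite at each t, and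
    the cubes are then exhausted. *)
Lemma measurable_esum (f : X * 'rV[R]_d -> \bar R) :
  measurable_fun setT f -> (forall p, 0 <= f p)%E ->
  measurable_fun setT (fun t => \esum_(v in c t) f (t, v))%E.
Proof.
move=> mf f0.
rewrite (_ : (fun t => _) = (fun t => \int[npoints_at t]_v f (t, v))%E); last first.
  apply/funext => t; rewrite integral_npoints//.
  exact: measurableT_comp mf (pair1_measurable t).
pose f_ := nnsfun_approx measurableT mf.
apply: (@measurable_fun_xsection_integral _ _ _ _ _ f npoints_at f_).
- by move=> a b ab; exact/nd_nnsfun_approx.
- by move=> p; exact/cvg_nnsfun_approx.
move=> n r; set B := f_ n @^-1` [set r].
have mB : measurable B by rewrite -[X in measurable X]setTI; exact: measurable_funPT.
apply: (@emeasurable_fun_cvg _ _ _ _ (fun n t => npoints (c t) (xsection B t `&` cube n))).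
  move=> m.
  have h t : exists M, forall A, measurable A -> (mrestr (npoints_at t) (@measurable_cube R d m) A < M%:E)%E.
    exists (pairing (\1_(setT `&` cube m)) (c t) + 1) => A mA.
    rewrite /mrestr; apply: (@le_lt_trans _ _ (npoints (c t) (setT `&` cube m))).
      by apply: le_measure; rewrite ?inE; [exact: measurableI|exact: measurableI|exact: setSI].
    by rewrite npoints_cube// lte_fin ltrDl.
  by have [_] := measurable_prod_subset_xsection_kernel h mB.
move=> t _.
have mX : measurable (xsection B t) by exact: measurable_xsection.
have {2}-> : xsection B t = \bigcup_n (xsection B t `&` cube n).
  rewrite -setI_bigcupr (_ : \bigcup_n cube n = setT) ?setIT//.
  by apply/seteqP; split => // v _; have [k nv] := cube_ex v; exists k.
apply: nondecreasing_cvg_mu.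
- by move=> k; apply: measurableI.
- by apply: bigcup_measurable => k _; apply: measurableI.
- by move=> k m km; apply/subsetPset; apply: setIS; exact: le_cube.
Qed.

End sums_over_configurations.

(** * Adding, deleting and restricting points *)

Section configuration_operations.
Context {R : realType} {d : nat}.
Implicit Types (g : config R d) (A : set 'rV[R]_d) (x y v : 'rV[R]_d) (f : 'rV[R]_d -> R).

Lemma config_eqP g g' : points g = points g' -> g = g'.
Proof.
case: g g' => [p lp] [p' lp'] /= pp'; case: _ / pp' in lp' *.
by rewrite (Prop_irrelevance lp lp').
Qed.

Lemma locally_finiteI g A (K : set 'rV[R]_d) : compact K -> finite_set ((g `&` A) `&` K).
Proof.
by move=> cK; apply: sub_finite_set (locally_finite g cK); apply: setSI; exact: subIsetl.
Qed.

Definition restr A g : config R d := Config (@locally_finiteI g A).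

Lemma addp_in g x : points g x -> addp g x = g.
Proof. by move=> gx; apply: config_eqP; apply/setUidPl => _ ->. Qed.

Lemma delp_notin g x : ~ points g x -> delp g x = g.
Proof. by move=> gx; apply: config_eqP; rewrite /= setDidl//; apply/disjoints_subset => y gy /= yx; rewrite yx in gy. Qed.

Lemma delp_addp g x : ~ points g x -> delp (addp g x) x = g.
Proof.
move=> gx; apply: config_eqP; apply/seteqP; split=> [y [[]//]|y gy] /=.
by split; [left|move=> yx; rewrite yx in gy].
Qed.

Lemma addpC g x y : addp (addp g x) y = addp (addp g y) x.
Proof. by apply: config_eqP; rewrite /= setUAC. Qed.

Lemma restr_addp_in A g x : A x -> restr A (addp g x) = addp (restr A g) x.
Proof.
move=> Ax; apply: config_eqP; rewrite /= setIUl; congr (_ `|` _).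
by apply/setIidPl => y ->.
Qed.

Lemma restr_addp_out A g x : ~ A x -> restr A (addp g x) = restr A g.
Proof.
move=> Ax; apply: config_eqP; rewrite /= setIUl.
rewrite (_ : [set x] `&` A = set0) ?setU0//.
by apply/seteqP; split => // y [/= ->].
Qed.

Lemma restr_restr A B g : restr A (restr B g) = restr (A `&` B) g.
Proof. by apply: config_eqP; rewrite /= -setIA (setIC A). Qed.

Lemma restr_delp A g x : restr A (delp g x) = delp (restr A g) x.
Proof. by apply: config_eqP; rewrite /= !setDE setIAC. Qed.

Lemma pairing_restr A g f : pairing f (restr A g) = pairing (fun v => \1_A v * f v) g.
Proof.
rewrite /pairing -[RHS](@fsbig_widen _ _ _ _ (g `&` A)).
- apply: eq_fsbigr => x; rewrite inE => -[_ Ax]; by rewrite indicE mem_set// mul1r.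
- exact: subIsetl.
- by move=> x [gx h] /=; rewrite indicE memNset ?mul0r// => Ax; apply: h.
Qed.

Lemma esum_addp g x (f : 'rV[R]_d -> \bar R) : (forall v, 0 <= f v)%E -> ~ points g x ->
  (\esum_(v in addp g x) f v = f x + \esum_(v in g) f v)%E.
Proof.
move=> f0 gx; rewrite (esumID [set x])//; congr (_ + _)%E.
  rewrite [X in esum X](_ : _ = [set x]) ?esum_set1//.
  by apply/seteqP; split=> [y []//|y ->]; split => //; right.
congr esum; apply/seteqP; split=> [y [[]//]|y gy].
by split; [left|move=> /= yx; rewrite yx in gy].
Qed.

Lemma esum_delp g x (f : 'rV[R]_d -> \bar R) : (forall v, 0 <= f v)%E -> points g x ->
  (\esum_(v in g) f v = f x + \esum_(v in delp g x) f v)%E.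
Proof.
move=> f0 gx; rewrite -esum_addp//; last by move=> [_]; apply.
congr esum; apply/seteqP; split=> [y gy|y [[]//|/= ->//]].
by have [->|yx] := pselect (y = x); [right|left].
Qed.

Lemma pairing_fsbig n f g : bsupp n f ->
  pairing f g = \sum_(x \in g `&` cube n) f x.
Proof. by move=> sf; rewrite (pairingE _ sf) fsbig_finite//; exact: finite_cube. Qed.

Lemma pairing_addp n f g x : bsupp n f -> ~ points g x ->
  pairing f (addp g x) = f x + pairing f g.
Proof.
move=> sf gx; have [m mx] := cube_ex x.
have {}sf := le_bsupp (leq_maxl n m) sf.
have {}mx := le_cube (leq_maxr n m) mx.
rewrite !(pairing_fsbig _ sf) (fsbigD1 x)//; last 2 first.
- exact: finite_cube.
- by split => //; right.
congr (_ + _); apply: eq_fsbigl; apply/seteqP; split=> y /=.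
  by case=> -[[]].
by case=> gy my; split => [|yx]; [split => //; left|rewrite yx in gy].
Qed.

Lemma pairing_delp n f g x : bsupp n f -> points g x ->
  pairing f (delp g x) = pairing f g - f x.
Proof.
move=> sf gx; have E : addp (delp g x) x = g.
  apply: config_eqP; apply/seteqP; split=> [y [[]//|->//]|y gy].
  by have [->|yx] := pselect (y = x); [right|left].
have nx : ~ points (delp g x) x by move=> [_]; apply.
by have := pairing_addp sf nx; rewrite E => ->; rewrite addrAC subrr add0r.
Qed.

End configuration_operations.

Section measurable_operations.
Context {R : realType} {d : nat} dX (X : measurableType dX).
Variables (c : X -> config R d) (p : X -> 'rV[R]_d).
Hypothesis mc : measurable_fun setT c.
Hypothesis mp : measurable_fun setT p.

Lemma measurable_pairing_joint n (f : X * 'rV[R]_d -> R) : measurable_fun setT f ->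
  (forall t, bsupp n (fun v => f (t, v))) ->
  measurable_fun setT (fun t => pairing (fun v => f (t, v)) (c t)).
Proof.
move=> mf sf.
have key (h : X * 'rV[R]_d -> R) : measurable_fun setT h -> (forall q, 0 <= h q) ->
    (forall t, bsupp n (fun v => h (t, v))) ->
    measurable_fun setT (fun t => pairing (fun v => h (t, v)) (c t)).
  move=> mh h0 sh.
  have mE := @measurable_esum _ _ _ _ _ mc (EFin \o h) ((measurable_EFinP _ _).2 mh) (fun q => h0 q).
  rewrite (_ : (fun t => _) = fine \o (fun t => \esum_(v in c t) (EFin \o h) (t, v))%E).
    exact: measurableT_comp.
  by apply/funext => t /=; rewrite (esum_bsupp _ (sh t)).
pose fp q := Num.max (f q) 0; pose fn q := Num.max (- f q) 0.
have sp t : bsupp n (fun v => fp (t, v)).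
  move=> v; rewrite /fp; apply: contra_neqT => nv.
  by rewrite (bsupp0 (sf t)) ?maxxx//; exact/negP.
have sn t : bsupp n (fun v => fn (t, v)).
  move=> v; rewrite /fn; apply: contra_neqT => nv.
  by rewrite (bsupp0 (sf t)) ?oppr0 ?maxxx//; exact/negP.
rewrite (_ : (fun t => _) = fun t => pairing (fun v => fp (t, v)) (c t) -
   pairing (fun v => fn (t, v)) (c t)).
  apply: measurable_funB; apply: key => //.
  - exact: measurable_maxr.
  - by move=> q; rewrite le_max lexx orbT.
  - apply: measurable_maxr => //; exact: measurableT_comp.
  - by move=> q; rewrite le_max lexx orbT.
apply/funext => t; rewrite addrC -mulN1r -(pairing_lin _ _ (sn t) (sp t)).
congr pairing; apply/funext => v; rewrite /fp /fn.
by case: (leP 0 (f (t, v))) => h; [rewrite max_r ?oppr_le0// | rewrite max_l ?oppr_ge0 1?ltW//]; lra.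
Qed.

Lemma measurable_restr A : measurable A -> measurable_fun setT (fun t => restr A (c t)).
Proof.
move=> mA; apply: measurable_config => f tf.
have [n sf] := test_fun_bsupp tf; have [cf _] := tf.
under eq_fun do rewrite pairing_restr.
apply: (@measurable_pairing_joint n (fun q => \1_A q.2 * f q.2)).
- apply: measurable_funM.
    have m1 : measurable_fun setT (\1_A : 'rV[R]_d -> R) by exact: measurable_indic.
    exact: (measurableT_comp m1).
  exact: (measurableT_comp (continuous_measurable_rV cf)).
- by move=> t v; rewrite mulf_eq0 negb_or => /andP[_]; exact: sf.
Qed.

(** The number of points v of [c t] with v - p t = 0 is 1 or 0, according to membership, and it is
    measurable in t. *)
Lemma measurable_mem_config : measurable [set t | points (c t) (p t)].
Proof.
pose h (q : X * 'rV[R]_d) : \bar R := (\1_[set 0 : 'rV[R]_d] (q.2 - p q.1))%:E.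
have mh : measurable_fun setT h.
  apply/measurable_EFinP.
  have m1 : measurable_fun setT (\1_[set 0] : 'rV[R]_d -> R).
    by apply: measurable_indic; exact: measurable_set1_rV.
  apply: (measurableT_comp m1); apply: measurable_funB_rV => //.
  exact: measurableT_comp.
have h0 q : (0 <= h q)%E by rewrite lee_fin indicE.
have hE t v : h (t, v) = (v == p t)%:R%:E.
  rewrite /h indicE /=; congr (_%:R%:E); congr nat_of_bool.
  by apply/idP/eqP => [/set_mem /= /subr0_eq//|->]; rewrite subrr inE.
rewrite (_ : [set t | _] = (fun t => \esum_(v in c t) h (t, v))%E @^-1` [set 1%E]).
  rewrite -[X in measurable X]setTI; apply: (measurable_esum mc mh h0) => //.
apply/seteqP; split=> t /=.
  move=> ct; rewrite (esum_delp (fun v => h0 (t, v)) ct).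
  rewrite hE eqxx esum1 ?adde0// => v [_ /= vp].
  by rewrite hE; case: eqP.
move=> h1; apply: contrapT => nct; move/eqP: h1; rewrite esum1 ?eqe ?(eq_sym 0) ?oner_eq0//.
by move=> v cv; rewrite hE; case: eqP => // vp; rewrite vp in cv.
Qed.

Lemma measurable_addp : measurable_fun setT (fun t => addp (c t) (p t)).
Proof.
apply: measurable_config => f tf; have [n sf] := test_fun_bsupp tf; have [cf _] := tf.
rewrite (_ : (fun t => _) = fun t => pairing f (c t) +
   f (p t) * (1 - \1_[set t | points (c t) (p t)] t)).
  apply: measurable_funD.
    exact: measurableT_comp (measurable_pairing tf) mc.
  apply: measurable_funM.
    exact: measurableT_comp (continuous_measurable_rV cf) mp.
  apply: measurable_funB => //; apply: measurable_indic; exact: measurable_mem_config.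
apply/funext => t; rewrite indicE.
have [h|h] := pselect (points (c t) (p t)).
  by rewrite addp_in// mem_set// subrr mulr0 addr0.
by rewrite (pairing_addp sf h) memNset// subr0 mulr1 addrC.
Qed.

Lemma measurable_delp : measurable_fun setT (fun t => delp (c t) (p t)).
Proof.
apply: measurable_config => f tf; have [n sf] := test_fun_bsupp tf; have [cf _] := tf.
rewrite (_ : (fun t => _) = fun t => pairing f (c t) -
   f (p t) * \1_[set t | points (c t) (p t)] t).
  apply: measurable_funB.
    exact: measurableT_comp (measurable_pairing tf) mc.
  apply: measurable_funM.
    exact: measurableT_comp (continuous_measurable_rV cf) mp.
  apply: measurable_indic; exact: measurable_mem_config.
apply/funext => t; rewrite indicE.
have [h|h] := pselect (points (c t) (p t)).
  by rewrite (pairing_delp sf h) mem_set// mulr1.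
by rewrite delp_notin// memNset// mulr0 subr0.
Qed.

End measurable_operations.

(** * Cylinder functions *)

Section smooth_functions.
Context {R : realType}.

(** The definition quantifies over all iterated derivatives; a class stable under one partial
    derivative reduces it to first order conditions. *)
Lemma smooth_bounded_class N (C : set ('rV[R]_N -> R)) :
  (forall h, C h -> [/\ continuous h, (forall x i, derivable h x (delta_mx 0 i)),
     (exists M, forall x, `|h x| <= M) &
     forall i, C (fun x => 'D_(delta_mx 0 i) h x)]) ->
  C `<=` @smooth_bounded R N.
Proof.
move=> hC h Ch s; suff : C (iter_partial s h) by move=> /hC[].
by elim: s => [//|i s ih] /=; have [_ _ _] := hC _ ih; apply.
Qed.

Lemma smooth_bounded_stable N h : @smooth_bounded R N h ->
  [/\ continuous h, (forall x i, derivable h x (delta_mx 0 i)),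
     (exists M, forall x, `|h x| <= M) &
     forall i, smooth_bounded (fun x => 'D_(delta_mx 0 i) h x)].
Proof.
move=> sh; have [c1 c2 c3] := sh [::]; split => // i s.
by have := sh (rcons s i); rewrite /iter_partial foldr_rcons.
Qed.

Lemma continuous_lsubmx N1 N2 : continuous (lsubmx : 'rV[R]_(N1 + N2) -> 'rV[R]_N1).
Proof.
move=> v B /nbhs_ballP[e /= e0 eB]; apply/nbhs_ballP; exists e => //= w [_ vw].
by apply: eB; split=> // i j; rewrite !mxE; exact: vw.
Qed.

Lemma continuous_rsubmx N1 N2 : continuous (rsubmx : 'rV[R]_(N1 + N2) -> 'rV[R]_N2).
Proof.
move=> v B /nbhs_ballP[e /= e0 eB]; apply/nbhs_ballP; exists e => //= w [_ vw].
by apply: eB; split=> // i j; rewrite !mxE; exact: vw.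
Qed.

Section linear_change.
Variables (N N' : nat) (L : {linear 'rV[R]_N -> 'rV[R]_N'}).

Lemma derive_comp_linear (h : 'rV[R]_N' -> R) x v w : L v = w ->
  'D_v (h \o L) x = 'D_w h (L x) /\ (derivable h (L x) w -> derivable (h \o L) x v).
Proof.
move=> <-; rewrite /derive /derivable.
suff -> : (fun t => t^-1 *: ((h \o L \o shift x) (t *: v) - (h \o L) x)) =
  (fun t => t^-1 *: ((h \o shift (L x)) (t *: L v) - h (L x))) by [].
apply/funext => t /=.
by have -> : L (t *: v + x) = t *: L v + L x by rewrite linearD linearZZ.
Qed.

(** A basis vector of a concatenated space has a zero block, so the function acting on that block is
    differentiated in the direction 0. *)
Lemma derive_dir0 (h : 'rV[R]_N' -> R) x : 'D_0 h x = 0 /\ derivable h x 0.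
Proof.
have E : (fun t : R => t^-1 *: ((h \o shift x) (t *: 0) - h x)) = fun=> 0.
  by apply/funext => t /=; rewrite scaler0 add0r subrr scaler0.
have c : (fun _ : R => 0 : R) @ 0^' --> (0 : R) by exact: cvg_cst.
split; rewrite /derive /derivable E; first exact: cvg_lim c.
by apply/cvg_ex; exists 0.
Qed.

End linear_change.

Lemma smooth_bounded_cst N (a : R) : smooth_bounded (fun _ : 'rV[R]_N => a).
Proof.
apply: (@smooth_bounded_class N [set h | exists a, h = fun=> a]); last by exists a.
move=> _ [b ->]; split.
- exact: continuous_cst_rV.
- by move=> x i; exact: derivable_cst.
- by exists `|b|.
- by move=> i; exists 0; apply/funext => x; rewrite derive_cst.
Qed.

(** The two functions act on disjoint blocks of coordinates, as needed to add cylinder functions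
    over different test functions. A partial derivative differentiates one of them and replaces the
    other by 0, so the form is preserved. *)
Lemma smooth_bounded_lin N1 N2 (a : R) (h1 : 'rV[R]_N1 -> R) (h2 : 'rV[R]_N2 -> R) :
  smooth_bounded h1 -> smooth_bounded h2 ->
  smooth_bounded (fun x : 'rV[R]_(N1 + N2) => a * h1 (lsubmx x) + h2 (rsubmx x)).
Proof.
move=> sh1 sh2.
apply: (@smooth_bounded_class _ [set h | exists h1 h2, [/\ @smooth_bounded R N1 h1,
  @smooth_bounded R N2 h2 & h = fun x => a * h1 (lsubmx x) + h2 (rsubmx x)]]); last first.
  by exists h1, h2.
move=> _ [{sh1}h1 [{sh2}h2 [sh1 sh2 ->]]].
have [c1 d1 [M1 b1] s1] := smooth_bounded_stable sh1.
have [c2 d2 [M2 b2] s2] := smooth_bounded_stable sh2.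
have L1 i : lsubmx (delta_mx 0 (lshift N2 i) : 'rV[R]_(N1 + N2)) = delta_mx 0 i.
  by apply/rowP => j; rewrite !mxE eq_lshift.
have L2 i : rsubmx (delta_mx 0 (lshift N2 i) : 'rV[R]_(N1 + N2)) = 0.
  by apply/rowP => j; rewrite !mxE eq_rlshift andbF.
have R1 i : lsubmx (delta_mx 0 (rshift N1 i) : 'rV[R]_(N1 + N2)) = 0.
  by apply/rowP => j; rewrite !mxE eq_lrshift andbF.
have R2 i : rsubmx (delta_mx 0 (rshift N1 i) : 'rV[R]_(N1 + N2)) = delta_mx 0 i.
  by apply/rowP => j; rewrite !mxE eq_rshift.
have dd x i : derivable (h1 \o lsubmx : 'rV[R]_(N1 + N2) -> R) x (delta_mx 0 i) /\
    derivable (h2 \o rsubmx : 'rV[R]_(N1 + N2) -> R) x (delta_mx 0 i).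
  case: (split_ordP i) => j ->; split.
  - by apply: (derive_comp_linear (L := lsubmx) h1 x (L1 j)).2; exact: d1.
  - by apply: (derive_comp_linear (L := rsubmx) h2 x (L2 j)).2; exact: (derive_dir0 h2 _).2.
  - by apply: (derive_comp_linear (L := lsubmx) h1 x (R1 j)).2; exact: (derive_dir0 h1 _).2.
  - by apply: (derive_comp_linear (L := rsubmx) h2 x (R2 j)).2; exact: d2.
have DE x i : 'D_(delta_mx 0 i) (fun x : 'rV[R]_(N1 + N2) => a * h1 (lsubmx x) + h2 (rsubmx x)) x =
   a * 'D_(delta_mx 0 i) (h1 \o lsubmx : 'rV[R]_(N1 + N2) -> R) x +
   'D_(delta_mx 0 i) (h2 \o rsubmx : 'rV[R]_(N1 + N2) -> R) x.
  have [e1 e2] := dd x i.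
  rewrite -[X in X + _]deriveZ// -deriveD//; exact: derivableZ.
split.
- apply: continuous_add_rV; first apply: continuous_mul_rV; first exact: continuous_cst_rV.
    by move=> v; apply: continuous_comp; [exact: continuous_lsubmx|exact: c1].
  by move=> v; apply: continuous_comp; [exact: continuous_rsubmx|exact: c2].
- move=> x i; have [e1 e2] := dd x i.
  by apply: (@derivableD _ _ _ (a *: (h1 \o lsubmx)) (h2 \o rsubmx)) => //; exact: derivableZ.
- exists (`|a| * M1 + M2) => x; apply: (le_trans (ler_normD _ _)).
  by rewrite normrM lerD// ler_wpM2l.
- move=> i; case: (split_ordP i) => j ->.
  + exists (fun x => 'D_(delta_mx 0 j) h1 x), (fun=> 0); split => //; first exact: smooth_bounded_cst.
    apply/funext => x; rewrite DE (derive_comp_linear (L := lsubmx) h1 x (L1 j)).1.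
    by rewrite (derive_comp_linear (L := rsubmx) h2 x (L2 j)).1 (derive_dir0 h2 _).1.
  + exists (fun=> 0), (fun x => 'D_(delta_mx 0 j) h2 x); split => //; first exact: smooth_bounded_cst.
    apply/funext => x; rewrite DE (derive_comp_linear (L := lsubmx) h1 x (R1 j)).1.
    by rewrite (derive_comp_linear (L := rsubmx) h2 x (R2 j)).1 (derive_dir0 h1 _).1.
Qed.

(** The logistic function s satisfies s' = s (1 - s). Polynomials in s are therefore bounded and
    stable under differentiation, which makes explicit smooth functions available without bump
    functions. *)
Definition sigmoid (x : R) : R := (1 + expR (- x))^-1.

Lemma sigmoid_gt0 x : 0 < sigmoid x.
Proof. by rewrite invr_gt0 addr_gt0// expR_gt0. Qed.

Lemma sigmoid_lt1 x : sigmoid x < 1.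
Proof. by rewrite invf_lt1 ?ltrDl ?expR_gt0// addr_gt0// expR_gt0. Qed.

Lemma is_derive_sigmoid (x : R) : is_derive x (1 : R) sigmoid (sigmoid x * (1 - sigmoid x)).
Proof.
have n0 : 1 + expR (- x) != 0 by rewrite gt_eqF// addr_gt0// expR_gt0.
have d1 : is_derive x (1 : R) (fun y => 1 + expR (- y)) (0 + expR (- x) * (-1)).
  apply: is_deriveD; apply: is_derive1_comp; exact: is_deriveNid.
have := @is_deriveV _ (fun y => 1 + expR (- y)) x _ 1 n0 d1.
set l := (X in is_derive _ _ _ X -> _) => h.
suff -> : sigmoid x * (1 - sigmoid x) = l by [].
by rewrite /l /sigmoid /GRing.scale/=; field.
Qed.

Definition poly_sigmoid (p : {poly R}) (t b x : R) : R := p.[sigmoid (t * x + b)].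

Lemma is_derive_poly_sigmoid p t b (x : R) : is_derive x (1 : R) (poly_sigmoid p t b)
  (poly_sigmoid (t *: (p^`()%R * ('X * (1 - 'X)))) t b x).
Proof.
have d1 : is_derive x (1 : R) (fun x => t * x + b) t.
  have h1 : is_derive x (1 : R) (t *: (id : R -> R)) (t *: (1 : R)).
    by apply: is_deriveZ; exact: is_derive_id.
  have h2 : is_derive x (1 : R) (cst b) 0 by exact: is_derive_cst.
  by have := is_deriveD h1 h2; rewrite addr0 /GRing.scale/= mulr1.
have d2 := @is_derive1_comp _ sigmoid (fun x => t * x + b) x _ _
  (is_derive_sigmoid (t * x + b)) d1.
have := @is_derive1_comp _ (horner p) (sigmoid \o (fun x => t * x + b)) x _ _
  (is_derive_poly p (sigmoid (t * x + b))) d2.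
set l := (X in is_derive _ _ _ X -> _) => h.
suff -> : poly_sigmoid (t *: (p^`()%R * ('X * (1 - 'X)))) t b x = l by [].
by rewrite /l /poly_sigmoid !hornerE /=; ring.
Qed.

Lemma poly_sigmoid_bound p t b : exists M, forall x, `|poly_sigmoid p t b x| <= M.
Proof.
exists (\sum_(i < size p) `|p`_i|) => x; rewrite /poly_sigmoid horner_coef.
apply: (le_trans (ler_norm_sum _ _ _)); apply: ler_sum => i _.
rewrite normrM ler_piMr// normrX exprn_ile1// ger0_norm ?ltW// ?sigmoid_gt0//.
exact: sigmoid_lt1.
Qed.

(** A derivative in direction i only changes the i-th polynomial p into t p' X (1 - X), so these
    products form a class stable under derivatives. *)
Lemma smooth_bounded_prod N (p : 'I_N -> {poly R}) (t b : 'I_N -> R) :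
  smooth_bounded (fun x : 'rV[R]_N => \prod_i poly_sigmoid (p i) (t i) (b i) (x 0 i)).
Proof.
apply: (@smooth_bounded_class _ [set h | exists p t b, h =
   fun x : 'rV[R]_N => \prod_i poly_sigmoid (p i) (t i) (b i) (x 0 i)]); last by exists p, t, b.
move=> _ [{}p [{}t [{}b ->]]].
have key x i : is_derive x (delta_mx 0 i)
    (fun x : 'rV[R]_N => \prod_i poly_sigmoid (p i) (t i) (b i) (x 0 i) : R)
    (\prod_j poly_sigmoid (if j == i then t i *: ((p i)^`()%R * ('X * (1 - 'X))) else p j)
        (t j) (b j) (x 0 j)).
  pose c := \prod_(j | j != i) poly_sigmoid (p j) (t j) (b j) (x 0 j).
  have := is_derive_poly_sigmoid (p i) (t i) (b i) (x 0 i).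
  set q := t i *: _ => -[dP DP].
  have E : (fun s => s^-1 *: (((fun x : 'rV[R]_N => \prod_i poly_sigmoid (p i) (t i) (b i) (x 0 i)) \o
      shift x) (s *: delta_mx 0 i) - \prod_i poly_sigmoid (p i) (t i) (b i) (x 0 i))) =
     (fun s => c *: (s^-1 *: ((poly_sigmoid (p i) (t i) (b i) \o shift (x 0 i)) (s *: 1) -
        poly_sigmoid (p i) (t i) (b i) (x 0 i)))).
    apply/funext => s; rewrite scalerA mulrC -scalerA; congr (_ *: _) => /=.
    rewrite (bigD1 i)//= [X in _ - X](bigD1 i)//= -/c !mxE !eqxx mulr1.
    rewrite (eq_bigr (fun j => poly_sigmoid (p j) (t j) (b j) (x 0 j))) -/c.
      by rewrite scalerBr /GRing.scale/= mulr1 !(mulrC c).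
    by move=> j ji; rewrite !mxE (negbTE ji) andbF mulr0 add0r.
  have cv : (fun s => c *: (s^-1 *: ((poly_sigmoid (p i) (t i) (b i) \o shift (x 0 i)) (s *: 1) -
        poly_sigmoid (p i) (t i) (b i) (x 0 i)))) @ 0^' --> c *: poly_sigmoid q (t i) (b i) (x 0 i).
    by apply: cvgZr; rewrite -DP; exact: dP.
  have -> : \prod_j poly_sigmoid (if j == i then q else p j) (t j) (b j) (x 0 j) =
     c *: poly_sigmoid q (t i) (b i) (x 0 i).
    rewrite (bigD1 i)//= eqxx mulrC; congr (_ * _).
    by apply: eq_bigr => j /negbTE ->.
  by split; rewrite /derivable /derive E; [apply/cvg_ex; eexists; exact: cv|exact: cvg_lim cv].
split.
- have c1 i : continuous (fun x : 'rV[R]_N => poly_sigmoid (p i) (t i) (b i) (x 0 i)).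
    move=> x; apply: (@continuous_comp _ _ _ (fun x : 'rV[R]_N => x 0 i)); first exact: coord_continuous.
    apply/differentiable_continuous/derivable1_diffP.
    by have [] := is_derive_poly_sigmoid (p i) (t i) (b i) (x 0 i).
  elim: (index_enum _) => [|i r ih].
    by under eq_fun do rewrite big_nil; exact: continuous_cst_rV.
  by under eq_fun do rewrite big_cons; exact: continuous_mul_rV.
- by move=> x i; have [] := key x i.
- have /choice[M hM] : forall i, exists M, forall x, `|poly_sigmoid (p i) (t i) (b i) x| <= M.
    by move=> i; exact: poly_sigmoid_bound.
  exists (\prod_i M i) => x; rewrite normr_prod; apply: ler_prod => i _.
  by rewrite normr_ge0 hM.
- move=> i; exists (fun j => if j == i then t i *: ((p i)^`()%R * ('X * (1 - 'X))) else p j), t, b.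
  by apply/funext => x; have [_] := key x i.
Qed.

End smooth_functions.

Section sigmoid_limit.
Context {R : realType}.

Lemma sigmoidN x : sigmoid (- x) = 1 - sigmoid x :> R.
Proof.
rewrite /sigmoid opprK expRN; have := expR_gt0 x; move: (expR x) => e e0.
by field; rewrite !gt_eqF// addr_gt0.
Qed.

Lemma sigmoid_le (m x : R) : 0 <= m -> m <= x -> sigmoid (- x) <= (1 + m)^-1.
Proof.
move=> m0 mx; have x0 := le_trans m0 mx.
have m1 : 0 < 1 + m by rewrite ltr_wpDr.
have x1 : 0 < 1 + expR x by rewrite addr_gt0// expR_gt0.
rewrite /sigmoid opprK lef_pV2 ?posrE//.
rewrite lerD2l; apply: (le_trans mx); apply: le_trans (expR_ge1Dx x).
by rewrite lerDr.
Qed.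

(** The argument is m^2 (x - a) - m. The extra - m sends it to minus infinity also at x = a, so the
    limit is the indicator of the strict inequality. *)
Lemma cvg_sigmoid (a x : R) :
  sigmoid (m%:R ^+ 2 * x + (- m%:R ^+ 2 * a - m%:R)) @[m --> \oo] --> ((a < x)%R%:R : R).
Proof.
have h0 : ((1 + m%:R)^-1 : R) @[m --> \oo] --> 0.
  by under eq_fun do rewrite nat1r; exact: cvg_harmonic.
case: ltP => [ax|xa].
- apply/cvgrPdist_le => e e0; move/cvgrPdist_le : h0 => /(_ e e0)[N _ hN].
  (* For m (x - a) > 2 the argument m^2 (x - a) - m is at least m. *)
  pose K := Num.bound (2 / (x - a)).
  exists (maxn N K) => // m /=; rewrite geq_max => /andP[Nm Km].
  have := hN m Nm; rewrite /= sub0r normrN => h.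
  rewrite -sigmoidN ger0_norm; last exact/ltW/sigmoid_gt0.
  apply: le_trans h; apply: le_trans (ler_norm _); apply: sigmoid_le => //.
  have xa0 : 0 < x - a by rewrite subr_gt0.
  have : 2 / (x - a) < m%:R.
    apply: lt_le_trans (archi_boundP _) _; first by rewrite divr_ge0// ltW.
    by rewrite ler_nat.
  rewrite ltr_pdivrMr// => mx.
  have m0 : 0 <= m%:R :> R by [].
  nra.
- apply: (squeeze_cvgr _ (cvg_cst 0) h0); apply: nearW => m; rewrite ltW ?sigmoid_gt0//=.
  rewrite -[X in sigmoid X]opprK; apply: sigmoid_le => //.
  have m0 : 0 <= m%:R :> R by [].
  nra.
Qed.

End sigmoid_limit.

Lemma nondecreasing_cvg_ge (R : realType) (u : nat -> R) (l : R) n :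
  nondecreasing_seq u -> u @ \oo --> l -> u n <= l.
Proof.
move=> nd cu; have <- := cvg_lim (@Rhausdorff R) cu.
by apply: nondecreasing_cvgn_le => //; apply/cvg_ex; exists l.
Qed.

Section cylinders.
Context {R : realType} {d : nat}.
Implicit Types (g : config R d) (F G u v : config R d -> R).

Lemma cylinder_lin (a : R) F G : cylinder F -> cylinder G ->
  cylinder (fun g => a * F g + G g).
Proof.
move=> [N1 [f1 [h1 [tf1 sh1 F1]]]] [N2 [f2 [h2 [tf2 sh2 F2]]]].
exists (N1 + N2)%N, (fun i => match fintype.split i with inl j => f1 j | inr j => f2 j end),
  (fun x => a * h1 (lsubmx x) + h2 (rsubmx x)); split.
- by move=> i; case: fintype.split.
- exact: smooth_bounded_lin.
- move=> g; rewrite F1 F2; congr (_ * h1 _ + h2 _); apply/rowP => i; rewrite !mxE.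
  + by rewrite (unsplitK (inl i)).
  + by rewrite (unsplitK (inr i)).
Qed.

Lemma cylinder_sigmoids k (f : 'I_k -> 'rV[R]_d -> R) (t b : 'I_k -> R) :
  (forall i, test_fun (f i)) ->
  cylinder (fun g => \prod_i sigmoid (t i * pairing (f i) g + b i)).
Proof.
move=> tf; exists k, f,
  (fun x : 'rV[R]_k => \prod_i poly_sigmoid 'X (t i) (b i) (x 0 i)); split => //.
  exact: smooth_bounded_prod.
by move=> g; apply: eq_bigr => i _; rewrite /poly_sigmoid hornerX !mxE.
Qed.

Lemma cylinder_bounded F : cylinder F -> exists M, forall g, `|F g| <= M.
Proof.
move=> [N [f [h [_ sh FE]]]]; have [_ _ [M hM]] := sh [::].
by exists M => g; rewrite FE.
Qed.

Lemma cylinder_measurable F : cylinder F -> measurable_fun setT F.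
Proof.
move=> [N [f [h [tf sh FE]]]]; have [ch _ _] := sh [::].
rewrite (_ : F = h \o (fun g => \row_i pairing (f i) g)); last first.
  by apply/funext => g /=; rewrite FE.
apply: measurableT_comp; first exact: continuous_measurable_rV.
apply: measurable_fun_rV => i; under eq_fun do rewrite mxE.
exact: measurable_pairing.
Qed.

Definition local n u := forall g, u g = u (restr (cube n) g).

Lemma pairing_local n (f : 'rV[R]_d -> R) : bsupp n f -> local n (pairing f).
Proof.
move=> sf g; rewrite pairing_restr; congr pairing; apply/funext => v; rewrite indicE.
have [nv|nv] := pselect (cube n v); first by rewrite mem_set// mul1r.
by rewrite memNset// mul0r (bsupp0 sf).
Qed.

Lemma le_local m n u : (m <= n)%N -> local m u -> local n u.
Proof.
move=> mn lu g; rewrite lu [RHS]lu restr_restr (setIidl (le_cube mn))//.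
Qed.

Lemma cylinder_local F : cylinder F -> exists n, local n F.
Proof.
move=> [N [f [h [tf sh FE]]]].
have [n_ hn] := choice (fun i => test_fun_bsupp (tf i)).
exists (\max_i n_ i)%N => g; rewrite !FE; congr h; apply/rowP => i; rewrite !mxE.
by apply: pairing_local; apply: le_bsupp (hn i); exact: leq_bigmax.
Qed.

End cylinders.

(** * A functional monotone class theorem for configurations *)

Section monotone_class.
Import HBNNSimple.
Context {R : realType} {d : nat}.
Variable V : set (config R d -> R).
Hypothesis V_sigmoids : forall k (f : 'I_k -> 'rV[R]_d -> R) (t b : 'I_k -> R),
  (forall i, test_fun (f i)) -> V (fun g => \prod_i sigmoid (t i * pairing (f i) g + b i)).
Hypothesis V_lin : forall (a : R) u v, V u -> V v -> V (fun g => a * u g + v g).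
Hypothesis V_lim : forall u_ u (C : R), (forall n, V (u_ n)) ->
  (forall n g, `|u_ n g| <= C) -> (forall g, u_ n g @[n --> \oo] --> u g) -> V u.

Let half_spaces : set (set (config R d)) := [set A | exists k (f : 'I_k -> 'rV[R]_d -> R) (a : 'I_k -> R),
  (forall i, test_fun (f i)) /\ A = [set g | forall i, a i < pairing (f i) g]].

Let half_spacesI : setI_closed half_spaces.
Proof.
move=> _ _ [k [f [a [tf ->]]]] [k' [f' [a' [tf' ->]]]].
exists (k + k')%N, (fun i => match fintype.split i with inl j => f j | inr j => f' j end),
  (fun i => match fintype.split i with inl j => a j | inr j => a' j end); split.
  by move=> i; case: fintype.split.
apply/seteqP; split=> [g [/= h h'] i|g /= h]; first by case: splitP => j _; [exact: h|exact: h'].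
split=> i; first by have := h (lshift k' i); rewrite (unsplitK (inl i)).
by have := h (rshift k i); rewrite (unsplitK (inr i)).
Qed.

(** By [measurable_config], the identity is measurable from the sigma-algebra generated by half
    spaces, since single half spaces are the events that a pairing exceeds a level. *)
Let measurable_half_spaces : @measurable _ (config R d) = <<s half_spaces >>.
Proof.
apply/seteqP; split; last first.
  apply: smallest_sub; first exact: sigma_algebra_measurable.
  move=> _ [k [f [a [tf ->]]]].
  rewrite (_ : [set g | _] = \bigcap_(i in [set: 'I_k]) (pairing (f i) @^-1` `]a i, +oo[)).
    apply: fin_bigcap_measurable => [|i _]; first exact: finite_finset.
    by rewrite -[X in measurable X]setTI; apply: measurable_pairing => //; exact: measurable_itv.
  apply/seteqP; split=> [g h i _|g h i]; first by rewrite /= in_itv/= andbT.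
  by have := h i I; rewrite /= in_itv/= andbT.
pose X := g_sigma_algebraType half_spaces.
have mid : measurable_fun setT (id : X -> config R d).
  apply: measurable_config => f tf.
  apply: (measurability _ (RGenOInfty.measurableE R)) => _ [_ [a ->] <-].
  rewrite setTI; apply: sub_gen_smallest; exists 1%N, (fun=> f), (fun=> a); split => //.
  apply/seteqP; split=> g /=; rewrite in_itv/= andbT//.
  by move=> /(_ ord0).
by move=> A mA; have := mid measurableT A mA; rewrite setTI.
Qed.

Let V_half_space A : half_spaces A -> V (\1_A).
Proof.
move=> [k [f [a [tf ->]]]].
apply: (@V_lim (fun m g => \prod_i sigmoid (m%:R ^+ 2 * pairing (f i) g + (- m%:R ^+ 2 * a i - m%:R))) _ 1).
- by move=> n; exact: V_sigmoids.
- move=> n g; rewrite normr_prod; apply: prodr_ile1 => i _.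
  by rewrite normr_ge0 ger0_norm ltW ?sigmoid_gt0 ?sigmoid_lt1.
move=> g; rewrite (_ : \1_ _ g = \prod_(i < k) (a i < pairing (f i) g)%R%:R).
  by apply: cvg_big => [|i _]; [exact: mul_continuous|exact: cvg_sigmoid].
rewrite indicE -natr_prod; congr (_%:R).
have [/set_mem h|h] := boolP (g \in _).
  by rewrite big1// => i _; rewrite h.
apply/esym/eqP; rewrite -leqn0 leqNgt; apply: contra h => h; apply/mem_set => i.
move: h; rewrite (bigD1 i)//= muln_gt0 => /andP[+ _].
by case: (_ < _).
Qed.

(** [V] need not be stable under products: half spaces are stable under intersection by
    concatenating their lists of test functions, and their indicators are bounded limits of products
    of sigmoids. It is applied both to graph approximation by cylinder functions and to their
    density in L^2. *)
Lemma monotone_class (u : config R d -> R) (C : R) : measurable_fun setT u ->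
  (forall g, `|u g| <= C) -> V u.
Proof.
have V1 : V (fun=> 1).
  rewrite (_ : (fun=> 1) = \1_[set g | forall i : 'I_0, 0 < pairing (fun=> 0) g]); last first.
    by apply/funext => g; rewrite indicE mem_set// => -[].
  by apply: V_half_space; exists 0%N, (fun _ _ => 0), (fun=> 0); split => // -[].
have V0 : V (fun=> 0).
  rewrite (_ : (fun=> 0) = fun g => -1 * 1 + 1); first exact: V_lin.
  by apply/funext => g; rewrite mulr1 addNr.
have V_indic A : measurable A -> V (\1_A).
  rewrite measurable_half_spaces; move: A.
  apply: (@dynkin_induction _ (config R d) half_spaces [set A | V (\1_A)]) => //=.
  - by rewrite indicT.
  - move=> A' _ VA; rewrite (_ : \1_(~` A') = fun g => -1 * \1_A' g + 1); first exact: V_lin.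
    by apply/funext => g; rewrite !indicE in_setC; case: (g \in A'); rewrite ?mulr1 ?mulr0 ?add0r ?addNr.
  - move=> F mF tF VF.
    have cF g : \sum_(i < n) \1_(F i) g @[n --> \oo] --> (\1_(\bigcup_k F k) g : R).
      suff : (\sum_(i < n) \1_(F i) g)%:E @[n --> \oo] --> (\1_(\bigcup_k F k) g : R)%:E.
        by move/fine_cvgP => [].
      rewrite indic_bigcup//.
      under eq_fun do rewrite -sumEFin -(big_mkord xpredT (fun i => (\1_(F i) g)%:E)).
      by apply: is_cvg_nneseries => n _ _; rewrite lee_fin indicE.
    have nd g : nondecreasing_seq (fun n => \sum_(i < n) \1_(F i) g : R).
      move=> m n mn; rewrite -!(big_mkord xpredT (fun i => \1_(F i) g)).
      rewrite (@big_cat_nat _ _ _ m 0 n)//= lerDl sumr_ge0//.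
    apply: (@V_lim (fun n g => \sum_(i < n) \1_(F i) g) _ 1).
    + elim=> [|n ih]; first by under eq_fun do rewrite big_ord0.
      rewrite (_ : (fun g => _) = fun g => 1 * \sum_(i < n) \1_(F i) g + \1_(F n) g); last first.
        by apply/funext => g; rewrite big_ord_recr/= mul1r.
      exact: V_lin.
    + move=> n g; rewrite ger0_norm ?sumr_ge0//.
      apply: (@le_trans _ _ (\1_(\bigcup_k F k) g)); first exact: nondecreasing_cvg_ge (nd g) (cF g).
      by rewrite indicE; case: (_ \in _).
    + exact: cF.
have V_nneg (w : config R d -> R) (K : R) : measurable_fun setT w ->
    (forall g, 0 <= w g <= K) -> V w.
  move=> mw wK; pose f := nnsfun_approx measurableT ((measurable_EFinP setT w).2 mw).
  have cf g : f n g @[n --> \oo] --> w g.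
    suff : (f n g)%:E @[n --> \oo] --> (w g)%:E by move/fine_cvgP => [].
    by apply: cvg_nnsfun_approx => // x _; rewrite lee_fin; case/andP: (wK x).
  apply: (@V_lim (fun n => f n) _ K).
  - move=> n.
    rewrite (_ : (f n : _ -> R) = fun g => \sum_(i < #|` fset_set (range (f n))|)
        ((fset_set (range (f n)))`_i * \1_(f n @^-1` [set (fset_set (range (f n)))`_i]) g)); last first.
      by apply/funext => g; rewrite [LHS]fimfunEord.
    set s := fset_set _; move: #|` s| => k.
    elim: k => [|k ih]; first by under eq_fun do rewrite big_ord0.
    under eq_fun do rewrite big_ord_recr/= addrC.
    by apply: V_lin => //; apply: V_indic; rewrite -[X in measurable X]setTI; exact: measurable_funPT.
  - move=> n g; rewrite ger0_norm//; have /andP[_] := wK g; apply: le_trans.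
    apply: (@nondecreasing_cvg_ge _ (fun n => f n g)); last exact: cf.
    by move=> a b ab; exact/lefP/nd_nnsfun_approx.
  - by move=> g; exact: cf.
move=> mu uC.
(* Adding C reduces to functions between 0 and 2 C, which simple functions approximate from below
   within the same bound. *)
rewrite (_ : u = fun g => - C * 1 + (u g + C)).
  apply: V_lin => //; apply: (V_nneg _ (C + C)).
    exact: measurable_funD.
  by move=> g; have := uC g; rewrite ler_norml => /andP[u1 u2]; apply/andP; split; lra.
by apply/funext => g; ring.
Qed.

End monotone_class.

(** * Boltzmann weights and the Georgii-Nguyen-Zessin identity *)

Lemma measurable_Rintegral_param d1 d2 (T1 : measurableType d1) (T2 : measurableType d2)
  (R : realType) (m : {sigma_finite_measure set T2 -> \bar R}) (f : T1 * T2 -> R) :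
  measurable_fun setT f -> measurable_fun setT (fun x => \int[m]_y f (x, y)).
Proof.
move=> mf; have mE : measurable_fun setT (EFin \o f) by exact/measurable_EFinP.
apply: measurableT_comp => //.
under eq_fun do rewrite integralE.
apply: emeasurable_funB.
- apply: eq_measurable_fun (measurable_fun_fubini_tonelli_F (m2 := m) _
    (measurable_funepos mE) (funepos_ge0 _)) => x _.
  by apply: eq_integral => y _; rewrite !funeposE.
- apply: eq_measurable_fun (measurable_fun_fubini_tonelli_F (m2 := m) _
    (measurable_funeneg mE) (funeneg_ge0 _)) => x _.
  by apply: eq_integral => y _; rewrite !funenegE.
Qed.

(** Dominated convergence for (f_n - f)^2, which is at most 4 h^2. *)
Lemma L2_dominated_cvg disp (T : measurableType disp) (R : realType)
  (mu : {measure set T -> \bar R}) (f_ : nat -> T -> R) (f h : T -> R) :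
  (forall n, measurable_fun setT (f_ n)) -> measurable_fun setT f ->
  h \in Lfun mu 2%:E -> {ae mu, forall x, f_ n x @[n --> \oo] --> f x} ->
  {ae mu, forall x, forall n, `|f_ n x| <= h x} ->
  forall e, 0 < e -> exists N, forall n, (N <= n)%N -> nrm mu (f_ n \- f) < e.
Proof.
move=> mf_ mf h2 f_f fh e e0.
have mh := L2_measurable h2.
have lef : {ae mu, forall x, `|f x| <= h x}.
  apply: filterS2 f_f fh => x cx hx.
  have cn : `|f_ n x| @[n --> \oo] --> `|f x| by exact: cvg_norm.
  rewrite -(cvg_lim (@Rhausdorff R) cn); apply: limr_le; first by apply/cvg_ex; exists `|f x|.
  exact: nearW.
have f_2 n : f_ n \- f \in Lfun mu 2%:E.
  have h22 : (fun x => 2 * h x) \in Lfun mu 2%:E by exact: L2_Z.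
  have mfB : measurable_fun setT (f_ n \- f) by exact: measurable_funB.
  apply/L2P; split => //; have [_] := (L2P mu _).1 h22; apply: le_lt_trans.
  apply: ae_ge0_le_integral => //=.
  - by move=> x _; rewrite lee_fin sqr_ge0.
  - exact/measurable_EFinP/measurable_funX.
  - by move=> x _; rewrite lee_fin sqr_ge0.
  - by apply/measurable_EFinP/measurable_funX/measurable_funM.
  - apply: filterS2 fh lef => x /(_ n) h1 h3 _; rewrite lee_fin.
    have := le_trans (ler_normB (f_ n x) (f x)) (lerD h1 h3); rewrite -mulr2n mulr_natl => h4.
    rewrite -(real_normK (num_real (f_ n x - f x))) lerXn2r ?nnegrE//.
    exact: le_trans (normr_ge0 _) h4.
have [] := @dominated_convergence _ T R mu setT measurableT
   (fun n x => ((f_ n x - f x) ^+ 2)%:E) (fun=> 0%E) (fun x => (4 * h x ^+ 2)%:E).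
- by move=> n; apply/measurable_EFinP/measurable_funX/measurable_funB.
- exact: measurable_cst.
- apply: filterS f_f => x cx _.
  apply: cvg_EFin; first exact: nearW.
  have -> : (0 : R) = (f x - f x) ^+ 2 by rewrite subrr expr0n.
  under eq_fun do rewrite /= expr2; rewrite expr2.
  by apply: cvgM; apply: cvgB => //; exact: cvg_cst.
- rewrite (_ : (fun x => _) = (fun x => 4%:E * (h x ^+ 2)%:E)%E); last first.
    by apply/funext => x; rewrite EFinM.
  by apply: integrableZl => //; exact: Lfun2_integrable_sqr.
- apply: filterS2 fh lef => x h1 h3 n _; rewrite gee0_abs ?lee_fin ?sqr_ge0//.
  have {}h1 := h1 n; have := sqr_ge0 (f_ n x + f x).
  have a1 : f_ n x ^+ 2 <= h x ^+ 2.
    by rewrite -(real_normK (num_real (f_ n x))) lerXn2r// nnegrE (le_trans _ h1).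
  have a2 : f x ^+ 2 <= h x ^+ 2.
    by rewrite -(real_normK (num_real (f x))) lerXn2r// nnegrE (le_trans _ h3).
  rewrite sqrrD sqrrB; lra.
move=> _ _ /=; rewrite integral0 => /fine_cvgP[_] /cvgrPdist_lt /(_ (e ^+ 2)).
rewrite exprn_gt0// => /(_ isT)[N _ hN]; exists N => n /hN /=; rewrite sub0r normrN.
rewrite nrm_lt// -EFin_ip//= ger0_norm ?ip_ge0//.
Qed.

Section boltzmann.
Context {R : realType} {d : nat}.
Variable phi : 'rV[R]_d -> \bar R.
Hypothesis phi_pot : pair_potential phi.
Hypothesis phi_ge0 : forall x, (0 <= phi x)%E.
Implicit Types (g : config R d) (x y : 'rV[R]_d).

(** For phi >= 0 both branches of [energy] agree with the extended sum, which is +oo exactly when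
    summability fails. *)
Lemma energyE x g : energy phi x g = (\esum_(y in g) phi (x - y))%E.
Proof.
rewrite /energy; case: asboolP => h.
  rewrite [X in (_ - X)%E]esum1 ?sube0.
    by apply: eq_esum => y _; rewrite (@ge0_funeposE _ _ setT)// inE.
  by move=> y _; rewrite (@ge0_funenegE _ _ setT)// inE.
apply/esym/eqP; rewrite -leye_eq leNgt; apply/negP => h'; apply: h.
rewrite /summable; apply: le_lt_trans h'; apply: le_esum => y _.
by rewrite gee0_abs.
Qed.

Definition bw x g : R := fine (expeR (- energy phi x g)).

Lemma energy_ge0 x g : (0 <= energy phi x g)%E.
Proof. by rewrite energyE; apply: esum_ge0. Qed.

Lemma expeRN_fin (e : \bar R) : (0 <= e)%E -> expeR (- e) = (fine (expeR (- e)))%:E.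
Proof. by case: e. Qed.

Lemma fine_expeRN_itv (e : \bar R) : (0 <= e)%E -> 0 <= fine (expeR (- e)) <= 1.
Proof.
case: e => [r| |]//=; last by rewrite lexx ler01.
by rewrite lee_fin => r0; rewrite expR_ge0 -expR0 ler_expR oppr_le0.
Qed.

Lemma EFin_bw x g : (bw x g)%:E = expeR (- energy phi x g).
Proof. by rewrite /bw -expeRN_fin// energy_ge0. Qed.

Lemma bw_ge0 x g : 0 <= bw x g.
Proof. by have /andP[] := fine_expeRN_itv (energy_ge0 x g). Qed.

Lemma bw_le1 x g : bw x g <= 1.
Proof. by have /andP[] := fine_expeRN_itv (energy_ge0 x g). Qed.

(** The factor by which a point at displacement x rescales a birth rate; [pw x - 1] is the Mayer
    function of phi. *)
Definition pw x : R := fine (expeR (- phi x)).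

Lemma pw_itv x : 0 <= pw x <= 1. Proof. exact: fine_expeRN_itv. Qed.

Lemma bw_addp x y g : ~ points g y -> bw x (addp g y) = pw (x - y) * bw x g.
Proof.
move=> gy; rewrite /bw /pw energyE esum_addp// -energyE.
have e0 := energy_ge0 x g; have p0 := phi_ge0 (x - y).
move: (energy _ _ _) (phi _) e0 p0 => [e| |] [p| |]//= _ _; rewrite ?mul0r ?mulr0//.
by rewrite opprD expRD.
Qed.

Lemma measurable_phi : measurable_fun setT phi. Proof. by case: phi_pot. Qed.

Lemma measurable_fine_expeRN dX (X : measurableType dX) (f : X -> \bar R) :
  measurable_fun setT f -> (forall t, 0 <= f t)%E ->
  measurable_fun setT (fun t => fine (expeR (- f t))).
Proof.
move=> mf f0; rewrite (_ : (fun t => _) = fun t => if f t == +oo%E then 0 else expR (- fine (f t))).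
  apply: measurable_fun_ifT => //.
  - apply: (measurable_fun_bool true); rewrite setTI.
    rewrite (_ : _ @^-1` _ = f @^-1` [set +oo%E]); last by apply/seteqP; split=> t /= /eqP.
    by rewrite -[X in measurable X]setTI; exact: mf.
  - apply: (measurableT_comp (@measurable_expR R)); apply: measurableT_comp => //.
    exact: measurableT_comp.
by apply/funext => t; have := f0 t; case: (f t).
Qed.

Lemma measurable_bw dX (X : measurableType dX) (p : X -> 'rV[R]_d) (c : X -> config R d) :
  measurable_fun setT p -> measurable_fun setT c ->
  measurable_fun setT (fun t => bw (p t) (c t)).
Proof.
move=> mp mc; apply: measurable_fine_expeRN; last by move=> t; exact: energy_ge0.
under eq_fun do rewrite energyE.
apply: (measurable_esum mc (f := fun q => phi (p q.1 - q.2))) => //.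
apply: (measurableT_comp measurable_phi); apply: measurable_funB_rV => //.
exact: measurableT_comp.
Qed.

Lemma measurable_pw : measurable_fun setT pw.
Proof.
exact: measurable_fine_expeRN measurable_phi phi_ge0.
Qed.

End boltzmann.

(** * Moments of sums over a Gibbs configuration *)

Section gibbs_moments.
Context {R : realType} {d : nat}.
Variables (phi : 'rV[R]_d -> \bar R) (z : R) (mu : probability (config R d) R).
Hypothesis phi_pot : pair_potential phi.
Hypothesis phi_ge0 : forall x, (0 <= phi x)%E.
Hypothesis z_gt0 : 0 < z.
Hypothesis mu_gibbs : gibbs z phi mu.
Implicit Types (g : config R d) (x y : 'rV[R]_d) (f : 'rV[R]_d -> R).
Local Notation bw := (bw phi).
Local Notation leb := (lebesgue_rV d : {measure set 'rV[R]_d -> \bar R}).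

Lemma gnz (F : config R d * 'rV[R]_d -> \bar R) :
  measurable_fun setT F -> (forall p, 0 <= F p)%E ->
  (\int[mu]_g (\esum_(x in g) F (g, x)) =
   \int[mu]_g \int[leb]_x ((z * bw x g)%:E * F (addp g x, x)))%E.
Proof.
move=> mF F0; rewrite (mu_gibbs mF F0); apply: eq_integral => g _; apply: eq_integral => x _.
by rewrite EFinM EFin_bw.
Qed.

Definition sum_points f g : \bar R := (\esum_(x in g) (f x)%:E)%E.

Lemma sum_points_ge0 f g : (forall x, 0 <= f x) -> (0 <= sum_points f g)%E.
Proof. by move=> f0; apply: esum_ge0 => x _; rewrite lee_fin. Qed.

Lemma measurable_sum_points f dX (X : measurableType dX) (c : X -> config R d) :
  measurable_fun setT c -> measurable_fun setT f -> (forall x, 0 <= f x) ->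
  measurable_fun setT (fun t => sum_points f (c t)).
Proof.
move=> mc mf f0; apply: (measurable_esum mc (f := fun q => (f q.2)%:E)).
- by apply/measurable_EFinP; exact: measurableT_comp.
- by move=> p; rewrite lee_fin.
Qed.

Lemma sum_points_addp f g x : (forall x, 0 <= f x) ->
  (sum_points f (addp g x) <= (f x)%:E + sum_points f g)%E.
Proof.
move=> f0; have [gx|gx] := pselect (points g x); last by rewrite /sum_points esum_addp.
by rewrite addp_in// leeDr// lee_fin.
Qed.

Lemma z_bw_ge0 x g : 0 <= z * bw x g.
Proof. by rewrite mulr_ge0 ?bw_ge0// ltW. Qed.

Lemma z_bw_le x g : z * bw x g <= z.
Proof. by rewrite ler_piMr ?bw_le1// ltW. Qed.

Lemma measurable_z_bw dX (X : measurableType dX) (p : X -> 'rV[R]_d) (c : X -> config R d) :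
  measurable_fun setT p -> measurable_fun setT c ->
  measurable_fun setT (fun t => z * bw (p t) (c t)).
Proof. by move=> mp mc; apply: measurable_funM => //; exact: measurable_bw. Qed.

Lemma measurable_addp_pair :
  measurable_fun setT (fun p : config R d * 'rV[R]_d => (addp p.1 p.2, p.2)).
Proof.
apply/measurable_fun_pairP; split; last exact: measurable_snd.
exact: measurable_addp measurable_fst measurable_snd.
Qed.

Lemma gnz_le (F : config R d * 'rV[R]_d -> \bar R) :
  measurable_fun setT F -> (forall p, 0 <= F p)%E ->
  (\int[mu]_g (\esum_(x in g) F (g, x)) <=
   \int[mu]_g \int[leb]_x (z%:E * F (addp g x, x)))%E.
Proof.
move=> mF F0; rewrite (gnz mF F0).
have mFa : measurable_fun setT (fun p : config R d * 'rV[R]_d => F (addp p.1 p.2, p.2)).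
  exact: measurableT_comp mF measurable_addp_pair.
have m1 : measurable_fun setT (fun p : config R d * 'rV[R]_d =>
    (z * bw p.2 p.1)%:E * F (addp p.1 p.2, p.2))%E.
  by apply: emeasurable_funM => //; apply/measurable_EFinP; exact: measurable_z_bw.
have m2 : measurable_fun setT (fun p : config R d * 'rV[R]_d =>
    z%:E * F (addp p.1 p.2, p.2))%E by apply: emeasurable_funM => //; exact: measurable_cst.
have p1 p : (0 <= (z * bw p.2 p.1)%:E * F (addp p.1 p.2, p.2))%E.
  by apply: mule_ge0; rewrite ?lee_fin ?z_bw_ge0.
have p2 p : (0 <= z%:E * F (addp p.1 p.2, p.2))%E.
  by apply: mule_ge0; rewrite ?lee_fin// ltW.
apply: ge0_le_integral => //=.
- by move=> g _; apply: integral_ge0 => x _; exact: (p1 (g, x)).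
- exact: (measurable_fun_fubini_tonelli_F (m2 := lebesgue_rV d) _ m1 p1).
- exact: (measurable_fun_fubini_tonelli_F (m2 := lebesgue_rV d) _ m2 p2).
move=> g _; apply: ge0_le_integral => //=.
- by move=> x _; exact: (p1 (g, x)).
- exact: (measurableT_comp m1 (measurable_pair1 g)).
- exact: (measurableT_comp m2 (measurable_pair1 g)).
- by move=> x _; apply: lee_wpmul2r => //; rewrite lee_fin z_bw_le.
Qed.

Section moments.
Variables (f : 'rV[R]_d -> R) (D : R).
Hypotheses (mf : measurable_fun setT f) (f0 : forall x, 0 <= f x) (fD : forall x, f x <= D).
Hypothesis int_f : (\int[leb]_x (f x)%:E < +oo)%E.

Let z0 : (0 <= z%:E)%E. Proof. by rewrite lee_fin ltW. Qed.

Let mfE : measurable_fun setT (EFin \o f). Proof. exact/measurable_EFinP. Qed.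

Let int_f_ge0 : (0 <= \int[leb]_x (f x)%:E)%E.
Proof. by apply: integral_ge0 => x _; rewrite lee_fin. Qed.

Lemma sum_points_moment1 : (\int[mu]_g sum_points f g < +oo)%E.
Proof.
apply: le_lt_trans (gnz_le (F := fun p => (f p.2)%:E) _ _) _.
- by apply/measurable_EFinP; exact: measurableT_comp.
- by move=> p; rewrite lee_fin.
rewrite (eq_integral (cst (z%:E * \int[leb]_x (f x)%:E)%E)); last first.
  by move=> g _; rewrite ge0_integralZl// => x _; rewrite lee_fin.
rewrite integral_cst//. rewrite [X in (_ * X)%E](probability_setT mu) mule1.
by rewrite lte_mul_pinfty.
Qed.

(** The square of the sum S is the sum over x of f(x) S. The birth formula evaluates S at the
    configuration with x added, where it is at most f(x) + S; this leaves z (D I + I E S), with I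
    the integral of f, and the first moment concludes. *)
Lemma sum_points_moment2 : (\int[mu]_g (sum_points f g * sum_points f g) < +oo)%E.
Proof.
pose F (p : config R d * 'rV[R]_d) := ((f p.2)%:E * sum_points f p.1)%E.
have mS (dX : measure_display) (X : measurableType dX) (c : X -> config R d) :
   measurable_fun setT c -> measurable_fun setT (fun t => sum_points f (c t)).
  by move=> mc; exact: measurable_sum_points.
have S0 g : (0 <= sum_points f g)%E by exact: sum_points_ge0.
have mF : measurable_fun setT F.
  apply: emeasurable_funM; last exact: mS.
  by apply/measurable_EFinP; exact: measurableT_comp.
have F0 p : (0 <= F p)%E by rewrite mule_ge0// lee_fin.
have fE0 x : (0 <= (f x)%:E)%E by rewrite lee_fin.
have -> : (\int[mu]_g (sum_points f g * sum_points f g) =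
   \int[mu]_g (\esum_(x in g) F (g, x)))%E.
  apply: eq_integral => g _; rewrite -integral_npoints//; last first.
    exact: (measurableT_comp mF (measurable_pair1 g)).
  by rewrite /F/= ge0_integralZr// {1}/sum_points -integral_npoints.
apply: le_lt_trans (gnz_le mF F0) _.
pose I := (\int[leb]_x (f x)%:E)%E.
have mff : measurable_fun setT (fun x => (f x)%:E * (f x)%:E)%E by exact: emeasurable_funM.
have le1 g : (\int[leb]_x (z%:E * F (addp g x, x)) <=
    z%:E * (D%:E * I + I * sum_points f g))%E.
  rewrite ge0_integralZl//; last first.
    exact: measurableT_comp mF (measurableT_comp measurable_addp_pair (measurable_pair1 g)).
  apply: lee_wpmul2l => //.
  apply: (@le_trans _ _ (\int[leb]_x (D%:E * (f x)%:E + (f x)%:E * sum_points f g))%E).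
    apply: ge0_le_integral => //=.

    - exact: measurableT_comp mF (measurableT_comp measurable_addp_pair (measurable_pair1 g)).
    - by apply: emeasurable_funD; apply: emeasurable_funM => //; exact: measurable_cst.
    move=> x _; rewrite /F /=; apply: le_trans (lee_wpmul2l _ (sum_points_addp g x f0)) _ => //.
    rewrite ge0_muleDr//; apply: leeD => //; apply: lee_wpmul2r => //.
    by rewrite lee_fin.
  have D0 : (0 <= D%:E)%E by rewrite lee_fin (le_trans _ (fD 0)).
  rewrite ge0_integralD//=.
  - by rewrite ge0_integralZl// ge0_integralZr.
  - by move=> x _; rewrite mule_ge0.
  - by apply: emeasurable_funM => //; exact: measurable_cst.
  - by move=> x _; rewrite mule_ge0.
  - by apply: emeasurable_funM => //; exact: measurable_cst.
have D0 : (0 <= D%:E)%E by rewrite lee_fin (le_trans _ (fD 0)).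
have I0 : (0 <= I)%E by [].
have cI : (0 <= D%:E * I)%E by rewrite mule_ge0.
have mFz : measurable_fun setT (fun p => z%:E * F (addp p.1 p.2, p.2))%E.
  apply: emeasurable_funM; first exact: measurable_cst.
  exact: measurableT_comp mF measurable_addp_pair.
have pFz p : (0 <= z%:E * F (addp p.1 p.2, p.2))%E by apply: mule_ge0.
apply: (@le_lt_trans _ _ (\int[mu]_g (z%:E * (D%:E * I + I * sum_points f g)))%E).
  apply: ge0_le_integral => //=.
  - by move=> g _; apply: integral_ge0 => x _; rewrite mule_ge0.
  - exact: (measurable_fun_fubini_tonelli_F (m2 := lebesgue_rV d) _ mFz pFz).
  - apply: emeasurable_funM; first exact: measurable_cst.
    apply: emeasurable_funD; first exact: measurable_cst.
    by apply: emeasurable_funM; [exact: measurable_cst|exact: mS].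
have mIS : measurable_fun setT (fun g => I * sum_points f g)%E.
  by apply: emeasurable_funM; [exact: measurable_cst|exact: mS].
rewrite ge0_integralZl//=; last 2 first.
- by apply: emeasurable_funD => //; exact: measurable_cst.
- by move=> g _; rewrite adde_ge0// mule_ge0.
apply: lte_mul_pinfty => //; rewrite ge0_integralD//=; last by move=> g _; rewrite mule_ge0.
rewrite integral_cst//. rewrite [X in (_ * X)%E](probability_setT mu) mule1.
rewrite lte_add_pinfty//; first by rewrite lte_mul_pinfty.
rewrite ge0_integralZl//; last exact: mS.
rewrite lte_mul_pinfty//; first by rewrite ge0_fin_numE.
exact: sum_points_moment1.
Qed.

Lemma sum_points_ae_fin : {ae mu, forall g, sum_points f g < +oo}%E.
Proof.
have i1 : mu.-integrable setT (sum_points f).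
  apply/integrableP; split; first exact: measurable_sum_points.
  rewrite (eq_integral (sum_points f)); first exact: sum_points_moment1.
  by move=> g _; rewrite gee0_abs// sum_points_ge0.
apply: filterS (integrable_ae measurableT i1) => g /(_ I).
by rewrite ge0_fin_numE// sum_points_ge0.
Qed.

Lemma L2_sum_points : (fun g => fine (sum_points f g)) \in Lfun mu 2%:E.
Proof.
have mS : measurable_fun setT (sum_points f) by exact: measurable_sum_points.
have mS' : measurable_fun setT (fun g => fine (sum_points f g)) by exact: measurableT_comp.
apply/L2P; split => //; apply: le_lt_trans sum_points_moment2.
apply: ge0_le_integral => //=.
- by move=> g _; rewrite lee_fin sqr_ge0.
- exact/measurable_EFinP/measurable_funX.
- exact: emeasurable_funM.
move=> g _; have := sum_points_ge0 g f0; case: (sum_points f g) => [r| |]//=.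
by rewrite expr0n/= mule_ge0.
Qed.

End moments.
End gibbs_moments.

(** * The generator on bounded local functions *)

Lemma integrable_abs_le dT (T : measurableType dT) (R : realType)
  (m : {measure set T -> \bar R}) (f h : T -> R) :
  measurable_fun setT f -> measurable_fun setT h -> (\int[m]_x (h x)%:E < +oo)%E ->
  (forall x, `|f x| <= h x) -> m.-integrable setT (EFin \o f).
Proof.
move=> mf mh hoo fh; apply: (@le_integrable _ _ _ _ _ _ _ (EFin \o h)) => //.
- exact/measurable_EFinP.
- by move=> x _ /=; rewrite lee_fin (le_trans (fh x))// ler_norm.
apply/integrableP; split; first exact/measurable_EFinP.
rewrite (eq_integral (EFin \o h))// => x _.
by rewrite /= ger0_norm// (le_trans _ (fh x)).
Qed.

Section generator_bounds.
Context {R : realType} {d : nat}.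
Variables (phi : 'rV[R]_d -> \bar R) (z : R).
Hypothesis phi_pot : pair_potential phi.
Hypothesis phi_ge0 : forall x, (0 <= phi x)%E.
Hypothesis z_gt0 : 0 < z.
Implicit Types (g : config R d) (x y : 'rV[R]_d) (u v : config R d -> R).
Local Notation bw := (bw phi).
Local Notation leb := (lebesgue_rV d : {measure set 'rV[R]_d -> \bar R}).

Definition bounded_local n (C : R) u :=
  [/\ measurable_fun setT u, (forall g, `|u g| <= C) & local n u].

Lemma local_addp n u g x : local n u -> ~ cube n x -> u (addp g x) = u g.
Proof. by move=> lu nx; rewrite lu restr_addp_out// -lu. Qed.

Lemma local_delp n u g x : local n u -> ~ cube n x -> u (delp g x) = u g.
Proof.
move=> lu nx; rewrite lu restr_delp delp_notin; first by rewrite -lu.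
by move=> [].
Qed.

Lemma bsupp_death n u g : local n u -> bsupp n (fun x => u (delp g x) - u g).
Proof.
move=> lu x; apply: contraNP => nx; by rewrite (local_delp g lu nx) subrr.
Qed.

Lemma generatorE u g : generator z phi u g =
  \int[leb]_x (z * bw x g * (u g - u (addp g x))) - pairing (fun x => u (delp g x) - u g) g.
Proof. by []. Qed.

Lemma measurable_u_addp u : measurable_fun setT u ->
  measurable_fun setT (fun p : config R d * 'rV[R]_d => u (addp p.1 p.2)).
Proof. by move=> mu; apply: measurableT_comp mu _; exact: measurable_addp measurable_fst measurable_snd. Qed.

Lemma measurable_u_delp u : measurable_fun setT u ->
  measurable_fun setT (fun p : config R d * 'rV[R]_d => u (delp p.1 p.2)).
Proof. by move=> mu; apply: measurableT_comp mu _; exact: measurable_delp measurable_fst measurable_snd. Qed.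

Lemma measurable_birth u : measurable_fun setT u ->
  measurable_fun setT (fun p : config R d * 'rV[R]_d => z * bw p.2 p.1 * (u p.1 - u (addp p.1 p.2))).
Proof.
move=> mu; apply: measurable_funM.
  exact: measurable_z_bw measurable_snd measurable_fst.
by apply: measurable_funB; [exact: measurableT_comp mu measurable_fst|exact: measurable_u_addp].
Qed.

Lemma measurable_generator n u : measurable_fun setT u -> local n u ->
  measurable_fun setT (generator z phi u).
Proof.
move=> mu lu; apply: measurable_funB.
  exact: (measurable_Rintegral_param (lebesgue_rV d) (measurable_birth mu)).
apply: (measurable_pairing_joint (c := id) _ (n := n)
  (f := fun p : config R d * 'rV[R]_d => u (delp p.1 p.2) - u p.1)) => //.
- by apply: measurable_funB; [exact: measurable_u_delp|exact: measurableT_comp mu measurable_fst].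
- by move=> g; exact: bsupp_death.
Qed.

Section increment_bound.
Variables (f : 'rV[R]_d -> R) (n : nat) (u : config R d -> R).
Hypotheses (mf : measurable_fun setT f) (int_f : (\int[leb]_x (f x)%:E < +oo)%E).
Hypotheses (mu : measurable_fun setT u) (lu : local n u).
Hypothesis incr : forall g x, `|u (addp g x) - u g| <= f x.

Let f0 x : 0 <= f x. Proof. exact: le_trans (normr_ge0 _) (incr point x). Qed.

Let integrable_f : leb.-integrable setT (EFin \o f).
Proof. by apply: (integrable_abs_le mf mf) => // x; rewrite ger0_norm. Qed.

Lemma incr_delp g x : points g x -> `|u (delp g x) - u g| <= f x.
Proof.
move=> gx; have E : addp (delp g x) x = g.
  by apply: config_eqP; rewrite /= setUC setDUK// => _ ->.
by rewrite -{2}E distrC incr.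
Qed.

Lemma birth_le g x : `|z * bw x g * (u g - u (addp g x))| <= z * f x.
Proof.
rewrite normrM ger0_norm ?z_bw_ge0// ler_pM// ?z_bw_ge0// ?z_bw_le//.
by rewrite distrC incr.
Qed.

Let measurable_zf : measurable_fun setT (fun x => z * f x).
Proof. by apply: measurable_funM. Qed.

Let int_zf : (\int[leb]_x (z * f x)%:E < +oo)%E.
Proof.
under eq_integral do rewrite EFinM.
rewrite ge0_integralZl//.
- rewrite lte_mul_pinfty// ?lee_fin ?ltW//.
- exact/measurable_EFinP.
- by move=> x _; rewrite lee_fin.
- by rewrite lee_fin ltW.
Qed.

Lemma integrable_birth g :
  leb.-integrable setT (EFin \o (fun x => z * bw x g * (u g - u (addp g x)))).
Proof.
apply: (integrable_abs_le _ measurable_zf int_zf (birth_le g)).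
exact: (measurableT_comp (measurable_birth mu) (measurable_pair1 g)).
Qed.

Lemma death_le g : (sum_points f g < +oo)%E ->
  `|pairing (fun x => u (delp g x) - u g) g| <= fine (sum_points f g).
Proof.
move=> Soo; have bd := bsupp_death (g := g) lu.
have ba : bsupp n (fun x => `|u (delp g x) - u g|).
  by move=> x; rewrite normr_eq0; exact: bd.
apply: (@le_trans _ _ (pairing (fun x => `|u (delp g x) - u g|) g)).
  by rewrite !(pairingE _ bd, pairingE _ ba) ler_norm_sum.
rewrite -lee_fin fineK ?ge0_fin_numE// ?sum_points_ge0//.
rewrite -(esum_bsupp _ ba)//; apply: le_esum => x gx; rewrite lee_fin; exact: incr_delp.
Qed.

(** The bound depends on [u] only through its increment majorant f. This lets one L^2 function
    dominate the generator along a whole sequence of approximate solutions. *)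
Lemma generator_le g : (sum_points f g < +oo)%E ->
  `|generator z phi u g| <= z * (\int[leb]_x f x) + fine (sum_points f g).
Proof.
move=> Soo; rewrite generatorE (le_trans (ler_normB _ _))// lerD ?death_le//.
rewrite -RintegralZl//; apply: le_trans (le_normr_Rintegral _ (integrable_birth g)) _ => //.
apply: le_Rintegral => //.
- exact: (integrable_norm (integrable_birth g)).
- by apply: (integrable_abs_le measurable_zf measurable_zf) => // x; rewrite ger0_norm ?mulr_ge0// ltW.
- by move=> x _; exact: birth_le.
Qed.

End increment_bound.

End generator_bounds.

(** * Linearity and continuity of the generator on bounded local functions *)

Section bounded_local_functions.
Context {R : realType} {d : nat}.
Variables (phi : 'rV[R]_d -> \bar R) (z : R).
Hypothesis phi_pot : pair_potential phi.
Hypothesis phi_ge0 : forall x, (0 <= phi x)%E.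
Hypothesis z_gt0 : 0 < z.
Implicit Types (g : config R d) (x y : 'rV[R]_d) (u v : config R d -> R) (C : R).
Local Notation bw := (bw phi).
Local Notation leb := (lebesgue_rV d : {measure set 'rV[R]_d -> \bar R}).
Local Notation gen := (generator z phi).

Definition cst_cube n (C : R) x : R := C * \1_(cube n) x.

Lemma measurable_cst_cube n C : measurable_fun setT (cst_cube n C).
Proof. by apply: measurable_funM => //; apply/measurable_indicP; exact: measurable_cube. Qed.

Lemma bsupp_cst_cube n C : bsupp n (cst_cube n C).
Proof.
by move=> x; apply: contraNP => nx; rewrite /cst_cube indicE memNset// mulr0.
Qed.

Lemma integral_cst_cube n C : 0 <= C -> (\int[leb]_x (cst_cube n C x)%:E < +oo)%E.
Proof.
move=> C0; under eq_integral do rewrite EFinM.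
have mC : measurable (cube n : set 'rV[R]_d) by exact: measurable_cube.
rewrite ge0_integralZl//.
- by rewrite integral_indic// setIT lte_mul_pinfty ?lee_fin//; exact: lebesgue_rV_ball.
- by apply/measurable_EFinP; exact: measurable_indic.
Qed.

Lemma cst_cube_ge0 n C x : 0 <= C -> 0 <= cst_cube n C x.
Proof. by move=> C0; rewrite mulr_ge0. Qed.

Lemma cst_cube_le n C x : 0 <= C -> cst_cube n C x <= C.
Proof. by move=> C0; rewrite ler_piMr// indicE lern1 leq_b1. Qed.

Lemma sum_points_cst_cube n C g : 0 <= C ->
  sum_points (cst_cube n C) g = (pairing (cst_cube n C) g)%:E.
Proof.
by move=> C0; rewrite /sum_points (esum_bsupp _ (@bsupp_cst_cube n C))// => x; rewrite cst_cube_ge0.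
Qed.

Lemma bounded_local_ge0 n C u : bounded_local n C u -> 0 <= C.
Proof. by move=> [_ /(_ point) + _]; exact: le_trans. Qed.

Lemma le_bounded_local m n C u : (m <= n)%N -> bounded_local m C u -> bounded_local n C u.
Proof. by move=> mn [mu uC lu]; split => //; exact: le_local lu. Qed.

Lemma bounded_local_incr n C u g x : bounded_local n C u ->
  `|u (addp g x) - u g| <= cst_cube n (2 * C) x.
Proof.
move=> bu; have [mu uC lu] := bu; rewrite /cst_cube indicE.
have [xn|xn] := pselect (cube n x); last first.
  by rewrite (local_addp g lu xn) subrr normr0 memNset// mulr0.
rewrite mem_set// mulr1 (le_trans (ler_normB _ _))// mulr_natl mulr2n.
by rewrite lerD.
Qed.

Lemma measurable_birth_section u g : measurable_fun setT u ->
  measurable_fun setT (fun x => z * bw x g * (u g - u (addp g x))).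
Proof.
move=> mu.
exact: (measurableT_comp (measurable_birth z phi_pot phi_ge0 mu) (measurable_pair1 g)).
Qed.

Section one_function.
Variables (n : nat) (C : R) (u : config R d -> R).
Hypothesis bu : bounded_local n C u.

Let C2 : 0 <= 2 * C. Proof. by rewrite mulr_ge0// (bounded_local_ge0 bu). Qed.

Lemma generator_le_cube g : `|gen u g| <=
  z * (\int[leb]_x cst_cube n (2 * C) x) + fine (sum_points (cst_cube n (2 * C)) g).
Proof.
have [mu uC lu] := bu.
apply: (generator_le phi_pot phi_ge0 z_gt0 _ _ mu lu) => //.
- exact: measurable_cst_cube.
- exact: integral_cst_cube.
- by move=> g' x; exact: bounded_local_incr.
- by rewrite sum_points_cst_cube// ltry.
Qed.

Lemma integrable_birth_cube g :
  leb.-integrable setT (EFin \o (fun x => z * bw x g * (u g - u (addp g x)))).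
Proof.
have [mu uC lu] := bu.
apply: (@integrable_birth _ _ _ _ phi_pot phi_ge0 z_gt0 (cst_cube n (2 * C))) => //.
- exact: measurable_cst_cube.
- exact: integral_cst_cube.
- by move=> g' x; exact: bounded_local_incr.
Qed.

End one_function.

Lemma generator_lin n C C' u v (a : R) g : bounded_local n C u -> bounded_local n C' v ->
  gen (fun g => a * u g + v g) g = a * gen u g + gen v g.
Proof.
move=> bu bv; rewrite !generatorE.
have iu := integrable_birth_cube bu g; have iv := integrable_birth_cube bv g.
have -> : \int[leb]_x (z * bw x g * (a * u g + v g - (a * u (addp g x) + v (addp g x)))) =
  a * (\int[leb]_x (z * bw x g * (u g - u (addp g x)))) +
    \int[leb]_x (z * bw x g * (v g - v (addp g x))).
  rewrite -RintegralZl// -RintegralD//; last first.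
    by apply: (integrableZl measurableT a) iu.
  by apply: eq_Rintegral => x _; ring.
have -> : pairing (fun x => a * u (delp g x) + v (delp g x) - (a * u g + v g)) g =
  a * pairing (fun x => u (delp g x) - u g) g + pairing (fun x => v (delp g x) - v g) g.
  have [[_ _ lu] [_ _ lv]] := (bu, bv).
  rewrite -(pairing_lin a g (bsupp_death (g := g) lu) (bsupp_death (g := g) lv)).
  by congr (pairing _ g); apply/funext => x; ring.
by ring.
Qed.

Lemma generator_cvg n C (u_ : nat -> config R d -> R) u g : (forall k, bounded_local n C (u_ k)) ->
  (forall g, u_ k g @[k --> \oo] --> u g) -> bounded_local n C u /\
  gen (u_ k) g @[k --> \oo] --> gen u g.
Proof.
move=> bu uu; have bu' : bounded_local n C u.
  split.
  - by apply: (@measurable_fun_cvg _ _ _ setT u_) => // k; have [] := bu k.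
  - move=> g'; have cn : `|u_ k g'| @[k --> \oo] --> `|u g'| by exact: cvg_norm.
    rewrite -(cvg_lim (@Rhausdorff R) cn); apply: limr_le; first by apply/cvg_ex; exists `|u g'|.
    by apply: nearW => k; have [] := bu k.
  - move=> g'; apply: (cvg_unique (@Rhausdorff R) (uu g')).
    rewrite (_ : (fun k => u_ k g') = (fun k => u_ k (restr (cube n) g'))); first exact: uu.
    by apply/funext => k; have [_ _] := bu k; apply.
split => //; under eq_fun do rewrite generatorE.
rewrite generatorE; apply: cvgB.
- have zC2 : 0 <= z * (2 * C).
    by apply: mulr_ge0; [exact: ltW|rewrite mulr_ge0 ?(bounded_local_ge0 bu')].
  have zd := @measurable_cst_cube n (z * (2 * C)).
  have := @dominated_convergence _ _ R leb setT measurableT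
   (fun k x => (z * bw x g * (u_ k g - u_ k (addp g x)))%:E)
   (fun x => (z * bw x g * (u g - u (addp g x)))%:E) (EFin \o cst_cube n (z * (2 * C))).
  case.
  + move=> k; apply/measurable_EFinP; have [mk _ _] := bu k.
    exact: measurable_birth_section.
  + apply/measurable_EFinP; have [mk _ _] := bu'.
    exact: measurable_birth_section.
  + apply: nearW => x _; apply: cvg_EFin; first exact: nearW.
    by apply: cvgM; [exact: cvg_cst|apply: cvgB; exact: uu].
  + apply: (integrable_abs_le zd zd); first exact: integral_cst_cube.
    by move=> x; rewrite ger0_norm// cst_cube_ge0.
  + apply: nearW => x k _ /=; rewrite lee_fin.
    have := birth_le phi_ge0 z_gt0 (fun g y => bounded_local_incr g y (bu k)) g x.
    by rewrite /cst_cube [z * (_ * _)]mulrA.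
  move=> _ _ h; apply: fine_cvg; rewrite fineK; first exact: h.
  have ib := integrable_birth_cube bu' g.
  have := integrable_fin_num measurableT ib. exact.
- apply: (pairing_cvg (n := n)).
  + by move=> k; have [_ _ lk] := bu k; exact: bsupp_death.
  + by have [_ _ lk] := bu'; exact: bsupp_death.
  + by move=> x; apply: cvgB; exact: uu.
Qed.

End bounded_local_functions.

(** * Integration by parts and the Dirichlet form *)

Section dirichlet_form.
Context {R : realType} {d : nat}.
Hypothesis d_gt0 : (0 < d)%N.
Variables (phi : 'rV[R]_d -> \bar R) (z : R) (mu : probability (config R d) R).
Hypothesis phi_pot : pair_potential phi.
Hypothesis phi_ge0 : forall x, (0 <= phi x)%E.
Hypothesis z_gt0 : 0 < z.
Hypothesis mu_gibbs : gibbs z phi mu.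
Implicit Types (g : config R d) (x y : 'rV[R]_d) (u v : config R d -> R) (C : R).
Local Notation bw := (bw phi).
Local Notation leb := (lebesgue_rV d : {measure set 'rV[R]_d -> \bar R}).
Local Notation gen := (generator z phi).
Local Notation L2 f := (f \in Lfun mu 2%:E).

Lemma integrable_bounded C u : measurable_fun setT u -> (forall g, `|u g| <= C) ->
  mu.-integrable setT (EFin \o u).
Proof.
move=> mu' uC; apply: (integrable_abs_le (h := cst C) mu') => //.
rewrite (eq_integral (cst C%:E))// integral_cst// [X in (_ * X)%E](probability_setT mu).
by rewrite mule1 ltry.
Qed.

Lemma L2_bounded C u : measurable_fun setT u -> (forall g, `|u g| <= C) -> L2 u.
Proof.
move=> mu' uC; apply/L2P; split => //.
have : mu.-integrable setT (EFin \o (fun g => u g ^+ 2)).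
  apply: (integrable_bounded (C := C ^+ 2)); first exact: measurable_funX.
  by move=> g; rewrite normrX lerXn2r// nnegrE// (le_trans _ (uC g)).
move=> /integrableP[_]; apply: le_lt_trans; apply: ge0_le_integral => //=.
- by move=> g _; rewrite lee_fin sqr_ge0.
- by apply/measurable_EFinP; exact: measurable_funX.
- by apply/measurable_EFinP; apply: measurableT_comp => //; exact: measurable_funX.
- by move=> g _; rewrite lee_fin ler_norm.
Qed.

Lemma L2_bounded_local n C u : bounded_local n C u -> L2 u.
Proof. by move=> [mu' uC _]; exact: L2_bounded uC. Qed.

Let dom n C g :=
  z * (\int[leb]_x cst_cube n (2 * C) x) + fine (sum_points (cst_cube n (2 * C)) g).

Lemma L2_sum_points_cube n C : 0 <= C -> L2 (fun g => fine (sum_points (cst_cube n C) g)).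
Proof.
move=> C0; apply: (L2_sum_points phi_pot phi_ge0 z_gt0 mu_gibbs (measurable_cst_cube n C)
  (fun x => cst_cube_ge0 n x C0) (fun x => cst_cube_le n x C0)).
exact: integral_cst_cube.
Qed.

Let L2_dom n C : 0 <= C -> L2 (dom n C).
Proof.
move=> C0; apply: L2_D; first by apply: (@L2_bounded `|z * (\int[leb]_x cst_cube n (2 * C) x)|).
by apply: L2_sum_points_cube; rewrite mulr_ge0.
Qed.

Lemma L2_generator n C u : bounded_local n C u -> L2 (gen u).
Proof.
move=> bu; have C0 := bounded_local_ge0 bu; have [mu' uC lu] := bu.
apply: (L2_dominated _ (L2_dom n C0)); first exact: measurable_generator lu.
move=> g; apply: le_trans (ler_norm _); exact: generator_le_cube bu g.
Qed.

Lemma generator_cvg_L2 n C (u_ : nat -> config R d -> R) u e :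
  (forall k, bounded_local n C (u_ k)) -> (forall g, u_ k g @[k --> \oo] --> u g) -> 0 < e ->
  bounded_local n C u /\
  exists k, nrm mu (u_ k \- u) < e /\ nrm mu (gen (u_ k) \- gen u) < e.
Proof.
move=> bu uu e0; have bu' := (generator_cvg phi_pot phi_ge0 z_gt0 point bu uu).1.
split => //; have C0 := bounded_local_ge0 bu'; have [mu' uC lu] := bu'.
have [N1 h1] : exists N, forall k, (N <= k)%N -> nrm mu (u_ k \- u) < e.
  apply: (L2_dominated_cvg (h := cst C)) => //.
  - by move=> k; have [] := bu k.
  - by apply: (@L2_bounded C) => // g; rewrite ger0_norm.
  - by apply: aeW.
  - by apply: aeW => g k; have [] := bu k.
have [N2 h2] : exists N, forall k, (N <= k)%N -> nrm mu (gen (u_ k) \- gen u) < e.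
  apply: (L2_dominated_cvg (f_ := fun k => gen (u_ k)) (h := dom n C)) => //.
  - by move=> k; have [mk _ lk] := bu k; exact: measurable_generator lk.
  - exact: measurable_generator lu.
  - exact: L2_dom.
  - by apply: aeW => g; have [] := generator_cvg phi_pot phi_ge0 z_gt0 g bu uu.
  - by apply: aeW => g k; exact: generator_le_cube.
exists (maxn N1 N2); split; [apply: h1|apply: h2]; by rewrite ?leq_maxl ?leq_maxr.
Qed.

Section signed_gnz.
Variables (n : nat) (C : R).
Hypothesis C0 : 0 <= C.

Let addPhi (Phi : config R d * 'rV[R]_d -> R) g := \int[leb]_x (z * bw x g * Phi (addp g x, x)).
Let sumPhi (Phi : config R d * 'rV[R]_d -> R) g := pairing (fun x => Phi (g, x)) g.

Let bPhi D (Phi : config R d * 'rV[R]_d -> R) :=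
  measurable_fun setT Phi /\ forall p, `|Phi p| <= cst_cube n D p.2.

Let bsupp_Phi D Phi g : bPhi D Phi -> bsupp n (fun x => Phi (g, x)).
Proof.
move=> [_ h] x; apply: contraNP => nx; rewrite -normr_le0 (le_trans (h _))//.
by rewrite (bsupp0 (@bsupp_cst_cube R d n D) nx).
Qed.

Let meas_addPhi D Phi : bPhi D Phi ->
  measurable_fun setT (fun p : config R d * 'rV[R]_d => z * bw p.2 p.1 * Phi (addp p.1 p.2, p.2)).
Proof.
move=> [mP _]; apply: measurable_funM; first exact: measurable_z_bw measurable_snd measurable_fst.
exact: measurableT_comp mP measurable_addp_pair.
Qed.

Let addPhi_le D Phi g x : 0 <= D -> bPhi D Phi ->
  `|z * bw x g * Phi (addp g x, x)| <= cst_cube n (z * D) x.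
Proof.
move=> D0 [_ h]; rewrite normrM /cst_cube -[z * D * _]mulrA; apply: ler_pM => //.
by rewrite ger0_norm ?(z_bw_ge0 phi_ge0 z_gt0)// (z_bw_le phi_ge0 z_gt0).
Qed.

Let int_addPhi D Phi g : 0 <= D -> bPhi D Phi ->
  leb.-integrable setT (EFin \o (fun x => z * bw x g * Phi (addp g x, x))).
Proof.
move=> D0 bP; have md := @measurable_cst_cube R d n (z * D).
apply: (integrable_abs_le _ md).
- exact: (measurableT_comp (meas_addPhi bP) (measurable_pair1 g)).
- by apply: integral_cst_cube; rewrite mulr_ge0// ltW.
- by move=> x; exact: addPhi_le bP.
Qed.

Let meas_add D Phi : bPhi D Phi -> measurable_fun setT (addPhi Phi).
Proof. by move=> bP; exact: (measurable_Rintegral_param (lebesgue_rV d) (meas_addPhi bP)). Qed.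

Let meas_sum D Phi : bPhi D Phi -> measurable_fun setT (sumPhi Phi).
Proof.
move=> bP; have [mP _] := bP.
by apply: (measurable_pairing_joint (c := id) _ (n := n) (f := Phi)) => // g; exact: bsupp_Phi bP.
Qed.

Let sumPhi_le D Phi g : 0 <= D -> bPhi D Phi -> `|sumPhi Phi g| <= fine (sum_points (cst_cube n D) g).
Proof.
move=> D0 bP; rewrite sum_points_cst_cube//= /sumPhi.
rewrite (pairingE _ (bsupp_Phi bP)) (pairingE _ (@bsupp_cst_cube R d n D)).
by rewrite (le_trans (ler_norm_sum _ _ _))// ler_sum// => x _; exact: bP.2.
Qed.

Let integrable_sum D Phi : 0 <= D -> bPhi D Phi -> mu.-integrable setT (EFin \o sumPhi Phi).
Proof.
move=> D0 bP; apply: (integrable_abs_le (meas_sum bP) (L2_measurable (L2_sum_points_cube n D0))).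
  rewrite (eq_integral (sum_points (cst_cube n D))).
    apply: (sum_points_moment1 phi_pot phi_ge0 z_gt0 mu_gibbs (@measurable_cst_cube R d n D)
      (fun x => cst_cube_ge0 n x D0)).
    exact: integral_cst_cube.
  by move=> g _; rewrite sum_points_cst_cube.
by move=> g; exact: sumPhi_le.
Qed.

Let addPhi_bound D Phi g : 0 <= D -> bPhi D Phi -> `|addPhi Phi g| <= \int[leb]_x cst_cube n (z * D) x.
Proof.
move=> D0 bP; have iP := int_addPhi g D0 bP.
apply: le_trans (le_normr_Rintegral _ iP) _ => //; apply: le_Rintegral => //.
- exact: integrable_norm iP.
- have md := @measurable_cst_cube R d n (z * D).
  have zD : 0 <= z * D by rewrite mulr_ge0// ltW.
  by apply: (integrable_abs_le md md (integral_cst_cube _ zD)) => x; rewrite ger0_norm// cst_cube_ge0.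
- by move=> x _; exact: addPhi_le bP.
Qed.

Let integrable_add D Phi : 0 <= D -> bPhi D Phi -> mu.-integrable setT (EFin \o addPhi Phi).
Proof.
move=> D0 bP; apply: (integrable_bounded (meas_add bP)) => g; exact: addPhi_bound bP.
Qed.

Let gnz_ge0 D Phi : 0 <= D -> bPhi D Phi -> (forall p, 0 <= Phi p) ->
  \int[mu]_g sumPhi Phi g = \int[mu]_g addPhi Phi g.
Proof.
move=> D0 bP P0; have [mP _] := bP; congr fine.
transitivity (\int[mu]_g (\esum_(x in g) (Phi (g, x))%:E))%E.
  by apply: eq_integral => g _; rewrite (esum_bsupp _ (bsupp_Phi (g := g) bP)).
rewrite (gnz phi_ge0 mu_gibbs (F := EFin \o Phi)); [|exact/measurable_EFinP|by move=> p; rewrite lee_fin].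
apply: eq_integral => g _; rewrite /addPhi fineK; first exact: eq_integral.
exact: (integrable_fin_num measurableT (int_addPhi g D0 bP)).
Qed.

(** The Gibbs identity is stated for nonnegative functions. It is applied to Phi + K and to K, with
    K the constant majorant on the cube, and the two results are subtracted; all integrals are
    finite. *)
Lemma gnz_bounded Phi : bPhi C Phi ->
  [/\ mu.-integrable setT (EFin \o sumPhi Phi), mu.-integrable setT (EFin \o addPhi Phi) &
  \int[mu]_g sumPhi Phi g = \int[mu]_g addPhi Phi g].
Proof.
move=> bP; have [mP PC] := bP; split; [exact: integrable_sum bP|exact: integrable_add bP|].
pose K (p : config R d * 'rV[R]_d) := cst_cube n C p.2.
have bK : bPhi C K.
  split; first by apply: measurableT_comp => //; exact: measurable_cst_cube.
  by move=> p; rewrite ger0_norm// cst_cube_ge0.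
have C20 : 0 <= C + C by rewrite addr_ge0.
pose Psi p := Phi p + K p.
have bPsi : bPhi (C + C) Psi.
  split; first by apply: measurable_funD => //; exact: bK.1.
  by move=> p; rewrite (le_trans (ler_normD _ _))// /cst_cube mulrDl lerD// ?PC// bK.2.
have Psi0 p : 0 <= Psi p.
  by rewrite -lerBlDr sub0r; have := PC p; rewrite ler_norml => /andP[].
have iS := integrable_sum C0; have iA := integrable_add C0.
have E1 : \int[mu]_g sumPhi Psi g = \int[mu]_g sumPhi Phi g + \int[mu]_g sumPhi K g.
  rewrite -RintegralD//; [|exact: iS bP|exact: iS bK]; apply: eq_Rintegral => g _.
  rewrite /sumPhi -[pairing (fun x => Phi _) g]mul1r.
  rewrite -(pairing_lin 1 g (bsupp_Phi (g := g) bP) (bsupp_Phi (g := g) bK)).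
  by congr pairing; apply/funext => x; rewrite mul1r.
have E2 : \int[mu]_g addPhi Psi g = \int[mu]_g addPhi Phi g + \int[mu]_g addPhi K g.
  rewrite -RintegralD//; [|exact: iA bP|exact: iA bK]; apply: eq_Rintegral => g _.
  rewrite /addPhi -RintegralD//; [|exact: int_addPhi bP|exact: int_addPhi bK].
  by apply: eq_Rintegral => x _; rewrite mulrDr.
have K0 p : 0 <= K p by exact: cst_cube_ge0.
by have := gnz_ge0 C20 bPsi Psi0; rewrite E1 E2 (gnz_ge0 C0 bK K0) => /addIr.
Qed.

End signed_gnz.

(** A countable set is null in positive dimension. For almost every x, adding x and deleting it
    again therefore returns the configuration. *)
Lemma ae_notin_config g : {ae leb, forall x, ~ points g x}.
Proof.
have [mg g0] := lebesgue_rV_countable d_gt0 (countable_config g).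
exists g; split => // x /= /contrapT.
exact.
Qed.

Lemma bounded_local_pair n C C' u v : bounded_local n C u -> bounded_local n C' v ->
  exists D, bounded_local n D u /\ bounded_local n D v.
Proof.
move=> [mu' uC lu] [mv vC lv]; exists (Num.max C C'); split; split => // g.
- by rewrite le_max uC.
- by rewrite le_max vC orbT.
Qed.

(** For x not in g, the birth integrand is z bw x g Phi(g + x, x) with Phi(g, x) = (u(g - x) - u(g))
    v(g - x). The Gibbs identity turns its mean into that of the sum of Phi(g, x) over the points x
    of g; subtracting the death sum, weighted by v(g), leaves the product of the two differences.
    The result is symmetric in u and v, and nonnegative for u = v. *)
Lemma ip_generator n C u v : bounded_local n C u -> bounded_local n C v ->
  ip mu (gen u) v =
  \int[mu]_g pairing (fun x => (u (delp g x) - u g) * (v (delp g x) - v g)) g.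
Proof.
move=> bu bv; have [mu' uC lu] := bu; have [mv vC lv] := bv.
have C0 := bounded_local_ge0 bu.
pose D (p : config R d * 'rV[R]_d) := u (delp p.1 p.2) - u p.1.
have mD : measurable_fun setT D.
  by apply: measurable_funB; [exact: measurable_u_delp|exact: measurableT_comp].
have DC p : `|D p| <= cst_cube n (2 * C) p.2.
  rewrite /cst_cube indicE; have [xn|xn] := pselect (cube n p.2); last first.
    by rewrite /D (local_delp _ lu xn) subrr normr0 memNset// mulr0.
  by rewrite mem_set// mulr1 (le_trans (ler_normB _ _))// mulr_natl mulr2n lerD.
pose Phi p := D p * v (delp p.1 p.2).
pose Psi p := D p * v p.1.
have CC : 0 <= 2 * C * C by rewrite !mulr_ge0.
have bM (w : config R d * 'rV[R]_d -> R) : measurable_fun setT w -> (forall p, `|w p| <= C) ->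
    measurable_fun setT (fun p => D p * w p) /\
    forall p, `|D p * w p| <= cst_cube n (2 * C * C) p.2.
  move=> mw wC; split; first exact: measurable_funM.
  by move=> p; rewrite /cst_cube mulrAC normrM; apply: ler_pM => //; exact: DC.
have bPhi := bM _ (measurable_u_delp mv) (fun p => vC _).
have bPsi := bM _ (measurableT_comp mv measurable_fst) (fun p => vC _).
have [i1 i2 E] := gnz_bounded CC bPhi.
have [j1 _ _] := gnz_bounded CC bPsi.
have bs (w : config R d * 'rV[R]_d -> R) g : bsupp n (fun x => D (g, x) * w (g, x)).
  by move=> x; apply: contraNP => nx; rewrite /D /= (local_delp _ lu nx) subrr mul0r.
transitivity (\int[mu]_g (\int[leb]_x (z * bw x g * Phi (addp g x, x)) - pairing (fun x => Psi (g, x)) g)).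
  apply: eq_Rintegral => g _; rewrite generatorE mulrBl; congr (_ - _).
    rewrite -RintegralZr//; last exact: integrable_birth_cube bu g.
    have iu := integrable_birth_cube phi_pot phi_ge0 z_gt0 bu g.
    congr fine; apply: ae_eq_integral => //.
    - apply/measurable_EFinP; apply: measurable_funM => //.
      exact: measurable_birth_section.
    - apply/measurable_EFinP; apply: measurable_funM.
        by apply: measurable_z_bw.
      exact: (measurableT_comp bPhi.1 (measurableT_comp measurable_addp_pair (measurable_pair1 g))).
    - apply: filterS (ae_notin_config g) => x gx _; congr (_%:E).
      by rewrite /Phi /D /= delp_addp// mulrA.
  (* The zero function serves as second summand, so that [pairing_lin] can be used for a scalar
     multiple. *)
  have P0 : pairing (cst_cube n 0) g = 0.
    rewrite (pairingE _ (@bsupp_cst_cube R d n 0)) big1// => x _.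
    by rewrite /cst_cube mul0r.
  rewrite mulrC -[LHS]addr0 -P0.
  rewrite -(pairing_lin (v g) g (bsupp_death (g := g) lu) (@bsupp_cst_cube R d n 0)).
  by congr pairing; apply/funext => x; rewrite /Psi /D /cst_cube /= mul0r addr0 mulrC.
rewrite RintegralB// -E -RintegralB//; apply: eq_Rintegral => g _.
rewrite addrC -mulN1r.
have b1 : bsupp n (fun x => Psi (g, x)) := bs (fun p => v p.1) g.
have b2 : bsupp n (fun x => Phi (g, x)) := bs (fun p => v (delp p.1 p.2)) g.
rewrite -(pairing_lin (-1) g b1 b2).
by congr pairing; apply/funext => x; rewrite /Psi /Phi /D /=; ring.
Qed.

Lemma ip_generatorC n C C' u v : bounded_local n C u -> bounded_local n C' v ->
  ip mu (gen u) v = ip mu u (gen v).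
Proof.
move=> bu bv; have [D [bu' bv']] := bounded_local_pair bu bv.
rewrite [RHS]ipC (ip_generator bu' bv') (ip_generator bv' bu').
apply: eq_Rintegral => g _; congr pairing; apply/funext => x.
by rewrite mulrC.
Qed.

Lemma ip_generator_ge0 n C u : bounded_local n C u -> 0 <= ip mu (gen u) u.
Proof.
move=> bu; rewrite (ip_generator bu bu); apply: Rintegral_ge0 => g _.
apply: (pairing_ge0 (n := n)); last by move=> x; rewrite -expr2 sqr_ge0.
have [_ _ lu] := bu; move=> x; apply: contraNP => nx.
by rewrite (local_delp _ lu nx) subrr mul0r.
Qed.

End dirichlet_form.

(** * The core of cylinder functions *)

Section core.
Context {R : realType} {d : nat}.
Hypothesis d_gt0 : (0 < d)%N.
Variables (phi : 'rV[R]_d -> \bar R) (z : R) (mu : probability (config R d) R).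
Hypothesis phi_pot : pair_potential phi.
Hypothesis phi_ge0 : forall x, (0 <= phi x)%E.
Hypothesis z_gt0 : 0 < z.
Hypothesis mu_gibbs : gibbs z phi mu.
Implicit Types (g : config R d) (x y : 'rV[R]_d) (u v : config R d -> R) (C : R).
Local Notation gen := (generator z phi).
Local Notation L2 f := (f \in Lfun mu 2%:E).
Local Notation nrm := (nrm mu).

Lemma cylinder_bounded_local (F : config R d -> R) : cylinder F -> exists n C, bounded_local n C F.
Proof.
move=> cF; have [C FC] := cylinder_bounded cF; have [n lF] := cylinder_local cF.
by exists n, C; split => //; exact: cylinder_measurable.
Qed.

Lemma cylinder_L2 F : cylinder F -> L2 F /\ L2 (gen F).
Proof.
move=> /cylinder_bounded_local[n [C bF]]; split; first exact: L2_bounded_local bF.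
exact: (L2_generator phi_pot phi_ge0 z_gt0 mu_gibbs bF).
Qed.

Lemma bounded_local_max m n C D u v : bounded_local m C u -> bounded_local n D v ->
  exists k E, bounded_local k E u /\ bounded_local k E v.
Proof.
move=> bu bv; have bu' := le_bounded_local (leq_maxl m n) bu.
have bv' := le_bounded_local (leq_maxr m n) bv.
by exists (maxn m n); exact: bounded_local_pair bu' bv'.
Qed.

(** In terms of classes: (u, gen u) belongs to the closure of the graph of H on cylinder
    functions. *)
Definition graph_approx u := forall e, 0 < e ->
  exists2 F, cylinder F & nrm (F \- u) < e /\ nrm (gen F \- gen u) < e.

Lemma cylinder_graph_approx F : cylinder F -> graph_approx F.
Proof.
move=> cF e e0; exists F => //; have nn (f : config R d -> R) : nrm (f \- f) = 0.
  rewrite /(nrm _) /ip (@eq_Rintegral _ _ _ _ _ (cst 0)) ?Rintegral_cst ?mul0r ?sqrtr0//.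
  by move=> g _ /=; rewrite subrr mulr0.
by rewrite !nn.
Qed.

Lemma graph_approx_trans n C u : bounded_local n C u ->
  (forall e, 0 < e -> exists m D v, [/\ bounded_local m D v, graph_approx v,
     nrm (v \- u) < e & nrm (gen v \- gen u) < e]) -> graph_approx u.
Proof.
move=> bu h e e0; have e20 : 0 < e / 2 by rewrite divr_gt0.
have [m [D [v [bv av n1 n2]]]] := h _ e20; have [F cF [n3 n4]] := av _ e20.
have [LF LgF] := cylinder_L2 cF.
have Lu := L2_bounded_local mu bu; have Lv := L2_bounded_local mu bv.
have Lgu := L2_generator phi_pot phi_ge0 z_gt0 mu_gibbs bu.
have Lgv := L2_generator phi_pot phi_ge0 z_gt0 mu_gibbs bv.
exists F => //; rewrite (splitr e); split.
- by apply: (le_lt_trans (nrm_sub_trans LF Lv Lu)); exact: ltrD.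
- by apply: (le_lt_trans (nrm_sub_trans LgF Lgv Lgu)); exact: ltrD.
Qed.

Lemma nrm_lin_lt (a e : R) (f f' h h' : config R d -> R) : L2 f -> L2 f' -> L2 h -> L2 h' ->
  nrm (f \- h) < e / 2 / (1 + `|a|) -> nrm (f' \- h') < e / 2 ->
  nrm ((fun g => a * f g + f' g) \- (fun g => a * h g + h' g)) < e.
Proof.
move=> Lf Lf' Lh Lh' n1 n2.
rewrite (_ : _ \- _ = (fun g => a * (f \- h) g) \+ (f' \- h')); last first.
  by apply/funext => g /=; ring.
have Lfh : L2 (f \- h) by exact: L2_B.
have Lfh' : L2 (f' \- h') by exact: L2_B.
apply: (le_lt_trans (nrmD (L2_Z a Lfh) Lfh')); rewrite nrmZ// [ltRHS]splitr ler_ltD//.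
rewrite ltr_pdivlMr ?ltr_pwDl// in n1; apply: le_trans (ltW n1).
by rewrite mulrC ler_wpM2l ?nrm_ge0// lerDr.
Qed.

Lemma graph_approx_lin n C (a : R) u v : bounded_local n C u -> bounded_local n C v ->
  graph_approx u -> graph_approx v -> graph_approx (fun g => a * u g + v g).
Proof.
move=> bu bv au av e e0; have e20 : 0 < e / 2 by rewrite divr_gt0.
have ea : 0 < e / 2 / (1 + `|a|) by rewrite divr_gt0// ltr_pwDl.
have [F cF [F1 F2]] := au _ ea; have [G cG [G1 G2]] := av _ e20.
exists (fun g => a * F g + G g); first exact: cylinder_lin.
have [[LF LgF] [LG LgG]] := (cylinder_L2 cF, cylinder_L2 cG).
have Lu := L2_bounded_local mu bu; have Lv := L2_bounded_local mu bv.
have Lgu := L2_generator phi_pot phi_ge0 z_gt0 mu_gibbs bu.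
have Lgv := L2_generator phi_pot phi_ge0 z_gt0 mu_gibbs bv.
have [m [D bF]] := cylinder_bounded_local cF; have [m' [D' bG]] := cylinder_bounded_local cG.
have [k [E [bF' bG']]] := bounded_local_max bF bG.
split; first exact: nrm_lin_lt.
have -> : gen (fun g => a * F g + G g) = fun g => a * gen F g + gen G g.
  by apply/funext => g; exact: (generator_lin phi_pot phi_ge0 z_gt0 a g bF' bG').
have -> : gen (fun g => a * u g + v g) = fun g => a * gen u g + gen v g.
  by apply/funext => g; exact: (generator_lin phi_pot phi_ge0 z_gt0 a g bu bv).
exact: nrm_lin_lt.
Qed.

Lemma graph_approx_lim n C (u_ : nat -> config R d -> R) u :
  (forall k, bounded_local n C (u_ k)) -> (forall k, graph_approx (u_ k)) ->
  (forall g, u_ k g @[k --> \oo] --> u g) -> graph_approx u.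
Proof.
move=> bu au uu.
have [bu' _] := generator_cvg_L2 phi_pot phi_ge0 z_gt0 mu_gibbs bu uu ltr01.
apply: (graph_approx_trans bu') => e e0.
have [_ [k [h1 h2]]] := generator_cvg_L2 phi_pot phi_ge0 z_gt0 mu_gibbs bu uu e0.
by exists n, C, (u_ k).
Qed.

(** Continuous functions supported in the open cube that increase to its indicator. *)
Let cutoff n (k : nat) x : R := Num.min 1 (k%:R * Num.max 0 (n%:R - `|x - 0|)).

Let continuous_cutoff n k : continuous (cutoff n k).
Proof.
apply: continuous_min_rV; apply: continuous_mul_rV; first exact: continuous_cst_rV.
apply: continuous_max_rV; apply: continuous_sub_rV; first exact: continuous_cst_rV.
exact: continuous_dist_rV.
Qed.

Let bsupp_cutoff n k : bsupp n (cutoff n k).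
Proof.
move=> x; apply: contraNP; rewrite /cube/= => /negP; rewrite -leNgt => nx.
rewrite /cutoff subr0 (max_idPl _) ?subr_le0// mulr0.
by rewrite (min_idPr _) ?ler01.
Qed.

Let cvg_cutoff n x : cutoff n k x @[k --> \oo] --> (\1_(cube n) x : R).
Proof.
rewrite indicE; have [xn|xn] := pselect (cube n x); last first.
  rewrite memNset// (_ : (fun k => _) = cst 0); first exact: cvg_cst.
  by apply/funext => k; rewrite (bsupp0 (@bsupp_cutoff n k)).
rewrite mem_set//; have r0 : 0 < n%:R - `|x| by rewrite subr_gt0.
apply: cvg_near_cst; have [N hN] : exists N : nat, (n%:R - `|x|)^-1 <= N%:R.
  by exists (Num.bound (n%:R - `|x|)^-1); rewrite ltW// archi_boundP// invr_ge0 ltW.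
exists N => // k /= Nk; rewrite /cutoff subr0 (max_idPr _) ?ltW//.
apply/min_idPl; rewrite -ler_pdivrMr// div1r (le_trans hN)// ler_nat//.
Qed.

(** The monotone class consists of the w whose composition with restriction to the cube is in the
    graph closure. Composing keeps all functions local in the same cube, so bounded pointwise limits
    pass through the generator by [generator_cvg_L2]; a local u equals its own composition. *)
Lemma bounded_local_graph_approx n C u : bounded_local n C u -> graph_approx u.
Proof.
move=> [mu' uC lu].
pose V (w : config R d -> R) := [/\ measurable_fun setT w, (exists C, forall g, `|w g| <= C) &
  graph_approx (fun g => w (restr (cube n) g))].
have mr : measurable_fun setT (restr (cube n) : config R d -> config R d).
  by apply: measurable_restr => //; exact: measurable_cube.
have bV (w : config R d -> R) D : measurable_fun setT w -> (forall g, `|w g| <= D) ->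
    bounded_local n D (fun g => w (restr (cube n) g)).
  move=> mw wD; split => //; first exact: measurableT_comp.
  by move=> g; rewrite restr_restr setIid.
suff [_ _] : V u by rewrite (_ : (fun g => _) = u)//; apply/funext => g; rewrite -lu.
apply: (monotone_class (V := V) _ _ _ mu' uC).
- move=> k f t b tf.
  pose S (F : 'I_k -> 'rV[R]_d -> R) g : R := \prod_i sigmoid (t i * pairing (F i) g + b i).
  have S1 F g : `|S F g| <= 1.
    rewrite /S normr_prod; apply: prodr_ile1 => i _.
    by rewrite normr_ge0 ger0_norm ltW ?sigmoid_gt0 ?sigmoid_lt1.
  split.
  + by apply: cylinder_measurable; exact: cylinder_sigmoids.
  + by exists 1 => g; exact: S1.
  (* Restriction to the cube amounts to multiplying the test functions by its indicator, which is
     not continuous. The cutoffs restore continuity, so the approximants are cylinder functions. *)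
  have tfc j i : test_fun (fun x => cutoff n j x * f i x).
    apply: (bsupp_test_fun (n := n)).
      by apply: continuous_mul_rV => //; have [] := tf i.
    by move=> x; rewrite mulf_eq0 negb_or => /andP[+ _]; exact: bsupp_cutoff.
  have cS j : cylinder (S (fun i x => cutoff n j x * f i x)) by exact: cylinder_sigmoids.
  apply: (graph_approx_lim (n := n) (C := 1) (u_ := fun j => S (fun i x => cutoff n j x * f i x))).
  + move=> j; split; [exact: cylinder_measurable|exact: S1|].
    have PL i : local n (pairing (fun x => cutoff n j x * f i x)).
      by apply: pairing_local => x; rewrite mulf_eq0 negb_or => /andP[+ _]; exact: bsupp_cutoff.
    move=> g; rewrite /S; apply: eq_bigr => i _.
    by have -> := PL i g.
  + by move=> j; exact: cylinder_graph_approx.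
  + move=> g; rewrite /S /=.
    apply: cvg_big => [|i _]; first exact: mul_continuous.
    apply: continuous_cvg.
      apply: differentiable_continuous; apply/derivable1_diffP.
      by have [] := is_derive_sigmoid (t i * pairing (f i) (restr (cube n) g) + b i).
    apply: cvgD; last exact: cvg_cst.
    apply: cvgM; first exact: cvg_cst.
    rewrite pairing_restr; apply: (pairing_cvg (n := n)).
    * by move=> j x; rewrite mulf_eq0 negb_or => /andP[+ _]; exact: bsupp_cutoff.
    * move=> x; apply: contraNP => nx; rewrite indicE memNset// mul0r//.
    * by move=> x; apply: cvgM; [exact: cvg_cutoff|exact: cvg_cst].
- move=> a w w' [mw [D wD] aw] [mw' [D' wD'] aw']; split.
  + by apply: measurable_funD => //; exact: measurable_funM.
  + by exists (`|a| * D + D') => g; rewrite (le_trans (ler_normD _ _))// lerD// normrM ler_wpM2l.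
  + have [E [b1 b2]] := bounded_local_pair (bV _ _ mw wD) (bV _ _ mw' wD').
    exact: (graph_approx_lin a b1 b2).
- move=> w_ w D Vw wD ww; split.
  + by apply: (measurable_fun_cvg (h := w_)) => // k; have [] := Vw k.
  + exists D => g; have cn : `|w_ k g| @[k --> \oo] --> `|w g| by exact: cvg_norm.
    rewrite -(cvg_lim (@Rhausdorff R) cn); apply: limr_le; first by apply/cvg_ex; exists `|w g|.
    by apply: nearW => k.
  + apply: (graph_approx_lim (n := n) (C := D) (u_ := fun k g => w_ k (restr (cube n) g))) => //.
    * by move=> k; apply: bV => //; have [] := Vw k.
    * by move=> k; have [] := Vw k.
Qed.

(** Bounded measurable functions are reached by the monotone class theorem, general L^2 functions by
    truncation. *)
Lemma cylinder_dense f e : L2 f -> 0 < e -> exists2 F, cylinder F & nrm (F \- f) < e.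
Proof.
move=> Lf; have mf := L2_measurable Lf; move: e.
pose V (w : config R d -> R) := [/\ measurable_fun setT w, (exists C, forall g, `|w g| <= C) &
  forall e : R, 0 < e -> exists2 F, cylinder F & nrm (F \- w) < e].
have VL2 w : V w -> L2 w by move=> [mw [C wC] _]; exact: L2_bounded wC.
have V_lim0 (w_ : nat -> config R d -> R) (w h : config R d -> R) : (forall k : nat, V (w_ k)) -> L2 w -> L2 h ->
    (forall k g, `|w_ k g| <= h g) -> (forall g, w_ k g @[k --> \oo] --> w g) ->
    forall e : R, 0 < e -> exists2 F, cylinder F & nrm (F \- w) < e.
  move=> Vw Lw Lh wh ww e e0; have e20 : 0 < e / 2 by rewrite divr_gt0.
  have [N hN] : exists N, forall k, (N <= k)%N -> nrm (w_ k \- w) < e / 2.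
    apply: (L2_dominated_cvg (h := h)) => //.
    - by move=> k; have [] := Vw k.
    - exact: L2_measurable Lw.
    - exact: aeW.
    - by apply: aeW => g k; exact: wh.
  have [_ _ /(_ _ e20)[F cF hF]] := Vw N; exists F => //.
  rewrite (splitr e); apply: (le_lt_trans (nrm_sub_trans (cylinder_L2 cF).1 (VL2 _ (Vw N)) Lw)).
  by apply: ltrD => //; exact: hN.
have Vb C (w : config R d -> R) : measurable_fun setT w -> (forall g, `|w g| <= C) -> V w.
  apply: (monotone_class (V := V)).
  - move=> k F t b tf; have cS := cylinder_sigmoids t b tf; split.
    + exact: cylinder_measurable.
    + exact: cylinder_bounded.
    + by move=> e e0; have [G cG []] := cylinder_graph_approx cS e0; exists G.
  - move=> a u v Vu Vv; have [Lu Lv] := (VL2 _ Vu, VL2 _ Vv).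
    have [mu' [D uD] au] := Vu; have [mv [D' vD'] av] := Vv; split.
    + by apply: measurable_funD => //; exact: measurable_funM.
    + by exists (`|a| * D + D') => g; rewrite (le_trans (ler_normD _ _))// lerD// normrM ler_wpM2l.
    + move=> e e0; have e20 : 0 < e / 2 by rewrite divr_gt0.
      have ea : 0 < e / 2 / (1 + `|a|) by rewrite divr_gt0// ltr_pwDl.
      have [F cF F1] := au _ ea; have [G cG G1] := av _ e20.
      exists (fun g => a * F g + G g); first exact: cylinder_lin.
      exact: (nrm_lin_lt (cylinder_L2 cF).1 (cylinder_L2 cG).1).
  - move=> w_ u D Vw wD ww; have mu' : measurable_fun setT u.
      by apply: (measurable_fun_cvg (h := w_)) => // k; have [] := Vw k.
    have uD g : `|u g| <= D.
      have cn : `|w_ k g| @[k --> \oo] --> `|u g| by exact: cvg_norm.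
      rewrite -(cvg_lim (@Rhausdorff R) cn); apply: limr_le; first by apply/cvg_ex; exists `|u g|.
      by apply: nearW => k.
    split; [exact: mu'|by exists D|].
    apply: (V_lim0 w_ u (cst D)) => //; first exact: L2_bounded uD.
    by apply: (@L2_bounded _ _ _ D) => // g; rewrite ger0_norm// (le_trans _ (uD point)).
(* Truncation of f at levels - k and k, dominated by |f| and eventually equal to f at each
   configuration. *)
apply: (V_lim0 (fun k g => Num.max (- k%:R) (Num.min k%:R (f g))) f (fun g => `|f g|)) => //.
- move=> k; apply: (Vb k%:R).
    by apply: measurable_maxr => //; apply: measurable_minr.
  move=> g; rewrite ler_norml le_max lexx/= ge_max ge_min lexx/= andbT.
  by rewrite (@le_trans _ _ 0)// oppr_le0.
- by apply: (L2_dominated _ Lf) => [|g]; [exact: measurableT_comp|rewrite normr_id].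
- move=> k g; have k0 : (0 : R) <= k%:R by [].
  have : - `|f g| <= f g <= `|f g| by rewrite -ler_norml.
  have n0 := normr_ge0 (f g).
  rewrite ler_norml le_max ge_max le_min ge_min; move=> /andP[h1 h2].
  apply/andP; split; [apply/orP; right|]; apply/andP; split; try lra.
move=> g; apply: cvg_near_cst; exists (Num.bound `|f g|) => // k /= Nk.
have hk : `|f g| <= k%:R.
  by rewrite (le_trans (ltW (archi_boundP _)))// ler_nat.
move: hk; rewrite ler_norml => /andP[h1 h2].
by rewrite (min_idPr h2) (max_idPr h1).
Qed.

Local Notation H := (operatorH z phi mu).

Lemma operatorH_lin_closed : lin_closed H.
Proof.
move=> a p q r [F [cF F1 F2]] [G [cG G1 G2]] r1 r2.
exists (fun g => a * F g + G g); split; first exact: cylinder_lin.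
- by apply: filterS3 r1 F1 G1 => g /(_ I) -> /(_ I) -> /(_ I) ->.
have [m [D bF]] := cylinder_bounded_local cF; have [m' [D' bG]] := cylinder_bounded_local cG.
have [k [E [bF' bG']]] := bounded_local_max bF bG.
apply: filterS3 r2 F2 G2 => g /(_ I) -> /(_ I) -> /(_ I) -> _.
by rewrite (generator_lin phi_pot phi_ge0 z_gt0 a g bF' bG').
Qed.

Let ipH (p q : LspaceType2 mu * LspaceType2 mu) F G : cylinder F -> cylinder G -> fct p.1 = F %[ae mu] ->
  fct p.2 = gen F %[ae mu] -> fct q.1 = G %[ae mu] -> fct q.2 = gen G %[ae mu] ->
  [/\ ip mu (fct p.2) (fct q.1) = ip mu (gen F) G,
      ip mu (fct p.1) (fct q.2) = ip mu F (gen G) &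
      ip mu (gen F) G = ip mu F (gen G)].
Proof.
move=> cF cG F1 F2 G1 G2; have [[LF LgF] [LG LgG]] := (cylinder_L2 cF, cylinder_L2 cG).
split; [by apply: ip_ae => //; exact: L2_fct|by apply: ip_ae => //; exact: L2_fct|].
have [m [D bF]] := cylinder_bounded_local cF; have [m' [D' bG]] := cylinder_bounded_local cG.
have [k [E [bF' bG']]] := bounded_local_max bF bG.
exact: (ip_generatorC d_gt0 phi_pot phi_ge0 z_gt0 mu_gibbs bF' bG').
Qed.

Lemma operatorH_symmetric : symmetric_op H.
Proof.
move=> p q [F [cF F1 F2]] [G [cG G1 G2]].
by have [-> -> ->] := ipH cF cG F1 F2 G1 G2.
Qed.

Lemma operatorH_nonnegative : nonnegative_op H.
Proof.
move=> p [F [cF F1 F2]]; have [-> _ _] := ipH cF cF F1 F2 F1 F2.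
have [m [D bF]] := cylinder_bounded_local cF.
exact: (ip_generator_ge0 d_gt0 phi_pot phi_ge0 z_gt0 mu_gibbs bF).
Qed.

Lemma operatorH_ex F : cylinder F ->
  exists p : LspaceType2 mu * LspaceType2 mu,
    [/\ H p, fct p.1 = F %[ae mu] & fct p.2 = gen F %[ae mu]].
Proof.
move=> cF; have [LF LgF] := cylinder_L2 cF.
have [u uF] := L2_fct_ex LF; have [v vF] := L2_fct_ex LgF.
by exists (u, v); split => //; exists F.
Qed.

Lemma operatorH_dense : densely_defined H.
Proof.
apply/densely_definedP => u e e0; have [F cF hF] := cylinder_dense (L2_fct u) e0.
have [p [Hp p1 _]] := operatorH_ex cF; exists p => //.
rewrite (nrm_ae _ _ (g := F \- fct u))//.
- by apply: L2_B; exact: L2_fct.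
- by apply: L2_B; [exact: (cylinder_L2 cF).1|exact: L2_fct].
- by apply: filterS p1 => g /(_ I) h _ /=; rewrite h.
Qed.

(** Three errors of size e / 3: w is replaced by a cylinder F, the equation is solved up to an error
    with a bounded local u, and u is replaced by a cylinder G in graph norm. *)
Lemma operatorH_range lam : 0 < lam ->
  (forall F e, cylinder F -> 0 < e -> exists n C u,
     bounded_local n C u /\ nrm ((fun g => lam * u g + gen u g) \- F) < e) ->
  forall (w : LspaceType2 mu) e, 0 < e -> exists2 q, H q & nrm ((fun g => lam * fct q.1 g + fct q.2 g) \- fct w) < e.
Proof.
move=> lam0 hR w e e0; have e30 : 0 < e / 3 by rewrite divr_gt0.
have [F cF hF] := cylinder_dense (L2_fct w) e30.
have [n [C [u [bu hu]]]] := hR _ _ cF e30.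
have e60 : 0 < e / 3 / 2 by rewrite divr_gt0.
have ea : 0 < e / 3 / 2 / (1 + `|lam|) by rewrite divr_gt0// ltr_pwDl.
have [G cG [G1 G2']] := bounded_local_graph_approx bu ea.
have G2 : nrm (gen G \- gen u) < e / 3 / 2.
  by apply: (lt_le_trans G2'); rewrite ler_pdivrMr ?ltr_pwDl//; apply: ler_peMr; [exact: ltW|rewrite lerDl].
have [p [Hp p1 p2]] := operatorH_ex cG; exists p => //.
have [LF _] := cylinder_L2 cF; have [LG LgG] := cylinder_L2 cG.
have Lu := L2_bounded_local mu bu.
have Lgu := L2_generator phi_pot phi_ge0 z_gt0 mu_gibbs bu.
have LB f f' : L2 f -> L2 f' -> L2 (fun g => lam * f g + f' g) by move=> ? ?; exact: L2_lin.
have Lw := L2_fct w.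
rewrite (nrm_ae _ _ (g := (fun g => lam * G g + gen G g) \- fct w)).
- apply: (le_lt_trans (nrm_sub_trans (LB _ _ LG LgG) LF Lw)).
  apply: (le_lt_trans (lerD (nrm_sub_trans (LB _ _ LG LgG) (LB _ _ Lu Lgu) LF) (lexx _))).
  have h : nrm ((fun g => lam * G g + gen G g) \- (fun g => lam * u g + gen u g)) < e / 3.
    exact: nrm_lin_lt.
  have E : e / 3 + e / 3 + e / 3 = e by lra.
  by rewrite -[ltRHS]E; exact: ltrD (ltrD h hu) hF.
- by apply: L2_B => //; apply: LB; exact: L2_fct.
- by apply: L2_B => //; exact: LB.
- by apply: filterS2 p1 p2 => g /(_ I) h1 /(_ I) h2 _ /=; rewrite h1 h2.
Qed.

End core.

(** * The resolvent equation *)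

Section majorant.
Context {R : realType} {d : nat}.
Variables (k : 'rV[R]_d -> R) (z D : R) (m : nat).
Hypothesis mk : measurable_fun setT k.
Hypothesis k0 : forall x, 0 <= k x.
Hypothesis kN : forall x, k (- x) = k x.
Local Notation leb := (lebesgue_rV d : {measure set 'rV[R]_d -> \bar R}).
Hypothesis int_k : (\int[leb]_x (k x)%:E < +oo)%E.
Hypotheses (z0 : 0 <= z) (D0 : 0 <= D).
Implicit Types x y : 'rV[R]_d.

Let K := \int[leb]_x k x.
Let lam := 1 + z * K.

Let K0 : 0 <= K. Proof. by apply: Rintegral_ge0. Qed.

Let lam_gt0 : 0 < lam. Proof. by rewrite ltr_pwDl// mulr_ge0. Qed.

Let mkE : measurable_fun setT (EFin \o k). Proof. exact/measurable_EFinP. Qed.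

Let EFin_K : (\int[leb]_x (k x)%:E = K%:E)%E.
Proof.
rewrite /K /Rintegral fineK// ge0_fin_numE//; apply: integral_ge0 => x _.
by rewrite lee_fin.
Qed.

Lemma integral_shiftr x : (\int[leb]_y (k (y - x))%:E = K%:E)%E.
Proof. by rewrite -EFin_K (lebesgue_rV_shift (- x) (f := EFin \o k))// => v; rewrite lee_fin. Qed.

Lemma integral_shiftl y : (\int[leb]_x (k (y - x))%:E = K%:E)%E.
Proof.
by rewrite -(integral_shiftr y); apply: eq_integral => x _; rewrite -kN opprB.
Qed.

Let conv (f : 'rV[R]_d -> \bar R) x : \bar R := (\int[leb]_y ((k (y - x))%:E * f y))%E.

Let mconv2 f : measurable_fun setT f ->
  measurable_fun setT (fun p : 'rV[R]_d * 'rV[R]_d => (k (p.2 - p.1))%:E * f p.2)%E.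
Proof.
move=> mf; apply: emeasurable_funM; last exact: measurableT_comp.
by apply: (measurableT_comp mkE); apply: measurable_funB_rV.
Qed.

Let mshift (a b : 'rV[R]_d -> 'rV[R]_d) : measurable_fun setT a -> measurable_fun setT b ->
  measurable_fun setT (fun y => (k (a y - b y))%:E).
Proof. by move=> ma mb; exact: (measurableT_comp mkE (measurable_funB_rV ma mb)). Qed.

Let mconv1 f x : measurable_fun setT f -> measurable_fun setT (fun y => (k (y - x))%:E * f y)%E.
Proof. by move=> mf; exact: (measurableT_comp (mconv2 mf) (measurable_pair1 x)). Qed.

Let conv_ge0 f x : (forall y, 0 <= f y)%E -> (0 <= conv f x)%E.
Proof. by move=> f0; apply: integral_ge0 => y _; rewrite mule_ge0// lee_fin. Qed.

Let measurable_conv f : measurable_fun setT f -> (forall y, 0 <= f y)%E -> measurable_fun setT (conv f).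
Proof.
move=> mf f0; have h p : (0 <= (k (p.2 - p.1))%:E * f p.2)%E by rewrite mule_ge0// lee_fin.
exact: (measurable_fun_fubini_tonelli_F (m2 := lebesgue_rV d) _ (mconv2 mf) h).
Qed.

Let le_conv f h x : measurable_fun setT f -> measurable_fun setT h -> (forall y, 0 <= f y)%E ->
  (forall y, f y <= h y)%E -> (conv f x <= conv h x)%E.
Proof.
move=> mf mh f0 fh; apply: ge0_le_integral => //.
- by move=> y _; rewrite mule_ge0// lee_fin.
- exact: mconv1.
- exact: mconv1.
- by move=> y _; rewrite lee_wpmul2l// lee_fin.
Qed.

Let conv_le f x : measurable_fun setT f -> (forall y, 0 <= f y)%E -> (forall y, f y <= D%:E)%E ->
  (conv f x <= (K * D)%:E)%E.
Proof.
move=> mf f0 fD; apply: (le_trans (le_conv x mf (measurable_cst D%:E) f0 fD)).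
have mkx : measurable_fun setT (fun y => (k (y - x))%:E) by apply: mshift.
have kx0 y : [set: 'rV[R]_d] y -> (0 <= (k (y - x))%:E)%E by rewrite lee_fin.
by rewrite /conv ge0_integralZr// integral_shiftr EFinM.
Qed.

Let integral_conv f : measurable_fun setT f -> (forall y, 0 <= f y)%E ->
  (\int[leb]_x conv f x = K%:E * \int[leb]_x f x)%E.
Proof.
move=> mf f0; have h p : (0 <= (k (p.2 - p.1))%:E * f p.2)%E by rewrite mule_ge0// lee_fin.
rewrite /conv (fubini_tonelli (m1 := lebesgue_rV d) (m2 := lebesgue_rV d) _ (mconv2 mf) h)/=.
rewrite -ge0_integralZl//.
apply: eq_integral => y _.
have mky : measurable_fun setT (fun x => (k (y - x))%:E) by apply: mshift.
have ky0 x : [set: 'rV[R]_d] x -> (0 <= (k (y - x))%:E)%E by rewrite lee_fin.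
by rewrite ge0_integralZr// integral_shiftl.
Qed.

Let g0 : 'rV[R]_d -> \bar R := EFin \o cst_cube m D.

Let step f x : \bar R := ((lam^-1)%:E * (g0 x + z%:E * conv f x))%E.

(* [lam] is chosen so that [(D + z K D) / lam = D]: the bound [D] is stable under [step]. *)
Fixpoint picard j : 'rV[R]_d -> \bar R := if j is j'.+1 then step (picard j') else cst 0%E.

Let mg0 : measurable_fun setT g0.
Proof. by apply/measurable_EFinP; exact: measurable_cst_cube. Qed.

Let g0_ge0 x : (0 <= g0 x)%E. Proof. by rewrite lee_fin cst_cube_ge0. Qed.

Let li0 : (0 <= (lam^-1)%:E)%E. Proof. by rewrite lee_fin invr_ge0 ltW. Qed.

Let picardP j : measurable_fun setT (picard j) /\ forall x, (0 <= picard j x)%E.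
Proof.
elim: j => [|j [mj pj]]; first by split => //; exact: measurable_cst.
split=> [|x]; last by rewrite /= mule_ge0// adde_ge0// mule_ge0// conv_ge0.
apply: emeasurable_funM; first exact: measurable_cst.
apply: emeasurable_funD => //; apply: emeasurable_funM; first exact: measurable_cst.
exact: measurable_conv.
Qed.

Let picard_le j x : (picard j x <= D%:E)%E.
Proof.
elim: j x => [|j ih] x; first by rewrite lee_fin.
have [mj pj] := picardP j; rewrite /= lee_pdivrMl// -EFinM.
have -> : (lam * D = D + z * (K * D))%R by rewrite /lam; ring.
rewrite EFinD EFinM leeD ?lee_fin ?cst_cube_le//.
by rewrite EFinM lee_wpmul2l// conv_le.
Qed.

Let picard_nd x : nondecreasing_seq (picard^~ x).
Proof.
apply/nondecreasing_seqP => j; elim: j x => [|j ih] x; first exact: (picardP 1).2.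
have [mj pj] := picardP j; have [mj1 _] := picardP j.+1.
by rewrite lee_wpmul2l// leeD2l// lee_wpmul2l// le_conv.
Qed.

Let I := (\int[leb]_x g0 x)%E.

(** The choice of lam works for integrals as for the sup bound: convolution multiplies the integral
    by K, and (I + z K I) / lam = I. *)
Let integral_picard j : (\int[leb]_x picard j x <= I)%E.
Proof.
have I0 : (0 <= I)%E by apply: integral_ge0.
have fI : I \is a fin_num by rewrite ge0_fin_numE//; exact: integral_cst_cube.
elim: j => [|j ih]; first by rewrite integral0.
have [mj pj] := picardP j; have mc := measurable_conv mj pj.
rewrite /= ge0_integralZl//; last 2 first.
- by apply: emeasurable_funD => //; apply: emeasurable_funM => //; exact: measurable_cst.
- by move=> x _; rewrite adde_ge0// mule_ge0// conv_ge0.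
rewrite ge0_integralD//; last 2 first.
- by move=> x _; rewrite mule_ge0// conv_ge0.
- by apply: emeasurable_funM => //; exact: measurable_cst.
rewrite ge0_integralZl//; last by move=> x _; exact: conv_ge0.
rewrite integral_conv// lee_pdivrMl// /lam EFinD ge0_muleDl//; last first.
  by rewrite lee_fin mulr_ge0.
rewrite mul1e leeD// EFinM -muleA lee_wpmul2l// lee_wpmul2l// lee_fin//.
Qed.

(** Picard iteration from 0 increases, so monotone convergence passes to the limit in the
    convolution and yields a fixed point of [step]; the sup and integral bounds of the iterates are
    inherited. *)
Lemma majorant_ex : exists f : 'rV[R]_d -> R, [/\ measurable_fun setT f,
  forall x, 0 <= f x <= D, (\int[leb]_x (f x)%:E < +oo)%E &
  forall x, cst_cube m D x + z * \int[leb]_y (k (y - x) * f y) <= lam * f x].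
Proof.
pose f x := limn (picard^~ x).
have cf x : picard^~ x @ \oo --> f x by exact: ereal_nondecreasing_is_cvgn (@picard_nd x).
have mf : measurable_fun setT f.
  by apply: (emeasurable_fun_cvg picard) => [j|x _]; [exact: (picardP j).1|exact: cf].
have f0 x : (0 <= f x)%E by apply: lime_ge; [exact: cf|apply: nearW => j; exact: (picardP j).2].
have fD x : (f x <= D%:E)%E by apply: lime_le; [exact: cf|exact: nearW].
have fE x : ((fine (f x))%:E = f x)%E.
  by rewrite fineK// ge0_fin_numE// (le_lt_trans (fD x))// ltry.
have If : (\int[leb]_x f x <= I)%E.
  rewrite /f (monotone_convergence leb measurableT (fun j => (picardP j).1)
    (fun j x _ => (picardP j).2 x) (fun x _ => @picard_nd x)).
  apply: lime_le; last exact: nearW.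
  apply: ereal_nondecreasing_is_cvgn => i j ij; apply: ge0_le_integral => //.
  - by move=> x _; exact: (picardP i).2.
  - exact: (picardP i).1.
  - exact: (picardP j).1.
  - by move=> x _; exact: picard_nd.
have cc x : conv (picard j) x @[j --> \oo] --> conv f x.
  have := @cvg_monotone_convergence _ _ R leb setT measurableT
    (fun j y => (k (y - x))%:E * picard j y)%E.
  rewrite (_ : (\int[leb]_y _)%E = conv f x); last first.
    apply: eq_integral => y _; rewrite limeMl//; exact/cvg_ex; exists (f y); exact: cf.
  apply.
  - by move=> j; apply: mconv1; exact: (picardP j).1.
  - by move=> j y _; rewrite mule_ge0 ?lee_fin//; exact: (picardP j).2.
  - by move=> y _ i j ij; rewrite lee_wpmul2l ?lee_fin//; exact: picard_nd.
have cs x : step (picard j) x @[j --> \oo] --> step f x.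
  apply: cvgeZl => //; apply: cvgeD; first by rewrite fin_num_adde_defr.
    exact: cvg_cst.
  exact: cvgeZl (cc x).
have ff x : f x = step f x.
  apply: (cvg_unique (@ereal_hausdorff R) _ (cs x)).
  by have := cf x; rewrite -(cvg_shiftS (picard^~ x)).
exists (fun x => fine (f x)); split.
- exact: measurableT_comp.
- by move=> x; rewrite -!lee_fin fE f0 fD.
- rewrite (eq_integral f); last by move=> x _; rewrite fE.
  by apply: (le_lt_trans If); exact: integral_cst_cube.
- move=> x; rewrite -lee_fin EFinD [(z * _)%:E]EFinM [(lam * _)%:E]EFinM fE ff /step muleA -[(lam%:E * _)%E]EFinM mulfV ?gt_eqF// mul1e.
  rewrite leeD// lee_wpmul2l//.
  have cE : conv f x = (\int[leb]_y (k (y - x) * fine (f y))%:E)%E.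
    by apply: eq_integral => y _; rewrite EFinM fE.
  rewrite cE fineK// -cE ge0_fin_numE ?conv_ge0//.
  by apply: le_lt_trans (conv_le _ mf f0 fD) _; rewrite ltry.
Qed.

End majorant.

(** * Approximate resolvent of the bounded generator in a cube *)

Section finite_volume_resolvent.
Context {R : realType} {d : nat}.
Variables (phi : 'rV[R]_d -> \bar R) (z : R).
Hypothesis phi_pot : pair_potential phi.
Hypothesis phi_ge0 : forall x, (0 <= phi x)%E.
Hypothesis z_gt0 : 0 < z.
Implicit Types (g : config R d) (x y : 'rV[R]_d) (u v : config R d -> R).
Local Notation bw := (bw phi).
Local Notation pw := (pw phi).
Local Notation leb := (lebesgue_rV d : {measure set 'rV[R]_d -> \bar R}).
Variables (F : config R d -> R) (m n : nat) (C lam : R) (Delta : 'rV[R]_d -> R).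
Hypothesis mn : (m <= n)%N.
Hypothesis bF : bounded_local m C F.
Hypothesis lam_gt0 : 0 < lam.
Hypotheses (mDelta : measurable_fun setT Delta) (Delta_ge0 : forall x, 0 <= Delta x).
Hypothesis Delta_le : forall x, Delta x <= 2 * C.
Hypothesis majorant : forall x,
  cst_cube m (2 * C) x + z * \int[leb]_y ((1 - pw (y - x)) * Delta y) <= lam * Delta x.
Hypothesis int_k : (\int[leb]_x (1 - pw x)%:E < +oo)%E.

Let C0 : 0 <= C. Proof. exact: bounded_local_ge0 bF. Qed.

Let one y : R := \1_(cube n) y.

Let one_ge0 y : 0 <= one y. Proof. by rewrite /one indicE. Qed.

Let mone : measurable_fun setT one.
Proof. by apply: measurable_indic; exact: measurable_cube. Qed.

Let int_one (h : 'rV[R]_d -> R) B : measurable_fun setT h -> (forall y, `|h y| <= B) ->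
  leb.-integrable setT (EFin \o (fun y => one y * h y)).
Proof.
move=> mh hB; have B0 : 0 <= B := le_trans (normr_ge0 _) (hB 0).
apply: (integrable_abs_le _ (measurable_cst_cube n B) (integral_cst_cube _ B0)).
  exact: measurable_funM.
by move=> y; rewrite normrM ger0_norm// mulrC /cst_cube ler_wpM2r.
Qed.

Definition vol := \int[leb]_y one y.

Let int_one1 (a : R) : leb.-integrable setT (EFin \o (fun y => one y * a)).
Proof. exact: (@int_one (cst a) `|a|). Qed.

Let int_one_cst a : \int[leb]_y (one y * a) = vol * a.
Proof.
rewrite RintegralZr//.
have := int_one1 1; rewrite (_ : (fun y => one y * 1) = one)//.
by apply/funext => y; rewrite mulr1.
Qed.

Let vol_ge0 : 0 <= vol. Proof. by apply: Rintegral_ge0. Qed.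

Definition bn y g := z * bw y (restr (cube n) g).

Let bn_ge0 y g : 0 <= bn y g. Proof. exact: z_bw_ge0. Qed.
Let bn_le y g : bn y g <= z. Proof. exact: z_bw_le. Qed.
Let z_bn_ge0 y g : 0 <= z - bn y g. Proof. by rewrite subr_ge0. Qed.

Let mrestr : measurable_fun setT (restr (cube n) : config R d -> config R d).
Proof. by apply: measurable_restr => //; exact: measurable_cube. Qed.

Let mbn : measurable_fun setT (fun p : config R d * 'rV[R]_d => bn p.2 p.1).
Proof. by apply: measurable_z_bw => //; exact: measurableT_comp. Qed.

(** Uniformization: at each site a clock rings at rate z; with rate [bn] a point is born, with the
    remaining rate nothing happens. The total rate then does not depend on the configuration. *)
Let brate u (p : config R d * 'rV[R]_d) :=
  one p.2 * ((z - bn p.2 p.1) * u p.1 + bn p.2 p.1 * u (addp p.1 p.2)).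

Let mbrate u : measurable_fun setT u -> measurable_fun setT (brate u).
Proof.
move=> mu; apply: measurable_funM; first exact: measurableT_comp.
apply: measurable_funD; apply: measurable_funM => //.
- by apply: measurable_funB.
- exact: measurableT_comp.
- exact: measurable_u_addp.
Qed.

Definition jumps u g := \int[leb]_y brate u (g, y) +
  \sum_(c : cells n) u (restr (~` @cell R d n c) g).

Definition rate := z * vol + #|{: cells (d := d) n}|%:R.

Let rate_ge0 : 0 <= rate. Proof. by rewrite addr_ge0// mulr_ge0// ltW. Qed.

Let int_brate A u g : measurable_fun setT u -> (forall g, `|u g| <= A) ->
  leb.-integrable setT (EFin \o (fun y => brate u (g, y))).
Proof.
move=> mu uA; apply: (@int_one (fun y => (z - bn y g) * u g + bn y g * u (addp g y)) (z * A)).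
  apply: measurable_funD; apply: measurable_funM => //.
  - apply: measurable_funB => //; exact: (measurableT_comp mbn (measurable_pair1 g)).
  - exact: (measurableT_comp mbn (measurable_pair1 g)).
  - exact: (measurableT_comp (measurable_u_addp mu) (measurable_pair1 g)).
move=> y; rewrite (le_trans (ler_normD _ _))// (normrM (z - bn y g)) (normrM (bn y g)) (ger0_norm (z_bn_ge0 _ _)) (ger0_norm (bn_ge0 _ _)).
rewrite (_ : z * A = (z - bn y g) * A + bn y g * A); last by ring.
by rewrite lerD// ler_wpM2l.
Qed.

(** [jumps] is the constant [rate] times an average over the outcomes of a jump, so it is Lipschitz
    in sup norm with that constant. *)
Let jumps_lip A e u v g : measurable_fun setT u -> (forall g, `|u g| <= A) ->
  measurable_fun setT v -> (forall g, `|v g| <= A) -> (forall g, `|u g - v g| <= e) ->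
  `|jumps u g - jumps v g| <= rate * e.
Proof.
move=> mu uA mv vA uv; have e0 : 0 <= e := le_trans (normr_ge0 _) (uv point).
have iu := int_brate g mu uA; have iv := int_brate g mv vA.
rewrite /jumps opprD addrACA -RintegralB// -sumrB (le_trans (ler_normD _ _))// /rate mulrDl.
apply: lerD; last first.
  rewrite (le_trans (ler_norm_sum _ _ _))// -sum1_card natr_sum mulr_suml ler_sum// => c _.
  by rewrite mul1r.
have iuv : leb.-integrable setT (EFin \o (fun y => brate u (g, y) - brate v (g, y))).
  exact: integrableB iu iv.
apply: (le_trans (le_normr_Rintegral _ iuv)) => //.
rewrite -mulrA mulrC -mulrA -int_one_cst; apply: le_Rintegral => //.
- exact: integrable_norm iuv.
move=> y _; rewrite /brate -mulrBr normrM ger0_norm//= ler_wpM2l//.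
rewrite (_ : _ - _ = (z - bn y g) * (u g - v g) + bn y g * (u (addp g y) - v (addp g y))); last by ring.
rewrite (le_trans (ler_normD _ _))// (normrM (z - bn y g)) (normrM (bn y g)) (ger0_norm (z_bn_ge0 _ _)) (ger0_norm (bn_ge0 _ _)).
rewrite (_ : e * z = (z - bn y g) * e + bn y g * e); last by ring.
by rewrite lerD// ler_wpM2l.
Qed.

Let mjumps u : measurable_fun setT u -> measurable_fun setT (jumps u).
Proof.
move=> mu; apply: measurable_funD.
  exact: (measurable_Rintegral_param (lebesgue_rV d) (mbrate mu)).
apply: measurable_sum => c; apply: measurableT_comp mu _; apply: measurable_restr => //.
by apply: measurableC; exact: measurable_cell.
Qed.

Let local_jumps u : local n u -> local n (jumps u).
Proof.
move=> lu g; congr (_ + _).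
  apply: eq_Rintegral => y _; rewrite /brate /= /bn restr_restr setIid /one.
  have [yn|yn] := pselect (cube n y); last by rewrite indicE memNset// !mul0r.
  by rewrite (lu g) (lu (addp g y)) restr_addp_in.
apply: eq_bigr => c _; rewrite [LHS]lu [RHS]lu !restr_restr; congr (u (restr _ g)).
by apply/seteqP; split => y /=; tauto.
Qed.

Let pw_ge0 x : 0 <= pw x. Proof. by have /andP[] := pw_itv phi_ge0 x. Qed.
Let pw_le1 x : pw x <= 1. Proof. by have /andP[] := pw_itv phi_ge0 x. Qed.

Let mkx x : measurable_fun setT (fun y => 1 - pw (y - x)).
Proof.
apply: measurable_funB => //.
have h : measurable_fun setT (fun y => y - x) by exact: measurable_funB_rV.
exact: (measurableT_comp (measurable_pw phi_pot phi_ge0) h).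
Qed.

Let int_kDelta x : leb.-integrable setT (EFin \o (fun y => (1 - pw (y - x)) * Delta y)).
Proof.
have mk : measurable_fun setT (fun x => 1 - pw x).
  by apply: measurable_funB => //; exact: measurable_pw.
have ik : leb.-integrable setT (EFin \o (fun y => 1 - pw (y - x))).
  apply: (integrable_abs_le (mkx x) (mkx x)); last by move=> y; rewrite ger0_norm ?subr_ge0.
  by rewrite (integral_shiftr mk _ int_k) ?ltry// => y; rewrite subr_ge0.
apply: (le_integrable measurableT _ _ (integrableZl measurableT (2 * C) ik)).
  by apply/measurable_EFinP; exact: measurable_funM.
move=> y _ /=; rewrite lee_fin mulrC [leLHS]normrM [leRHS]normrM.
by rewrite ler_wpM2r// !ger0_norm ?mulr_ge0.
Qed.

(** The jumps from g and g + x are coupled. Emptying a cell leaves the two configurations differing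
    by x or makes them equal. At a site y, with b the birth rate from g: a point is born in both at
    rate p b, only in g at rate (1 - p) b, in neither at rate z - b. Only the middle event costs
    more than Delta x, namely an additional Delta y, and b <= z bounds its rate. *)
Let jumps_incr A u g x : measurable_fun setT u -> (forall g, `|u g| <= A) ->
  (forall g x, `|u (addp g x) - u g| <= Delta x) -> ~ points g x -> cube n x ->
  `|jumps u (addp g x) - jumps u g| <=
    z * \int[leb]_y ((1 - pw (y - x)) * Delta y) + rate * Delta x.
Proof.
move=> mu uA incr gx xn.
have i1 := int_brate (addp g x) mu uA; have i2 := int_brate g mu uA.
rewrite /jumps opprD addrACA -RintegralB// -sumrB (le_trans (ler_normD _ _))// /rate mulrDl addrA.
apply: lerD; last first.
  rewrite (le_trans (ler_norm_sum _ _ _))// -sum1_card natr_sum mulr_suml ler_sum// => c _.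
  rewrite mul1r; have [xc|xc] := pselect (cell c x).
    by rewrite restr_addp_out ?subrr ?normr0//; exact.
  by rewrite restr_addp_in.
have i12 : leb.-integrable setT (EFin \o (fun y => brate u (addp g x, y) - brate u (g, y))).
  exact: integrableB i1 i2.
apply: (le_trans (le_normr_Rintegral _ i12)) => //.
have izk : leb.-integrable setT (EFin \o (fun y => z * ((1 - pw (y - x)) * Delta y))).
  by apply: (integrableZl measurableT z) (int_kDelta x).
rewrite -mulrA [z * (vol * _)]mulrCA -int_one_cst -(RintegralZl _ _ (int_kDelta x))// -RintegralD//.
apply: le_Rintegral => //; first exact: integrable_norm i12.
  exact: (integrableD measurableT izk (int_one1 (z * Delta x))).
move=> y _; rewrite /brate -mulrBr normrM ger0_norm//=.
set p := pw (y - x); have p0 : 0 <= p := pw_ge0 _; have p1 : p <= 1 := pw_le1 _.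
have bE : bn y (addp g x) = p * bn y g.
  by rewrite /bn restr_addp_in// bw_addp//; [rewrite mulrCA|move=> []].
(* A new point at [x] multiplies the birth rate [b] at [y] by [p]. *)
rewrite bE; have b0 := bn_ge0 y g; have bz := bn_le y g; set b := bn y g in b0 bz *.
rewrite (_ : _ - _ = (z - b) * (u (addp g x) - u g) +
  (p * b) * (u (addp (addp g x) y) - u (addp g y)) +
  ((1 - p) * b) * (u (addp g x) - u (addp g y))); last by ring.
have D0 := Delta_ge0 x; have Dy := Delta_ge0 y.
have h3 : `|u (addp g x) - u (addp g y)| <= Delta x + Delta y.
  rewrite (_ : _ - _ = (u (addp g x) - u g) - (u (addp g y) - u g)); last by ring.
  by rewrite (le_trans (ler_normB _ _))// lerD.
have h2 : `|u (addp (addp g x) y) - u (addp g y)| <= Delta x by rewrite addpC.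
have kb : 0 <= (1 - p) * b by rewrite mulr_ge0// subr_ge0.
have pb : 0 <= p * b by exact: mulr_ge0.
have H : `|(z - b) * (u (addp g x) - u g) + p * b * (u (addp (addp g x) y) - u (addp g y)) +
    (1 - p) * b * (u (addp g x) - u (addp g y))| <= z * Delta x + z * ((1 - p) * Delta y).
  apply: (le_trans (ler_normD _ _)); apply: (le_trans (lerD (ler_normD _ _) (lexx _))).
  rewrite (normrM (z - b)) (normrM (p * b)) (normrM ((1 - p) * b)) (ger0_norm (z_bn_ge0 _ _)).
  rewrite (ger0_norm kb) (ger0_norm pb).
  apply: (@le_trans _ _ ((z - b) * Delta x + p * b * Delta x + (1 - p) * b * (Delta x + Delta y))).
    by rewrite !lerD// ler_wpM2l// ?mulr_ge0// subr_ge0.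
  rewrite (_ : _ + _ = z * Delta x + b * ((1 - p) * Delta y)); last by ring.
  by rewrite lerD2l ler_wpM2r// mulr_ge0// subr_ge0.
apply: (le_trans (ler_wpM2l (one_ge0 y) H)).
rewrite mulrDr [X in X + _ <= _](_ : _ = one y * (z * Delta x))// [leRHS]addrC lerD2l.
apply: ler_piMl; last by rewrite /one indicE lern1 leq_b1.
by apply: mulr_ge0; [exact: ltW|rewrite mulr_ge0// subr_ge0].
Qed.

(** As H_n u = rate u - jumps u, the fixed points of this map are the solutions of (lam + H_n) u =
    F. *)
Definition relax u g := (F g + jumps u g) / (lam + rate).

Definition iterate j := iter j relax (cst 0).

Let lr_gt0 : 0 < lam + rate. Proof. by rewrite ltr_wpDr. Qed.

(** Both bounds are stable under [relax]: (C + rate C / lam) / (lam + rate) = C / lam for the sup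
    norm, and for increments [jumps_incr] with the inequality [majorant] gives at most (lam + rate)
    Delta before division. Increments vanish for x in g, and for x outside the cube by locality. *)
Let iterateP j : bounded_local n (C / lam) (iterate j) /\
  forall g x, `|iterate j (addp g x) - iterate j g| <= Delta x.
Proof.
have [mF FC lF] := bF; have Cl0 : 0 <= C / lam by rewrite divr_ge0// ltW.
elim: j => [|j [[mj jC lj] ij]].
  split; first by split => [|g|//]; [exact: measurable_cst|rewrite normr0].
  by move=> g x; rewrite subrr normr0.
rewrite /= -/(iterate j); set u := iterate j in mj jC lj ij *.
have bu : bounded_local n (C / lam) (relax u).
  split.
  - apply: measurable_funM => //; apply: measurable_funD => //; exact: mjumps.
  - move=> g; rewrite /relax normrM normfV (gtr0_norm lr_gt0) ler_pdivrMr//.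
    (* Comparison with the zero function turns the Lipschitz bound into a bound on |jumps u|. *)
    have := @jumps_lip (C / lam) (C / lam) u (cst 0) g mj jC _ _ _.
    have -> : jumps (cst 0) g = 0.
      rewrite /jumps big1// addr0 /brate /= (@eq_Rintegral _ _ _ _ _ (cst 0)).
        by rewrite Rintegral_cst// mul0r.
      by move=> y _; rewrite !mulr0 addr0 mulr0.
    rewrite subr0 => h; rewrite (le_trans (ler_normD _ _))// mulrDr.
    rewrite lerD ?divfK ?gt_eqF// mulrC; apply: h => //.
    + by move=> g'; rewrite normr0.
    + by move=> g'; rewrite subr0.
  - move=> g; rewrite /relax (local_jumps lj g); congr ((_ + _) / _).
    exact: (le_local mn lF).
split => // g x.
have [gx|gx] := pselect (points g x); first by rewrite addp_in// subrr normr0.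
have [xn|xn] := pselect (cube n x); last first.
  by have [_ _ lu] := bu; rewrite (local_addp g lu xn) subrr normr0.
rewrite /relax -mulrBl normrM normfV (gtr0_norm lr_gt0) ler_pdivrMr//.
rewrite opprD addrACA (le_trans (ler_normD _ _))//.
apply: (le_trans (lerD (bounded_local_incr g x bF) (jumps_incr mj jC ij gx xn))).
by rewrite addrA mulrDr [Delta x * lam]mulrC [Delta x * rate]mulrC lerD2r.
Qed.

(* The bounded generator [H_n]: births in the cube at a rate ignoring the points
   outside it, and each grid cell is emptied at rate 1. *)
Definition generator_n u g := \int[leb]_y (one y * (bn y g * (u g - u (addp g y)))) +
  \sum_(c : cells n) (u g - u (restr (~` @cell R d n c) g)).

Let generator_nE A u g : measurable_fun setT u -> (forall g, `|u g| <= A) ->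
  generator_n u g = rate * u g - jumps u g.
Proof.
move=> mu uA.
have E : \int[leb]_y (one y * (bn y g * (u g - u (addp g y)))) =
    z * vol * u g - \int[leb]_y brate u (g, y).
  rewrite (_ : z * vol * u g = vol * (z * u g)); last by ring.
  rewrite -int_one_cst -RintegralB//; last exact: int_brate uA.
  by apply: eq_Rintegral => y _; rewrite /brate /=; ring.
rewrite /generator_n E /jumps sumrB sumr_const /rate -mulr_natl; ring.
Qed.

(** The map contracts with ratio rate / (lam + rate), and the residual at the iterate j is - (lam +
    rate) times the next increment of the sequence. Stopping at a finite j makes it at most e and
    keeps the properties of [iterateP] without a limit. *)
Lemma finite_volume_resolvent e : 0 < e -> exists u, [/\ bounded_local n (C / lam) u,
  (forall g x, `|u (addp g x) - u g| <= Delta x) &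
  forall g, `|lam * u g + generator_n u g - F g| <= e].
Proof.
move=> e0; pose r := rate / (lam + rate).
have r0 : 0 <= r by rewrite divr_ge0// ltW.
have r1 : r < 1 by rewrite ltr_pdivrMr// mul1r ltrDr.
have geo j g : `|iterate j.+1 g - iterate j g| <= r ^+ j * (C / lam).
  elim: j g => [|j ih] g.
    by rewrite expr0 mul1r [iterate 0 g]/(0) subr0; have [[_ + _] _] := iterateP 1; exact.
  have [[m1 C1 _] _] := iterateP j; have [[m2 C2 _] _] := iterateP j.+1.
  rewrite [iterate j.+2]/(relax (iterate j.+1)) [iterate j.+1 g]/(relax (iterate j) g).
  rewrite /relax -mulrBl opprD addrACA subrr add0r normrM normfV (gtr0_norm lr_gt0) ler_pdivrMr//.
  apply: (le_trans (jumps_lip g m2 C2 m1 C1 ih)).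
  have rE : r * (lam + rate) = rate by rewrite divfK ?gt_eqF.
  rewrite -[X in X * _ <= _]rE (_ : r * _ * _ = r ^+ j.+1 * (C / lam) * (lam + rate))//.
  by rewrite exprS; move: (lam + rate) (C / lam) => a b; ring.
have : r ^+ j @[j --> \oo] --> (0 : R) by apply: cvg_expr; rewrite ger0_norm.
(* C / lam + 1 in the denominator instead of C / lam covers C = 0. *)
move=> /cvgrPdist_lt /(_ (e / ((lam + rate) * (C / lam + 1)))).
have B0 : 0 < (lam + rate) * (C / lam + 1) by rewrite mulr_gt0// ltr_wpDl// divr_ge0// ltW.
rewrite divr_gt0// => /(_ isT)[j _ /(_ j (leqnn j))] /=; rewrite sub0r normrN => hj.
have [[mj jC lj] ij] := iterateP j; exists (iterate j); split => // g.
rewrite (generator_nE _ mj jC).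
rewrite (_ : _ - _ = - ((lam + rate) * (iterate j.+1 g - iterate j g))); last first.
  have E : iterate j.+1 g * (lam + rate) = F g + jumps (iterate j) g.
    by rewrite [iterate j.+1 g]/(relax (iterate j) g) divfK ?gt_eqF.
  by rewrite mulrBr [_ * iterate j.+1 g]mulrC E; ring.
rewrite normrN normrM (gtr0_norm lr_gt0).
apply: (le_trans (ler_wpM2l (ltW lr_gt0) (geo j g))).
move: hj; rewrite ger0_norm ?exprn_ge0// ltr_pdivlMr// => /ltW; apply: le_trans.
have hA : C / lam <= C / lam + 1 by rewrite lerDl.
by rewrite mulrCA; apply: ler_wpM2l; [exact: exprn_ge0|apply: ler_wpM2l => //; exact: ltW].
Qed.

End finite_volume_resolvent.

Lemma cvg_fine_expeRN (R : realType) (e_ : nat -> \bar R) e : (forall n, 0 <= e_ n)%E -> (0 <= e)%E ->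
  e_ @ \oo --> e -> fine (expeR (- e_ n)) @[n --> \oo] --> fine (expeR (- e)).
Proof.
move=> e_0; case: e => [r| |//] e0 ce.
  have /fine_cvgP[fe cf] := ce.
  apply: (@cvg_trans _ ((fun n => expR (- fine (e_ n))) @ \oo)).
    by apply: near_eq_cvg; apply: filterS fe => n; case: (e_ n).
  apply: (continuous_cvg (h := fun t => expR (- t)) _ _ cf).
  by apply: continuous_comp; [exact: opp_continuous|exact: continuous_expR].
apply/cvgrPdist_lt => eps eps0; have /cvgeyPgt /(_ (- ln eps)) := ce.
apply: filterS => n; have := e_0 n; case: (e_ n) => [r _| _ _|//] /=; last first.
  by rewrite subrr normr0.
rewrite lte_fin sub0r normrN ger0_norm ?expR_ge0// -[X in _ < X -> _]opprK ltrN2 => h.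
by rewrite -[ltRHS]lnK ?posrE// ltr_expR.
Qed.

(** * Increments under the removal of all points of a set *)

Section increments.
Context {R : realType} {d : nat}.
Implicit Types (g : config R d) (x y : 'rV[R]_d).
Variables (u : config R d -> R) (Delta : 'rV[R]_d -> R).
Hypothesis incr : forall g x, `|u (addp g x) - u g| <= Delta x.

Let Delta_ge0 x : 0 <= Delta x. Proof. exact: le_trans (normr_ge0 _) (incr point x). Qed.

Let removal (A : set 'rV[R]_d) s g := foldr (fun x h => if x \in A then delp h x else h) g s.

Let removalE A s g y : points (removal A s g) y <-> points g y /\ ~ (y \in s /\ A y).
Proof.
elim: s => [|x s ih] /=; first by split=> [gy|[]//]; split => // -[].
case: ifPn => xA /=; rewrite inE; split.
- move=> [/ih[gy ns] /eqP yx]; split => // -[/orP[]]; first by rewrite (negbTE yx).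
  by move=> ys Ay; exact: ns.
- move=> [gy ns]; split; first by apply/ih; split => // -[ys Ay]; apply: ns; rewrite ys orbT.
  by move=> /= yx; apply: ns; rewrite yx eqxx; split => //; rewrite -yx; rewrite -yx in xA; exact: set_mem.
- move=> /ih[gy ns]; split => // -[/orP[/eqP yx Ay|ys Ay]]; last exact: ns.
  by rewrite -yx mem_set in xA.
- move=> [gy ns]; apply/ih; split => // -[ys Ay]; apply: ns; by rewrite ys orbT.
Qed.

(** The finitely many points of g in [A] are deleted one at a time and the increments telescoped;
    the order is immaterial, as the increment bound holds at every configuration. *)
Lemma incr_restrC n (A : set 'rV[R]_d) g : A `<=` cube n ->
  `|u g - u (restr (~` A) g)| <= pairing (fun x => \1_A x * Delta x) g.
Proof.
move=> An; pose s : seq 'rV[R]_d := fset_set (g `&` cube n).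
have -> : restr (~` A) g = removal A s g.
  apply: config_eqP; apply/seteqP; split=> y /=.
    by move=> [gy nA]; apply/removalE; split => // -[].
  move=> /removalE[gy ns]; split => // Ay; apply: ns; split => //.
  by rewrite mem_cube_fset; apply/mem_set; split => //; exact: An.
have bs : bsupp n (fun x => \1_A x * Delta x).
  move=> x; apply: contraNP => nx; rewrite indicE memNset ?mul0r// => Ax; apply: nx; exact: An.
rewrite (pairingE _ bs) -/s; elim: s => [|x s ih]; first by rewrite big_nil subrr normr0.
rewrite big_cons /=; case: ifPn => xA; last by rewrite indicE (negbTE xA) mul0r add0r.
rewrite indicE xA mul1r [leRHS]addrC.
rewrite (_ : _ - _ = (u g - u (removal A s g)) + (u (removal A s g) - u (delp (removal A s g) x))); last by ring.
rewrite (le_trans (ler_normD _ _))// lerD// distrC.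
have [px|px] := pselect (points (removal A s g) x); first exact: incr_delp.
by rewrite delp_notin// subrr normr0.
Qed.

End increments.

(** * The error between the generator and its finite-volume approximation *)

Section volume_errors.
Context {R : realType} {d : nat}.
Hypothesis d_gt0 : (0 < d)%N.
Variables (phi : 'rV[R]_d -> \bar R) (z : R).
Hypothesis phi_pot : pair_potential phi.
Hypothesis phi_ge0 : forall x, (0 <= phi x)%E.
Hypothesis z_gt0 : 0 < z.
Implicit Types (g : config R d) (x y : 'rV[R]_d) (u v : config R d -> R).
Local Notation bw := (bw phi).
Local Notation leb := (lebesgue_rV d : {measure set 'rV[R]_d -> \bar R}).
Variables (Delta : 'rV[R]_d -> R).
Hypotheses (mDelta : measurable_fun setT Delta) (Delta_ge0 : forall x, 0 <= Delta x).
Hypothesis int_Delta : (\int[leb]_x (Delta x)%:E < +oo)%E.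

(** Monotone convergence for the counting measure of g, as phi >= 0; a limit +oo is included. *)
Lemma energy_cvg x g : energy phi x (restr (cube n) g) @[n --> \oo] --> energy phi x g.
Proof.
pose f n y : \bar R := ((\1_(cube n) y)%:E * phi (x - y))%E.
have mphi : measurable_fun setT (fun y => phi (x - y)).
  apply: (measurableT_comp (measurable_phi phi_pot)).
  by exact: measurable_funB_rV.
have mf n : measurable_fun setT (f n).
  apply: emeasurable_funM => //; apply/measurable_EFinP; apply: measurable_indic.
  exact: measurable_cube.
have f0 n y : (0 <= f n y)%E by rewrite mule_ge0// lee_fin.
have fnd y : {homo f^~ y : n m / (n <= m)%N >-> (n <= m)%E}.
  move=> n m nm; apply: lee_wpmul2r => //; rewrite lee_fin !indicE ler_nat.
  case: (boolP (y \in cube n)) => // /set_mem yn.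
  by rewrite mem_set//; exact: le_cube nm _ yn.
have E n : energy phi x (restr (cube n) g) = (\int[npoints g]_y f n y)%E.
  rewrite energyE// integral_npoints// esum_mkcondr; apply: eq_esum => y _.
  by rewrite /f indicE; case: ifPn => _; rewrite ?mul1e ?mul0e.
under eq_fun do rewrite E.
have := @cvg_monotone_convergence _ _ R (npoints g) setT measurableT f mf (fun n y _ => f0 n y) (fun y _ => fnd y).
rewrite (_ : (\int[npoints g]_y _)%E = energy phi x g)//.
rewrite energyE// -integral_npoints//; apply: eq_integral => y _.
apply: cvg_lim => //; have [N yN] := cube_ex y.
apply: cvg_near_cst; exists N => // n /= Nn.
by rewrite /f indicE mem_set ?mul1e//; exact: le_cube Nn _ yN.
Qed.

Lemma bw_cvg x g : bw x (restr (cube n) g) @[n --> \oo] --> bw x g.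
Proof.
apply: cvg_fine_expeRN; last exact: energy_cvg.
- by move=> n; exact: energy_ge0.
- exact: energy_ge0.
Qed.

Lemma bw_restr_ge x n g : bw x g <= bw x (restr (cube n) g).
Proof.
rewrite -lee_fin !EFin_bw// lee_expeR leeN2 !energyE// esum_mkcondr; apply: le_esum => y _.
by case: ifP.
Qed.

Definition birth_error n g := \int[leb]_x (z * (bw x (restr (cube n) g) - bw x g) * Delta x).

(** The cells of level n have sup-norm diameter less than 1 / n, so two points sharing a cell are
    both crowded. *)
Definition crowded n g : set 'rV[R]_d :=
  [set x | points g x /\ exists y, [/\ points g y, y <> x & `|x - y| < n%:R^-1]].

(** The factor 2 covers one Delta for the single death of x and one for its share in the emptying of
    its cell. *)
Let death_bound n g x := 2 * Delta x * \1_(crowded n g) x.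

Definition death_error n g := fine (\int[npoints g]_x (death_bound n g x)%:E).

Let mdeath n g : measurable_fun setT (death_bound n g).
Proof.
apply: measurable_funM; first exact: measurable_funM.
apply: measurable_indic.
have h : countable (crowded n g).
  by apply: sub_countable (countable_config g); apply: subset_card_le => x [].
by have [] := lebesgue_rV_countable d_gt0 h.
Qed.

Let zDelta x n g : 0 <= z * (bw x (restr (cube n) g) - bw x g) * Delta x <= z * Delta x.
Proof.
have h1 := bw_restr_ge x n g; have h2 := bw_ge0 phi_ge0 x g; have h3 := bw_le1 phi_ge0 x (restr (cube n) g).
rewrite -mulrA; apply/andP; split.
  by rewrite !mulr_ge0 ?subr_ge0// ltW.
by apply: ler_wpM2l; [exact: ltW|apply: ler_piMl => //; lra].
Qed.

Let mzDelta n g : measurable_fun setT (fun x => z * (bw x (restr (cube n) g) - bw x g) * Delta x).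
Proof.
apply: measurable_funM => //; apply: measurable_funM => //.
by apply: measurable_funB; apply: measurable_bw.
Qed.

Let int_zDelta : leb.-integrable setT (EFin \o (fun x => z * Delta x)).
Proof.
have iD : leb.-integrable setT (EFin \o Delta).
  by apply: (integrable_abs_le mDelta mDelta) => // x; rewrite ger0_norm.
by apply: (integrableZl measurableT z) iD.
Qed.

Let int_birth n g :
  leb.-integrable setT (EFin \o (fun x => z * (bw x (restr (cube n) g) - bw x g) * Delta x)).
Proof.
apply: (le_integrable measurableT _ _ int_zDelta); first exact/measurable_EFinP.
by move=> x _ /=; rewrite lee_fin; have /andP[h1 h2] := zDelta x n g; rewrite !ger0_norm// (le_trans h1).
Qed.

Lemma birth_error_cvg g : birth_error n g @[n --> \oo] --> (0 : R).
Proof.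
have [] := @dominated_convergence _ _ R leb setT measurableT
   (fun n x => (z * (bw x (restr (cube n) g) - bw x g) * Delta x)%:E) (cst 0%E) (fun x => (z * Delta x)%:E).
- by move=> n; exact/measurable_EFinP.
- exact: measurable_cst.
- apply: aeW => x _; apply: cvg_EFin; first exact: nearW.
  have -> : (0 : R) = z * (bw x g - bw x g) * Delta x by rewrite subrr mulr0 mul0r.
  apply: cvgM; last exact: cvg_cst.
  apply: cvgM; first exact: cvg_cst.
  by apply: cvgB; [exact: bw_cvg|exact: cvg_cst].
- exact: int_zDelta.
- apply: aeW => x n _ /=; rewrite lee_fin.
  by have /andP[h1 h2] := zDelta x n g; rewrite ger0_norm.
move=> _ _; rewrite integral_cst// mul0e => h; exact: fine_cvg h.
Qed.

Let int_death g : (sum_points Delta g < +oo)%E ->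
  (npoints g).-integrable setT (EFin \o (fun x => 2 * Delta x)).
Proof.
move=> Soo.
have iD : (npoints g).-integrable setT (EFin \o Delta).
  apply: (integrable_abs_le mDelta mDelta); last by move=> x; rewrite ger0_norm.
  have mDE : measurable_fun setT (EFin \o Delta) by exact/measurable_EFinP.
  by rewrite integral_npoints// => x; rewrite lee_fin.
by apply: (integrableZl measurableT 2) iD.
Qed.

Let death_bound_itv n g x : 0 <= death_bound n g x <= 2 * Delta x.
Proof.
rewrite /death_bound; have D0 : 0 <= 2 * Delta x by rewrite mulr_ge0.
by rewrite mulr_ge0//= ler_piMr// indicE lern1 leq_b1.
Qed.

(** Only the finitely many points of g in a larger cube can be within distance 1 of x, and any n
    above the inverses of their distances to x excludes them. *)
Let not_crowded g x : exists N, forall n, (N <= n)%N -> ~ crowded n g x.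
Proof.
have [gx|gx] := pselect (points g x); last by exists 0%N => n _ [].
have [M xM] := cube_ex x.
pose s : seq 'rV[R]_d := fset_set (g `&` cube M.+1).
exists (\max_(y <- s) Num.bound (`|x - y|^-1)%R).+1 => n Nn [_ [y [gy yx xy]]].
have n1 : (0 < n)%N by exact: leq_trans Nn.
have r0 : 0 < `|x - y| by rewrite normr_gt0 subr_eq0; apply/eqP => /esym.
have ys : y \in s.
  rewrite mem_cube_fset; apply/mem_set; split => //=.
  rewrite /cube/= (_ : y = x - (x - y)); last by rewrite opprB addrC subrK.
  rewrite (le_lt_trans (ler_normB _ _))// -natr1 ltr_leD//.
  by rewrite (le_trans (ltW xy))// invf_le1 ?ltr0n// ler1n.
have h1 : (Num.bound (`|x - y|^-1)%R < n)%N.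
  by apply: leq_trans Nn; rewrite ltnS; exact: (leq_bigmax_seq (F := fun y => Num.bound `|x - y|^-1)).
have h2 : `|x - y|^-1 < n%:R.
  rewrite (lt_trans (archi_boundP _)) ?ltr_nat ?invr_ge0//.
by move: xy; rewrite ltNge -(invrK `|x - y|) lef_pV2 ?posrE ?invr_gt0 ?ltr0n// (ltW h2).
Qed.

Lemma death_error_cvg g : (sum_points Delta g < +oo)%E -> death_error n g @[n --> \oo] --> (0 : R).
Proof.
move=> Soo.
have [] := @dominated_convergence _ _ R (npoints g) setT measurableT
   (fun n x => (death_bound n g x)%:E) (cst 0%E) (fun x => (2 * Delta x)%:E).
- by move=> n; exact/measurable_EFinP.
- exact: measurable_cst.
- apply: aeW => x _; apply: cvg_EFin; first exact: nearW.
  have [N hN] := not_crowded g x.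
  by apply: cvg_near_cst; exists N => // n /= /hN nc; rewrite /death_bound indicE memNset// mulr0.
- exact: int_death.
- apply: aeW => x n _ /=; rewrite lee_fin.
  by have /andP[h1 h2] := death_bound_itv n g x; rewrite ger0_norm.
move=> _ _; rewrite integral_cst// mul0e => h; exact: fine_cvg h.
Qed.

Section one_function.
Variables (n : nat) (C : R) (u : config R d -> R).
Hypothesis bu : bounded_local n C u.
Hypothesis incr : forall g x, `|u (addp g x) - u g| <= Delta x.

Let death g x := u (delp g x) - u g.

(** An empty cell contributes nothing, and a cell with one point exactly cancels, since emptying it
    deletes that point. With two or more points, all of them are crowded, and the single deaths and
    the emptying are each bounded by the sum of Delta. *)
Let cell_error g (c : cells (d := d) n) :
  `|pairing (fun x => \1_(@cell R d n c) x * death g x) g + (u g - u (restr (~` @cell R d n c) g))| <=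
  pairing (fun x => \1_(@cell R d n c) x * death_bound n g x) g.
Proof.
set A := @cell R d n c.
have bA (f : 'rV[R]_d -> R) : bsupp n (fun x => \1_A x * f x) := @bsupp_cell R d n c f.
have [[x [y [gx gy xA yA yx]]]|none] :=
    pselect (exists x y, [/\ points g x, points g y, A x, A y & y <> x]).
  have h1 := incr_restrC incr g (@cell_cube R d n c).
  have h2 : `|pairing (fun x => \1_A x * death g x) g| <= pairing (fun x => \1_A x * Delta x) g.
    rewrite !(pairingE _ (bA _)) (le_trans (ler_norm_sum _ _ _))//.
    rewrite big_seq [leRHS]big_seq; apply: ler_sum => w; rewrite mem_cube_fset => /set_mem[gw _].
    by rewrite normrM ger0_norm// ler_wpM2l//; exact: incr_delp.
  rewrite (le_trans (ler_normD _ _))// (le_trans (lerD h2 h1))//.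
  rewrite !(pairingE _ (bA _)) -big_split /= big_seq [leRHS]big_seq; apply: ler_sum => w.
  rewrite mem_cube_fset => /set_mem[gw _]; rewrite /death_bound.
  have [wA|wA] := pselect (A w); last by rewrite indicE memNset// !mul0r addr0.
  rewrite (@indicE _ _ (crowded n g)) mem_set; first by rewrite mulr1 mulr_natl mulr2n mulrDr.
  split => //; have [wx|wx] := pselect (w = x).
    by exists y; split => //; [rewrite wx|exact: cell_diam wA yA].
  by exists x; split => //; [exact/nesym|exact: cell_diam wA xA].
have RHS0 : 0 <= pairing (fun x => \1_A x * death_bound n g x) g.
  apply: (pairing_ge0 (n := n)); [exact: bA|move=> w; rewrite mulr_ge0//].
  by have /andP[] := death_bound_itv n g w.
apply: le_trans RHS0; rewrite normr_le0; apply/eqP.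
have [[x [gx xA]]|empty] := pselect (exists x, points g x /\ A x); last first.
  have -> : restr (~` A) g = g.
    apply: config_eqP; apply/seteqP; split=> [y []//|y gy]; split => // yA.
    by apply: empty; exists y.
  rewrite subrr addr0 (pairingE _ (bA _)) big_seq big1// => y.
  rewrite mem_cube_fset => /set_mem[gy _]; rewrite indicE memNset ?mul0r// => yA.
  by apply: empty; exists y.
have uniq y : points g y -> A y -> y = x.
  by move=> gy yA; apply: contrapT => yx; apply: none; exists x, y.
have -> : restr (~` A) g = delp g x.
  apply: config_eqP; apply/seteqP; split=> y [gy yA]; split => //.
  - by move=> /= yx; apply: yA; rewrite yx.
  - by move=> Ay; apply: yA; exact: uniq.
have xs : x \in fset_set (g `&` cube n).
  by rewrite mem_cube_fset; apply/mem_set; split => //; exact: cell_cube xA.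
rewrite (pairingE _ (bA _)) (bigD1_seq x xs (fset_uniq _))/=.
rewrite big1_seq ?addr0 => [|y /andP[yx]]; last first.
  rewrite mem_cube_fset => /set_mem[gy _]; rewrite indicE memNset ?mul0r// => yA.
  by move: yx; rewrite (uniq y)// eqxx.
by rewrite indicE mem_set// mul1r /death; ring.
Qed.

(** Births outside the cube do not change the local function u, so the birth terms differ only in
    their rates; the death terms are compared cell by cell. *)
Lemma generator_n_error g : (sum_points Delta g < +oo)%E ->
  `|generator z phi u g - generator_n phi z n u g| <= birth_error n g + death_error n g.
Proof.
move=> Soo; have [mu uC lu] := bu; rewrite generatorE /generator_n.
set b1 := \int[leb]_x _; set b2 := \int[leb]_x _; set dp := pairing _ g; set sc := (X in _ - (_ + X)).
rewrite (_ : b1 - dp - (b2 + sc) = (b1 - b2) - (dp + sc)); last by ring.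
rewrite (le_trans (ler_normB _ _))// lerD//.
  have E2 : b2 = \int[leb]_x (z * bw x (restr (cube n) g) * (u g - u (addp g x))).
    apply: eq_Rintegral => x _; rewrite /bn indicE.
    have [xn|xn] := pselect (cube n x); first by rewrite mem_set// mul1r.
    by rewrite (local_addp g lu xn) subrr !mulr0.
  have i1 : leb.-integrable setT (EFin \o (fun x => z * bw x g * (u g - u (addp g x)))).
    exact: (integrable_birth_cube phi_pot phi_ge0 z_gt0 bu g).
  have i2 : leb.-integrable setT (EFin \o (fun x => z * bw x (restr (cube n) g) * (u g - u (addp g x)))).
    apply: (le_integrable measurableT _ _ int_zDelta).
      apply/measurable_EFinP; apply: measurable_funM.
        by apply: measurable_z_bw.
      by apply: measurable_funB => //; exact: (measurableT_comp (measurable_u_addp mu) (measurable_pair1 g)).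
    move=> x _ /=; rewrite lee_fin [leRHS]ger0_norm; last by rewrite mulr_ge0// ltW.
    rewrite normrM ger0_norm ?z_bw_ge0// ler_pM ?z_bw_ge0 ?z_bw_le//.
    by rewrite distrC.
  have i12 : leb.-integrable setT (EFin \o (fun x => z * bw x g * (u g - u (addp g x)) -
      z * bw x (restr (cube n) g) * (u g - u (addp g x)))) by exact: integrableB i1 i2.
  rewrite E2 -RintegralB//; apply: (le_trans (le_normr_Rintegral _ i12)) => //.
  apply: le_Rintegral => //; first exact: integrable_norm i12.
  move=> x _; rewrite -mulrBl -mulrBr !normrM (gtr0_norm z_gt0) -!mulrA.
  apply: ler_wpM2l; first exact: ltW.
  apply: ler_pM => //; last by rewrite distrC.
  by rewrite distrC ger0_norm// subr_ge0 bw_restr_ge.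
rewrite /dp (pairing_cells _ (bsupp_death (g := g) lu)) -big_split /=.
rewrite (le_trans (ler_norm_sum _ _ _))//.
apply: (@le_trans _ _ (\sum_(c : cells n) pairing (fun x => \1_(@cell R d n c) x * death_bound n g x) g)).
  by apply: ler_sum => c _; exact: cell_error.
pose w x := \1_(cube n) x * death_bound n g x.
have bw' : bsupp n w.
  by move=> x; apply: contraNP => nx; rewrite /w indicE memNset// mul0r.
have -> : \sum_(c : cells n) pairing (fun x => \1_(@cell R d n c) x * death_bound n g x) g = pairing w g.
  rewrite (pairing_cells _ bw'); apply: eq_bigr => c _; congr pairing; apply/funext => x.
  rewrite /w; have [xc|xc] := pselect (@cell R d n c x); last by rewrite indicE memNset// !mul0r.
  by rewrite [\1_(cube n) x]indicE mem_set ?mul1r//; exact: cell_cube xc.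
have db0 x := proj1 (andP (death_bound_itv n g x)).
have fin : (\int[npoints g]_x (death_bound n g x)%:E)%E \is a fin_num.
  rewrite ge0_fin_numE; last by apply: integral_ge0 => x _; rewrite lee_fin.
  have /integrableP[_] := int_death Soo; apply: le_lt_trans; apply: ge0_le_integral => //=.
  - by move=> x _; rewrite lee_fin.
  - exact/measurable_EFinP.
  - by apply/measurable_EFinP; apply: measurableT_comp => //; exact: measurable_funM.
  - by move=> x _; have /andP[_ h] := death_bound_itv n g x; rewrite lee_fin (le_trans h)// ler_norm.
rewrite -lee_fin /death_error fineK// -(esum_bsupp g bw'); last by move=> x; rewrite mulr_ge0.
have mdE : measurable_fun setT (EFin \o death_bound n g) by exact/measurable_EFinP.
have dE0 x : (0 <= (death_bound n g x)%:E)%E by rewrite lee_fin.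
rewrite integral_npoints//.
by apply: le_esum => x _; rewrite lee_fin ler_piMl// indicE lern1 leq_b1.
Qed.

End one_function.
End volume_errors.

(** * Density of the range of lam + H *)

Section resolvent.
Context {R : realType} {d : nat}.
Hypothesis d_gt0 : (0 < d)%N.
Variables (phi : 'rV[R]_d -> \bar R) (z : R) (mu : probability (config R d) R).
Hypothesis phi_pot : pair_potential phi.
Hypothesis phi_ge0 : forall x, (0 <= phi x)%E.
Local Notation leb := (lebesgue_rV d : {measure set 'rV[R]_d -> \bar R}).
Hypothesis phi_int : (\int[leb]_x `|1 - expeR (- phi x)| < +oo)%E.
Hypothesis z_gt0 : 0 < z.
Hypothesis mu_gibbs : gibbs z phi mu.
Implicit Types (g : config R d) (x : 'rV[R]_d).
Local Notation gen := (generator z phi).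
Local Notation nrm := (nrm mu).

Let k x : R := 1 - pw phi x.

Let k0 x : 0 <= k x.
Proof. by rewrite subr_ge0; have /andP[] := pw_itv phi_ge0 x. Qed.

Let kN x : k (- x) = k x.
Proof.
have [->|x0] := eqVneq x 0; first by rewrite oppr0.
by have [_ _ /(_ x x0)[h _]] := phi_pot; rewrite /k /pw h.
Qed.

Let mk : measurable_fun setT k.
Proof. by apply: measurable_funB => //; exact: measurable_pw. Qed.

Let int_k : (\int[leb]_x (k x)%:E < +oo)%E.
Proof.
rewrite (eq_integral (fun x => `|1 - expeR (- phi x)|%E))// => x _.
by rewrite (expeRN_fin (phi_ge0 x)) -EFinB abse_EFin ger0_norm// k0.
Qed.

Let lam := 1 + z * \int[leb]_x k x.

Lemma resolvent_rate_gt0 : 0 < lam.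
Proof.
by rewrite ltr_pwDl//; apply: mulr_ge0; [exact: ltW|exact: Rintegral_ge0].
Qed.

(** Delta depends on F but not on the volume. The cubes start at the one carrying F and the
    tolerances 1 / (j + 1) tend to 0, so the residuals f_j tend to 0 almost surely. *)
Lemma resolvent_dense F e : cylinder F -> 0 < e -> exists n C u,
  bounded_local n C u /\ nrm ((fun g => lam * u g + gen u g) \- F) < e.
Proof.
move=> cF e0; have [m [C bF]] := cylinder_bounded_local cF.
have [mF FC lF] := bF; have C0 := bounded_local_ge0 bF; have lam0 := resolvent_rate_gt0.
have C2 : 0 <= 2 * C by rewrite mulr_ge0.
have [Delta [mD D0C intD maj]] := majorant_ex m mk k0 kN int_k (ltW z_gt0) C2.
have D0 x : 0 <= Delta x by have /andP[] := D0C x.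
have DC x : Delta x <= 2 * C by have /andP[] := D0C x.
have /choice[u_ hu] j : exists u, [/\ bounded_local (m + j) (C / lam) u,
    forall g x, `|u (addp g x) - u g| <= Delta x &
    forall g, `|lam * u g + generator_n phi z (m + j) u g - F g| <= j.+1%:R^-1].
  exact: (finite_volume_resolvent phi_pot phi_ge0 z_gt0 (leq_addr j m) bF lam0 mD D0 DC maj int_k).
(* One C bounds lam u_j, the other bounds F; the remaining terms come from [generator_le]. *)
pose h g := (2 * C + z * (\int[leb]_x Delta x)) + fine (sum_points Delta g).
have Soo := sum_points_ae_fin phi_pot phi_ge0 z_gt0 mu_gibbs mD D0 intD.
pose f_ j g := lam * u_ j g + gen (u_ j) g - F g.
have [N hN] : exists N, forall j, (N <= j)%N -> nrm (f_ j \- cst 0) < e.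
  apply: (L2_dominated_cvg (h := h)) => //.
  - move=> j; have [[mj _ lj] _ _] := hu j; apply: measurable_funB => //; apply: measurable_funD.
      exact: measurable_funM.
    exact: measurable_generator lj.
  - apply: L2_D; last exact: (L2_sum_points phi_pot phi_ge0 z_gt0 mu_gibbs mD D0 DC intD).
    by apply: (@L2_bounded _ _ _ `|2 * C + z * (\int[leb]_x Delta x)|).
  - apply: filterS Soo => g Sg.
    pose b_ j := j.+1%:R^-1 + (birth_error phi z Delta (m + j) g + death_error Delta (m + j) g).
    apply/norm_cvg0P; apply: (@squeeze_cvgr _ _ _ _ (cst 0) b_).
    + apply: nearW => j; rewrite normr_ge0/=; have [bj ij rj] := hu j.
      have er := generator_n_error d_gt0 phi_pot phi_ge0 z_gt0 mD D0 intD bj ij Sg.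
      rewrite (_ : f_ j g = (lam * u_ j g + generator_n phi z (m + j) (u_ j) g - F g) +
        (gen (u_ j) g - generator_n phi z (m + j) (u_ j) g)); last by rewrite /f_; ring.
      by rewrite (le_trans (ler_normD _ _))// lerD.
    + exact: cvg_cst.
    rewrite (_ : 0 = 0 + (0 + 0) :> R); last by rewrite !addr0.
    apply: cvgD; first exact: cvg_harmonic.
    apply: cvgD.
      exact: cvg_comp (cvg_addnl m) (birth_error_cvg phi_pot phi_ge0 z_gt0 mD D0 intD g).
    exact: cvg_comp (cvg_addnl m) (death_error_cvg d_gt0 mD D0 Sg).
  - apply: filterS Soo => g Sg j; have [bj ij rj] := hu j; have [mj jC lj] := bj.
    have h1 := generator_le phi_pot phi_ge0 z_gt0 mD intD mj lj ij Sg.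
    have h2 : `|lam * u_ j g| <= C.
      by rewrite normrM (gtr0_norm lam0) mulrC -ler_pdivlMr.
    rewrite /f_ (le_trans (ler_normB _ _))// (le_trans (lerD (ler_normD _ _) (FC g)))//.
    have := lerD (lerD h2 h1) (lexx C); rewrite /h; lra.
have [bN _ _] := hu N; exists (m + N)%N, (C / lam), (u_ N); split => //.
have := hN N (leqnn N).
by rewrite (_ : f_ N \- cst 0 = (fun g => lam * u_ N g + gen (u_ N) g) \- F)//; apply/funext => g /=; rewrite subr0.
Qed.

End resolvent.

Theorem theorem4p1 (R : realType) (d : nat) (d_gt0 : (0 < d)%N)
    (phi : 'rV[R]_d -> \bar R) (phi_pot : pair_potential phi)
    (phi_ge0 : forall x, (0 <= phi x)%E)
    (phi_int : (\int[lebesgue_rV d]_x `|1 - expeR (- phi x)| < +oo)%E)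
    (z : R) (z_gt0 : 0 < z)
    (mu : probability (config R d) R) (mu_gibbs : gibbs z phi mu) :
  let H := operatorH z phi mu in
  [/\ forall F, cylinder F ->
        F \in Lfun mu 2%:E /\ generator z phi F \in Lfun mu 2%:E,
      symmetric_op H /\ nonnegative_op H,
      essentially_selfadjoint H &
      friedrichs H = op_closure H].
Proof.
move=> H.
have Hsym : symmetric_op H by exact: operatorH_symmetric.
have Hge0 : nonnegative_op H by exact: operatorH_nonnegative.
have Hlin : lin_closed H by exact: operatorH_lin_closed.
have Hdense : densely_defined H by exact: operatorH_dense.
have lam0 := resolvent_rate_gt0 phi_ge0 z_gt0.
have Hrange := operatorH_range phi_pot phi_ge0 z_gt0 mu_gibbs lam0
  (fun F e => @resolvent_dense R d d_gt0 phi z mu phi_pot phi_ge0 phi_int z_gt0 mu_gibbs F e).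
have [Hess Hfri] := essentially_selfadjoint_friedrichs Hlin Hsym Hge0 Hdense lam0 Hrange.
split => // F cF; exact: (cylinder_L2 phi_pot phi_ge0 z_gt0 mu_gibbs).
Qed.
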